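(* Let $d\in\mathbb{N}$, let $n$ be a prime, let $\alpha>1/2$, and let $\boldsymbol{\gamma}=(\gamma_1,\gamma_2,\ldots)$ satisfy $1\ge\gamma_1\ge\gamma_2\ge\cdots>0$. Let $\boldsymbol{z}\in\{0,1,\ldots,n-1\}^d$ be the generating vector obtained, in $\mathcal{O}(d\,n\log n)$ operations, by a fast component-by-component algorithm using the squared worst-case error of a lattice rule in the Korobov space $E_{d,\alpha,\boldsymbol{\gamma}/2}$ as the search criterion. Then there exists a shift $\boldsymbol{\Delta}\in[0,1]^d$ such that $$e^{\mathrm{wor}}(Q_n(\cdot\circ\psi;\boldsymbol{z},\boldsymbol{\Delta});C_{d,\alpha,\boldsymbol{\gamma}})\le e^{\mathrm{wor}}_{\mathrm{rms}}(Q_n^{\mathrm{ran}}(\cdot\circ\psi;\boldsymbol{z});C_{d,\alpha,\boldsymbol{\gamma}})=e^{\mathrm{wor}}(Q_n(\cdot;\boldsymbol{z});E_{d,\alpha,\boldsymbol{\gamma}/2})$$ $$\le\left(\frac{1}{n-1}\left(\prod_{j=1}^d\big(1+2^{1-\lambda}\zeta(2\alpha\lambda)\gamma_j^\lambda\big)-1\right)\right)^{1/(2\lambda)}$$ for all $1/(2\alpha)<\lambda\le1$, where $\zeta$ is the Riemann zeta function. Hence, for each such $\lambda$, the convergence rate is $\mathcal{O}(n^{-1/(2\lambda)})$, with implied constant independent of $d$ if $\sum_{j=1}^\infty\gamma_j^\lambda<\infty$. Letting $\lambda\to1/(2\alpha)$, for fixed $d$ the method achieves a rate $\mathcal{O}(n^{-\alpha+\delta})$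 for every $\delta>0$, i.e. arbitrarily close to $\mathcal{O}(n^{-\alpha})$, which is the optimal rate for integration in $C_{d,\alpha,\boldsymbol{\gamma}}$ (no sequence of $n$-point linear cubature rules achieves $\mathcal{O}(n^{-\beta})$ with $\beta>\alpha$).
   Context: Notation. $\mathbb{Z}_+=\{0,1,2,\ldots\}$; $\boldsymbol{\gamma}/2=(\gamma_1/2,\gamma_2/2,\ldots)$. For $\boldsymbol{k}\in\mathbb{Z}^d$, $|\boldsymbol{k}|_0$ is the number of non-zero components. The half-period cosine basis of $L_2([0,1]^d)$ is $\phi_{\boldsymbol{k}}(\boldsymbol{x})=(\sqrt2)^{|\boldsymbol{k}|_0}\prod_{j=1}^d\cos(\pi k_jx_j)$, $\boldsymbol{k}\in\mathbb{Z}_+^d$, and $\hat f(\boldsymbol{k})=\int_{[0,1]^d}f\phi_{\boldsymbol{k}}$. Fourier coefficients are $\widetilde f(\boldsymbol{h})=\int_{[0,1]^d}f(\boldsymbol{x})e^{-2\pi\mathrm{i}\boldsymbol{h}\cdot\boldsymbol{x}}d\boldsymbol{x}$, $\boldsymbol{h}\in\mathbb{Z}^d$. For $\boldsymbol{k}\in\mathbb{Z}^d$, $r_{\alpha,\boldsymbol{\gamma}}(\boldsymbol{k})=\prod_{j=1}^d r_{\alpha,\gamma_j}(k_j)$, where $r_{\alpha,\gamma_j}(0)=1$ and $r_{\alpha,\gamma_j}(k)=|k|^{2\alpha}/\gamma_j$ for $k\ne0$. Cosine space: $C_{d,\alpha,\boldsymbol{\gamma}}=\{f\in L_2([0,1]^d):\|f\|^2=\sum_{\boldsymbol{k}\in\mathbb{Z}_+^d}|\hat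 f(\boldsymbol{k})|^2r_{\alpha,\boldsymbol{\gamma}}(\boldsymbol{k})<\infty\}$. Korobov space: $E_{d,\alpha,\boldsymbol{\gamma}}=\{f\in L_2([0,1]^d):\|f\|^2=\sum_{\boldsymbol{h}\in\mathbb{Z}^d}|\widetilde f(\boldsymbol{h})|^2r_{\alpha,\boldsymbol{\gamma}}(\boldsymbol{h})<\infty\}$. Functions are complex-valued; for $\alpha>1/2$ both are reproducing kernel Hilbert spaces, functions being identified with their continuous representatives given by their cosine, respectively Fourier, series. Lattice rule: $Q_n(f;\boldsymbol{z})=\frac1n\sum_{i=1}^nf(\tfrac{i\boldsymbol{z}}n\bmod1)$. Tent transformation: $\psi(x)=1-|2x-1|$ on $[0,1]$, applied componentwise. Tent-transformed shifted lattice rule: $Q_n(f\circ\psi;\boldsymbol{z},\boldsymbol{\Delta})=\frac1n\sum_{i=1}^nf\big(\psi((\tfrac{i\boldsymbol{z}}n+\boldsymbol{\Delta})\bmod1)\big)$. $Q_n^{\mathrm{ran}}(\cdot\circ\psi;\boldsymbol{z})$ is the randomized method with $\boldsymbol{\Delta}$ uniform on $[0,1]^d$. Worst-case integration error: $e^{\mathrm{wor}}(Q;H)=\sup_{f\in H,\|f\|_H\le1}|\int_{[0,1]^d}f(\boldsymbol{x})\,d\boldsymbol{x}-Q(f)|$. Root-mean-squared worst-case error: $e^{\mathrm{wor}}_{\mathrm{rms}}(Q_n^{\mathrm{ran}}(\cdot\circ\psi;\boldsymbol{z});C_{d,\alpha,\boldsymbol{\gamma}})=\Big(\int_{[0,1]^d}e^{\mathrm{wor}}(Q_n(\cdot\circ\psi;\boldsymbol{z},\boldsymbol{\Delta});C_{d,\alpha,\boldsymbol{\gamma}})^2\,d\boldsymbol{\Delta}\Big)^{1/2}$.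 For a lattice rule in a Korobov space it is known that $e^{\mathrm{wor}}(Q_n(\cdot;\boldsymbol{z});E_{d,\alpha,\boldsymbol{\gamma}})^2=\sum_{\boldsymbol{0}\ne\boldsymbol{k}\in\mathbb{Z}^d,\ \boldsymbol{k}\cdot\boldsymbol{z}\equiv0\,(n)}1/r_{\alpha,\boldsymbol{\gamma}}(\boldsymbol{k})$. Component-by-component algorithm: the components of $\boldsymbol{z}$ are chosen successively; for $s=1,\ldots,d$, with $z_1,\ldots,z_{s-1}$ already fixed, $z_s\in\{1,\ldots,n-1\}$ is chosen to minimize the search criterion in dimension $s$, here $e^{\mathrm{wor}}(Q_n(\cdot;(z_1,\ldots,z_s));E_{s,\alpha,\boldsymbol{\gamma}/2})^2$. ''Fast'' refers to an FFT-based implementation of this search with the stated cost. *)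

(* Defs.v *)
From HB Require Import structures.
From mathcomp Require Import all_boot all_order all_algebra finmap.
From mathcomp Require Import complex.
From mathcomp Require Import all_classical all_reals all_analysis.

Set Implicit Arguments.
Unset Strict Implicit.
Unset Printing Implicit Defensive.

Import Order.TTheory GRing.Theory Num.Theory.
Import numFieldNormedType.Exports.

Local Open Scope classical_set_scope.
Local Open Scope ring_scope.
Local Open Scope complex_scope.

(* Conventions.
   - Points of R^d are d-tuples.  A function on [0,1]^d is a total function on
     d-tuples of which only the values on [cube R d] are ever used.
   - Weights are sequences indexed from 0: [g j] is gamma_{j+1}.
   - Possibly infinite quantities (norms, worst-case errors) live in \bar R. *)

Section Cube.
Variable R : realType.

Definition cube (d : nat) : set (d.-tuple R) :=
  [set x | forall j, 0 <= tnth x j <= 1].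

Definition tcons (d : nat) (p : measurableTypeR R * d.-tuple R) : d.+1.-tuple R :=
  [tuple of p.1 :: p.2].

Lemma measurable_tcons (d : nat) : measurable_fun setT (@tcons d).
Proof.
apply: measurable_cons; last exact: measurable_snd.
exact: (@measurable_fst _ _ (measurableTypeR R) (d.-tuple R)).
Qed.

HB.instance Definition _ (d : nat) :=
  isMeasurableFun.Build _ _ _ _ (@tcons d) (@measurable_tcons d).

(* Lebesgue measure on [0,1]^d: the d-fold product of the uniform law. *)
Fixpoint cube_measure (d : nat) : probability (d.-tuple R) R :=
  if d is d'.+1 return probability (d.-tuple R) R
  then distribution (uniform_prob (@ltr01 R) \x cube_measure d')%E (@tcons d')
  else \d_([tuple] : 0.-tuple R).

End Cube.

Arguments cube R d : clear implicits.
Arguments cube_measure R d : clear implicits.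

Section Spaces.
Variable R : realType.

Notation normc := Normc.normc.

Definition cint (d : nat) (f : d.-tuple R -> R[i]) : R[i] :=
  Rintegral (cube_measure R d) (cube R d) (fun x => complex.Re (f x)) +i*
  Rintegral (cube_measure R d) (cube R d) (fun x => complex.Im (f x)).

Definition L2 (d : nat) : set (d.-tuple R -> R[i]) :=
  [set f : d.-tuple R -> R[i] |
           [/\ measurable_fun (cube R d) (fun x => complex.Re (f x)),
               measurable_fun (cube R d) (fun x => complex.Im (f x)) &
               (\int[cube_measure R d]_(x in cube R d)
                   (normc (f x) ^+ 2)%:E < +oo)%E]].

(* Unconditional convergence of a family of complex numbers. *)
Definition has_sum (I : choiceType) (a : I -> R[i]) (s : R[i]) : Prop :=
  forall e : R, 0 < e -> exists A : {fset I}, forall B : {fset I},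
    (A `<=` B)%fset -> normc (\sum_(i <- B) a i - s) < e.

Definition rfac (a g : R) (k : int) : R :=
  if k == 0 then 1 else (absz k)%:R `^ (2 * a) / g.

Definition rweight (d : nat) (a : R) (g : nat -> R) (k : d.-tuple int) : R :=
  \prod_(j < d) rfac a (g j) (tnth k j).

Definition cos_basis (d : nat) (k : d.-tuple nat) (x : d.-tuple R) : R :=
  Num.sqrt 2 ^+ count (predC1 0%N) k *
  \prod_(j < d) cos (pi * (tnth k j)%:R * tnth x j).

Definition cos_coef (d : nat) (f : d.-tuple R -> R[i]) (k : d.-tuple nat) :=
  cint (fun x => f x * (cos_basis k x)%:C).

(* exp(2 pi i t) *)
Definition cis2pi (t : R) : R[i] := cos (2 * pi * t) +i* sin (2 * pi * t).

Definition dotz (d : nat) (h : d.-tuple int) (x : d.-tuple R) : R :=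
  \sum_(j < d) (tnth h j)%:~R * tnth x j.

Definition fourier_coef (d : nat) (f : d.-tuple R -> R[i]) (h : d.-tuple int) :=
  cint (fun x => f x * cis2pi (- dotz h x)).

Record fun_space (d : nat) := FunSpace {
  fs_norm : (d.-tuple R -> R[i]) -> \bar R;
  fs_mem : set (d.-tuple R -> R[i]) }.

(* The last membership clause selects, in each L_2 class, the continuous
   representative given pointwise by the cosine (resp. Fourier) series; point
   evaluations, hence cubature rules, are meaningless without it. *)
Definition cosine_norm (d : nat) (a : R) (g : nat -> R)
    (f : d.-tuple R -> R[i]) : \bar R :=
  sqrte (\esum_(k in [set: d.-tuple nat])
    (normc (cos_coef f k) ^+ 2 * rweight a g (map_tuple Posz k))%:E).

Definition cosine_space (d : nat) (a : R) (g : nat -> R) : fun_space d :=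
  FunSpace (cosine_norm a g)
    [set f : d.-tuple R -> R[i] | [/\ L2 f, (cosine_norm a g f < +oo)%E &
      forall x, cube R d x ->
        has_sum (fun k => cos_coef f k * (cos_basis k x)%:C) (f x)]].

Definition korobov_norm (d : nat) (a : R) (g : nat -> R)
    (f : d.-tuple R -> R[i]) : \bar R :=
  sqrte (\esum_(h in [set: d.-tuple int])
    (normc (fourier_coef f h) ^+ 2 * rweight a g h)%:E).

Definition korobov_space (d : nat) (a : R) (g : nat -> R) : fun_space d :=
  FunSpace (korobov_norm a g)
    [set f : d.-tuple R -> R[i] | [/\ L2 f, (korobov_norm a g f < +oo)%E &
      forall x, cube R d x ->
        has_sum (fun h => fourier_coef f h * cis2pi (dotz h x)) (f x)]].

Definition wor_error (d : nat) (H : fun_space d)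
    (Q : (d.-tuple R -> R[i]) -> R[i]) : \bar R :=
  ereal_sup [set (normc (cint f - Q f))%:E
            | f in [set f | fs_mem H f /\ (fs_norm H f <= 1)%E]].

Definition fracpart (x : R) : R := x - (Num.floor x)%:~R.

Definition lattice_point (d n : nat) (z : d.-tuple 'I_n) (i : nat) : d.-tuple R :=
  [tuple fracpart ((i * tnth z j)%N%:R / n%:R) | j < d].

Definition lattice_rule (d n : nat) (z : d.-tuple 'I_n)
    (f : d.-tuple R -> R[i]) : R[i] :=
  (n%:R)^-1 * \sum_(1 <= i < n.+1) f (lattice_point z i).

Definition tent (x : R) : R := 1 - `|2 * x - 1|.

Definition tent_point (d n : nat) (z : d.-tuple 'I_n) (D : d.-tuple R)
    (i : nat) : d.-tuple R :=
  [tuple tent (fracpart ((i * tnth z j)%N%:R / n%:R + tnth D j)) | j < d].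

Definition tent_lattice_rule (d n : nat) (z : d.-tuple 'I_n) (D : d.-tuple R)
    (f : d.-tuple R -> R[i]) : R[i] :=
  (n%:R)^-1 * \sum_(1 <= i < n.+1) f (tent_point z D i).

Definition cubature (d n : nat) (x : 'I_n -> d.-tuple R) (w : 'I_n -> R[i])
    (f : d.-tuple R -> R[i]) : R[i] :=
  \sum_(i < n) w i * f (x i).

Definition tent_error (d n : nat) (a : R) (g : nat -> R)
    (z : d.-tuple 'I_n) (D : d.-tuple R) : \bar R :=
  wor_error (cosine_space d a g) (tent_lattice_rule z D).

Definition tent_rms_error (d n : nat) (a : R) (g : nat -> R)
    (z : d.-tuple 'I_n) : \bar R :=
  sqrte (\int[cube_measure R d]_(D in cube R d) (tent_error a g z D ^+ 2))%E.

Definition half_weights (g : nat -> R) (j : nat) : R := g j / 2.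

Definition lattice_korobov_error (d n : nat) (a : R) (g : nat -> R)
    (z : d.-tuple 'I_n) : \bar R :=
  wor_error (korobov_space d a (half_weights g)) (lattice_rule z).

(* (z_1, ..., z_s, c): the first s components of z followed by c. *)
Definition cbc_extend (d n : nat) (z : d.-tuple 'I_n) (s : 'I_d) (c : 'I_n) :
    s.+1.-tuple 'I_n :=
  [tuple if j == s :> nat then c else tnth z (widen_ord (ltn_ord s) j) | j < s.+1].

(* z is a possible outcome of the component-by-component algorithm (ties between
   minimizers being broken arbitrarily). *)
Definition is_cbc (d n : nat) (a : R) (g : nat -> R) (z : d.-tuple 'I_n) : Prop :=
  forall s : 'I_d, (0 < tnth z s)%N /\
    forall c : 'I_n, (0 < c)%N ->
      (lattice_korobov_error a g (cbc_extend z s (tnth z s)) ^+ 2 <=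
       lattice_korobov_error a g (cbc_extend z s c) ^+ 2)%E.

Definition zeta (s : R) : R :=
  limn (fun N => \sum_(1 <= k < N.+1) k%:R `^ (- s)).

Definition weights (g : nat -> R) : Prop :=
  [/\ g 0%N <= 1, forall j, g j.+1 <= g j & forall j, 0 < g j].

End Spaces.

(* Operation counts: algebraic computation trees, i.e. for each input size a
   program over a growing list of real registers, initially holding the input.
   A step appends a constant or the result of an arithmetic operation on two
   registers, or branches on a comparison; every step costs 1.  Only register
   indices occur in a program, so it cannot inspect the input otherwise. *)
Section Cost.
Variable R : realType.

Inductive arith := Add | Sub | Mul | Div.

Definition arith_eval (o : arith) (x y : R) : R :=
  match o with
  | Add => x + y | Sub => x - y | Mul => x * y | Div => x / y
  end.

Inductive program (A : Type) :=
  | Return of A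
  | Const of R & program A
  | Arith of arith & nat & nat & program A
  | Branch of nat & nat & program A & program A.

Fixpoint run (A : Type) (p : program A) (m : seq R) : A :=
  match p with
  | Return b => b
  | Const c q => run q (rcons m c)
  | Arith o i j q => run q (rcons m (arith_eval o m`_i m`_j))
  | Branch i j q q' => if m`_i <= m`_j then run q m else run q' m
  end.

Fixpoint cost (A : Type) (p : program A) : nat :=
  match p with
  | Return _ => 0
  | Const _ q | Arith _ _ _ q => (cost q).+1
  | Branch _ _ q q' => (maxn (cost q) (cost q')).+1
  end.

(* sum of exp(2 pi i h x) / |h|^(2a) over all nonzero integers h *)
Definition korobov_kernel (a x : R) : R :=
  limn (fun N => \sum_(1 <= h < N.+1) 2 * cos (2 * pi * h%:R * x) / h%:R `^ (2 * a)).

(* Input of the search: the weights and the tabulated one-dimensional kernel. *)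
Definition cbc_input (d n : nat) (a : R) (g : nat -> R) : seq R :=
  mkseq g d ++ mkseq (fun k => korobov_kernel a (k%:R / n%:R)) n.

End Cost.

(* Main.v *)
Require Import Defs.
From mathcomp Require Import all_boot all_order all_algebra finmap.
From mathcomp Require Import fingroup cyclic finfield.
From mathcomp Require Import complex ring lra zify.
From mathcomp Require Import all_classical all_reals all_analysis.
From mathcomp Require Import measurable_realfun.

Set Implicit Arguments.
Unset Strict Implicit.
Unset Printing Implicit Defensive.

Import Order.TTheory GRing.Theory Num.Theory.
Import numFieldNormedType.Exports.

Local Open Scope classical_set_scope.
Local Open Scope ring_scope.
Local Open Scope complex_scope.

(* In a space given by a weighted orthonormal basis b_k with weights r_k, the
   Cauchy-Schwarz inequality gives the squared worst-case error of a cubature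
   rule as sum_k |error(b_k)|^2 / r_k.  For a lattice rule in the Korobov space
   with weights gamma/2 this is -1 plus the mean over the nodes x of
   prod_j (1 + gamma_j/2 kappa(x_j)), where kappa(x) = sum_(h <> 0) e^(2 pi i h x)/|h|^(2 alpha).
   Averaging the squared error of the tent-transformed rule in the cosine space
   over the shift gives the same quantity, because cos(pi k psi(x)) = cos(2 pi k x);
   some shift does at least as well as the mean.

   The error bound is proved by induction on the dimension: the increment of the
   dual lattice sum caused by a new component c is a sum over dual vectors; its
   power lambda <= 1 is at most the sum of the powers, whose average over c is
   controlled because a dual condition whose last coordinate is not divisible by
   the prime n has at most one solution c modulo n.

   For the cost, a primitive root modulo n turns the evaluation of the criterion
   at all candidates into a correlation, which is computed by a Cooley-Tukey
   recursion on polynomials modulo X^(2^m) - c.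

   For the lower bound, let P be the orthogonal projector onto the coefficient
   vectors of combinations of phi_p, p < 2n, vanishing at the n nodes.  Its trace
   is at least n, so P_kk >= 1/2 for some k, and (sum_p P_kp phi_p) phi_k vanishes
   at the nodes, has integral P_kk and norm O(n^alpha). *)

(** * Integration over the unit cube *)

Section CubeIntegration.
Variable R : realType.

(** Sums over frequencies factor over the coordinates only on boxes, so the identities are proved
    for sums truncated at [N] and passed to the limit. The integers are enumerated symmetrically, so
    that a truncated box yields the truncated cosine series of the kernel. The component bound is
    the delicate case: subadditivity and counting apply to truncated sums, whereas minimality is
    known for the limits; [cbc_step] reconciles the two. Extremal functions are replaced by finite
    truncations, so the integrals computed by linearity or by Fubini have bounded integrands, for
    which [bounded_measurable] gives integrability. A weight gamma_j on a cosine frequency k > 0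
    counts as gamma_j / 2 on each of k and -k; this is the origin of the halved weights. In the
    program [d] and [n] are fixed while alpha and gamma vary: the primitive root only permutes
    register indices, and the square roots of the recursion are constants of the program. The lower
    bound takes 2n frequencies because n vanishing conditions then leave half of the trace. *)

Definition bounded_measurable d (T : measurableType d) (f : T -> R) :=
  measurable_fun setT f /\ exists M : R, forall x, `|f x| <= M.

Section Generic.
Context d (T : measurableType d).
Implicit Types f g : T -> R.

Lemma bmfun_cst c : bounded_measurable (fun _ : T => c).
Proof. by split; [exact: measurable_cst|exists `|c|]. Qed.

Lemma bmfunD f g : bounded_measurable f -> bounded_measurable g ->
  bounded_measurable (fun x => f x + g x).
Proof.
move=> [mf [M fM]] [mg [N gN]]; split; first exact: measurable_funD.
by exists (M + N) => x; rewrite (le_trans (ler_normD _ _))// lerD.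
Qed.

Lemma bmfunN f : bounded_measurable f -> bounded_measurable (fun x => - f x).
Proof.
move=> [mf [M fM]]; split; first exact: measurableT_comp.
by exists M => x; rewrite normrN.
Qed.

Lemma bmfunM f g : bounded_measurable f -> bounded_measurable g ->
  bounded_measurable (fun x => f x * g x).
Proof.
move=> [mf [M fM]] [mg [N gN]]; split; first exact: measurable_funM.
by exists (M * N) => x; rewrite normrM ler_pM.
Qed.

Lemma bmfun_sum (I : Type) (s : seq I) (f : I -> T -> R) :
  (forall i, bounded_measurable (f i)) ->
  bounded_measurable (fun x => \sum_(i <- s) f i x).
Proof.
move=> bf; elim: s => [|i s IH].
  by under eq_fun do rewrite big_nil; exact: bmfun_cst.
by under eq_fun do rewrite big_cons; exact: bmfunD.
Qed.

Lemma bmfun_prod (I : Type) (s : seq I) (f : I -> T -> R) :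
  (forall i, bounded_measurable (f i)) ->
  bounded_measurable (fun x => \prod_(i <- s) f i x).
Proof.
move=> bf; elim: s => [|i s IH].
  by under eq_fun do rewrite big_nil; exact: bmfun_cst.
by under eq_fun do rewrite big_cons; exact: bmfunM.
Qed.

Lemma bmfun_integrable (P : probability T R) A f :
  measurable A -> bounded_measurable f -> P.-integrable A (EFin \o f).
Proof.
move=> mA [mf [M fM]]; apply: measurable_bounded_integrable => //.
- by rewrite -ge0_fin_numE// fin_num_measure.
- exact: measurable_funTS.
- exists M; split; first by rewrite num_real.
  by move=> y My x _ /=; rewrite (le_trans (fM x))// ltW.
Qed.

End Generic.

Lemma bmfun_comp d1 d2 (T1 : measurableType d1) (T2 : measurableType d2)
    (f : T2 -> R) (h : T1 -> T2) :
  measurable_fun setT h -> bounded_measurable f -> bounded_measurable (f \o h).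
Proof.
move=> mh [mf [M fM]]; split; first exact: measurableT_comp.
by exists M => x; exact: fM.
Qed.

Lemma measurable_cube d : measurable (cube R d).
Proof.
have -> : cube R d = \bigcap_(j in [set: 'I_d])
    ((fun x : d.-tuple R => tnth x j) @^-1` `[0, 1]).
  apply/seteqP; split => x /=; first by move=> h j _; rewrite /= in_itv /=.
  by move=> h j; have := h j I; rewrite /= in_itv.
apply: fin_bigcap_measurable => [|j _]; first exact: finite_finset.
rewrite -[X in measurable X]setTI.
exact: (@measurable_tnth _ (measurableTypeR R)).
Qed.

Lemma cube_measure_cube d : cube_measure R d (cube R d) = 1%E.
Proof.
elim: d => [|d IH].
  by rewrite /= diracE mem_set// => -[].
rewrite /= /pushforward.
have -> : @tcons R d @^-1` cube R d.+1 = `[0, 1] `*` cube R d.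
  apply/seteqP; split => -[x y] /=.
    move=> h; split; first by have := h ord0; rewrite /= (tnth_nth 0) /= in_itv.
    by move=> j; have := h (lift ord0 j); rewrite !(tnth_nth 0).
  move=> [/= ]; rewrite in_itv /= => h1 h2 j.
  rewrite (tnth_nth 0); case: j => -[|j] /= lj //.
  by have := h2 (Ordinal (lj : (j < d)%N)); rewrite (tnth_nth 0).
rewrite product_measure1E//; last exact: measurable_cube.
rewrite [X in (_ * X)%E]IH mule1.
exact: (integral_uniform_pdf1 (@ltr01 R)).
Qed.

Lemma cube_integrable d (f : d.-tuple R -> R) : bounded_measurable f ->
  (cube_measure R d).-integrable (cube R d) (EFin \o f).
Proof. move=> bf; apply: bmfun_integrable => //; exact: measurable_cube. Qed.

(** The complement of the cube is a null set. Change of variables and Fubini are then carried out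
    over the whole space. *)
Lemma integral_cubeT d (f : d.-tuple R -> R) : bounded_measurable f ->
  (\int[cube_measure R d]_(x in cube R d) (f x)%:E =
   \int[cube_measure R d]_x (f x)%:E)%E.
Proof.
move=> bf; have mc := @measurable_cube d.
rewrite [RHS](@negligible_integral _ _ _ _ _ (~` cube R d))//.
- by rewrite setTD setCK.
- exact: measurableC.
- exact: (@bmfun_integrable _ _ (cube_measure R d) _ _).
- by rewrite [LHS](probability_setC (cube_measure R d)) // cube_measure_cube subee.
Qed.

Definition unit_int (u : R -> R) : R :=
  (\int[lebesgue_measure]_(x in `[0, 1]) u x)%R.

Definition cube_int d (f : d.-tuple R -> R) : R :=
  (\int[cube_measure R d]_(x in cube R d) f x)%R.

Lemma integral_uniform01 (u : measurableTypeR R -> R) : bounded_measurable u ->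
  (\int[uniform_prob (@ltr01 R)]_x (u x)%:E)%E = (unit_int u)%:E.
Proof.
move=> bu; have [mu [M uM]] := bu.
have iu : lebesgue_measure.-integrable `[0 : R, 1] (EFin \o u).
  apply: measurable_bounded_integrable => //.
  - by rewrite /= lebesgue_measure_itv /= lte01 ltry.
  - exact: measurable_funTS.
  - exists M; split; first by rewrite num_real.
    by move=> y My x _ /=; rewrite (le_trans (uM x))// ltW.
have iM : lebesgue_measure.-integrable `[0 : R, 1] (EFin \o cst M).
  apply: measurable_bounded_integrable => //.
  - by rewrite /= lebesgue_measure_itv /= lte01 ltry.
  - exists `|M|; split; first by rewrite num_real.
    by move=> y My x _ /=; rewrite ltW.
(* The formula for the uniform law concerns nonnegative functions, so [u] is shifted by its bound
   [M]; the constant cancels at the end. *)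
have := @integral_uniform R 0 1 ltr01 (fun x => (u x + M)%:E).
rewrite subr0 invr1 mul1e => H.
have mD : measurable_fun setT (fun x => (u x + M)%:E).
  by apply/measurable_EFinP; apply: measurable_funD.
have pD x : (0 <= (u x + M)%:E)%E.
  by have := uM x; rewrite lee_fin ler_norml => /andP[+ _]; lra.
have {H} := H mD pD.
under eq_integral do rewrite EFinD.
rewrite integralD//; last 2 first.
- exact: (@bmfun_integrable _ _ (uniform_prob (@ltr01 R))).
- exact: (@bmfun_integrable _ _ (uniform_prob (@ltr01 R)) _ _ _ (bmfun_cst _ M)).
under [in RHS]eq_integral do rewrite EFinD.
rewrite integralD//.
rewrite !integral_cst//.
rewrite [X in (_ * X)%E](probability_setT (uniform_prob (@ltr01 R))).
rewrite [X in (_ = _ + _ * X)%E](_ : _ = 1%E); last first.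
  by rewrite /= lebesgue_measure_itv /= lte01 oppr0 adde0.
have iuf := integrable_fin_num _ iu.
rewrite mule1 /unit_int /Rintegral fineK; last exact: iuf.
by move/(congr1 (fun x => x - M%:E)%E); rewrite !addeK.
Qed.

(** Fubini along the recursive definition of [cube_measure]: the pullback by [tcons] turns the
    integrand into a product of functions of the two components. *)
Lemma cube_int_split d (u : measurableTypeR R -> R) (v : d.-tuple R -> R) :
  bounded_measurable u -> bounded_measurable v ->
  cube_int (fun x : d.+1.-tuple R => u (thead x) * v [tuple of behead x]) =
  unit_int u * cube_int v.
Proof.
move=> bu bv.
have bf : bounded_measurable
    (fun x : d.+1.-tuple R => u (thead x) * v [tuple of behead x]).
  apply: bmfunM.
    exact: (bmfun_comp (@measurable_tnth _ (measurableTypeR R) d.+1 ord0)).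
  apply: (bmfun_comp (h := fun x : d.+1.-tuple R => [tuple of behead x])) => //.
  exact: measurable_behead.
have bg : bounded_measurable (fun p : measurableTypeR R * d.-tuple R => u p.1 * v p.2).
  by apply: bmfunM; apply: bmfun_comp => //; exact: measurable_fst || exact: measurable_snd.
have igg : ((uniform_prob (@ltr01 R)) \x (cube_measure R d))%E.-integrable setT
    (fun p : measurableTypeR R * d.-tuple R => (u p.1 * v p.2)%:E).
  exact: (@bmfun_integrable _ (measurableTypeR R * d.-tuple R)%type ((uniform_prob (@ltr01 R)) \x (cube_measure R d))%E _ _ measurableT bg).
rewrite /cube_int /Rintegral integral_cubeT //=.
rewrite integral_distribution; last 2 first.
- by apply/measurable_EFinP; case: bf.
- apply: eq_integrable igg => // -[x y] _ /=.
  by congr ((u _ * v _)%:E); apply/val_inj.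
transitivity (fine (\int[(uniform_prob (@ltr01 R) \x cube_measure R d)%E]_p (u p.1 * v p.2)%:E)%E).
  congr fine; apply: eq_integral => -[x y] _ /=.
  by congr ((u _ * v _)%:E); apply/val_inj.
rewrite -integral12_prod_meas1 // /fubini_F /=.
under eq_integral => x _.
  under eq_integral do rewrite EFinM.
  rewrite integralZl //; last exact: (@bmfun_integrable _ _ (cube_measure R d) _ _).
  over.
have iv := @bmfun_integrable _ _ (cube_measure R d) _ _ measurableT bv.
have fv : (\int[cube_measure R d]_x (v x)%:E \is a fin_num)%E.
  by have := integrable_fin_num measurableT iv.
rewrite integral_cubeT// -(fineK fv) integralZr //.
  by rewrite integral_uniform01.
exact: (@bmfun_integrable _ _ (uniform_prob (@ltr01 R))).
Qed.
End CubeIntegration.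

(** * Integrals of complex-valued functions *)

Section ComplexIntegration.
Variables (R : realType) (d : nat).
Implicit Types (f g : d.-tuple R -> R[i]).
Local Notation normc := Normc.normc.

Lemma cube_intD (u v : d.-tuple R -> R) :
  bounded_measurable u -> bounded_measurable v ->
  cube_int (fun x => u x + v x) = cube_int u + cube_int v.
Proof.
move=> bu bv; apply: RintegralD; first exact: measurable_cube.
- exact: cube_integrable.
- exact: cube_integrable.
Qed.

Lemma cube_intZ (c : R) (u : d.-tuple R -> R) : bounded_measurable u ->
  cube_int (fun x => c * u x) = c * cube_int u.
Proof.
move=> bu; apply: RintegralZl; first exact: measurable_cube.
exact: cube_integrable.
Qed.

Lemma cube_intB (u v : d.-tuple R -> R) :
  bounded_measurable u -> bounded_measurable v ->
  cube_int (fun x => u x - v x) = cube_int u - cube_int v.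
Proof.
move=> bu bv; rewrite cube_intD //; last exact: bmfunN.
by congr (_ + _); under eq_fun do rewrite -mulN1r; rewrite cube_intZ // mulN1r.
Qed.

Lemma cube_int_cst (c : R) : cube_int (fun _ : d.-tuple R => c) = c.
Proof.
rewrite /cube_int /Rintegral integral_cst; last exact: measurable_cube.
by rewrite [X in (_ * X)%E]cube_measure_cube mule1.
Qed.

Lemma cube_int_sum (I : Type) (s : seq I) (u : I -> d.-tuple R -> R) :
  (forall i, bounded_measurable (u i)) ->
  cube_int (fun x => \sum_(i <- s) u i x) = \sum_(i <- s) cube_int (u i).
Proof.
move=> bu; elim: s => [|i s IH].
  by rewrite big_nil; under eq_fun do rewrite big_nil; rewrite cube_int_cst.
under eq_fun do rewrite big_cons.
by rewrite big_cons cube_intD //; [rewrite IH|exact: bmfun_sum].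
Qed.

Definition cbounded_measurable f :=
  bounded_measurable (fun x => complex.Re (f x)) /\
  bounded_measurable (fun x => complex.Im (f x)).

Lemma cintE f : cint f = cube_int (fun x => complex.Re (f x)) +i*
  cube_int (fun x => complex.Im (f x)).
Proof. by []. Qed.

Lemma cint_real (u : d.-tuple R -> R) : cint (fun x => (u x)%:C) = (cube_int u)%:C.
Proof. by rewrite cintE /= cube_int_cst. Qed.

Lemma cbmfun_real (u : d.-tuple R -> R) : bounded_measurable u ->
  cbounded_measurable (fun x => (u x)%:C).
Proof. by move=> bu; split => //=; exact: bmfun_cst. Qed.

Lemma cbmfunM f g : cbounded_measurable f -> cbounded_measurable g ->
  cbounded_measurable (fun x => f x * g x).
Proof.
move=> [rf jf] [rg jg]; split.
  rewrite (_ : (fun _ => _) = fun x => complex.Re (f x) * complex.Re (g x) -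
      complex.Im (f x) * complex.Im (g x)).
    by apply: bmfunD; [|apply: bmfunN]; apply: bmfunM.
  by apply/funext => x; case: (f x) (g x) => [a b] [a' b'].
rewrite (_ : (fun _ => _) = fun x => complex.Re (f x) * complex.Im (g x) +
    complex.Im (f x) * complex.Re (g x)).
  by apply: bmfunD; apply: bmfunM.
by apply/funext => x; case: (f x) (g x) => [a b] [a' b'].
Qed.

Lemma cbmfun_cst c : cbounded_measurable (fun _ => c).
Proof. by split; exact: bmfun_cst. Qed.

Lemma ReD (x y : R[i]) : complex.Re (x + y) = complex.Re x + complex.Re y.
Proof. by case: x y => [a b] []. Qed.

Lemma ImD (x y : R[i]) : complex.Im (x + y) = complex.Im x + complex.Im y.
Proof. by case: x y => [a b] []. Qed.

Lemma cbmfunD f g : cbounded_measurable f -> cbounded_measurable g ->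
  cbounded_measurable (fun x => f x + g x).
Proof.
move=> [rf jf] [rg jg]; split.
  by under eq_fun do rewrite ReD; exact: bmfunD.
by under eq_fun do rewrite ImD; exact: bmfunD.
Qed.

Lemma cbmfun_sum (I : Type) (s : seq I) (F : I -> d.-tuple R -> R[i]) :
  (forall i, cbounded_measurable (F i)) ->
  cbounded_measurable (fun x => \sum_(i <- s) F i x).
Proof.
move=> bf; elim: s => [|i s IH].
  by under eq_fun do rewrite big_nil; exact: cbmfun_cst.
by under eq_fun do rewrite big_cons; exact: cbmfunD.
Qed.

Lemma cintD f g : cbounded_measurable f -> cbounded_measurable g ->
  cint (fun x => f x + g x) = cint f + cint g.
Proof.
move=> [rf jf] [rg jg]; rewrite !cintE.
under eq_fun do rewrite ReD.
under [X in _ +i* cube_int X = _]eq_fun do rewrite ImD.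
by rewrite !cube_intD.
Qed.

Lemma cintZ c f : cbounded_measurable f -> cint (fun x => c * f x) = c * cint f.
Proof.
move=> [rf jf]; rewrite !cintE; case: c => a b.
rewrite (_ : (fun _ => _) = fun x => a * complex.Re (f x) - b * complex.Im (f x));
  last by apply/funext => x; case: (f x).
rewrite [X in _ +i* cube_int X](_ : _ =
    fun x => a * complex.Im (f x) + b * complex.Re (f x));
  last by apply/funext => x; case: (f x).
by rewrite cube_intB ?cube_intD ?cube_intZ //; exact: bmfunM (bmfun_cst _ _) _.
Qed.

Lemma cint_sum (I : Type) (s : seq I) (F : I -> d.-tuple R -> R[i]) :
  (forall i, cbounded_measurable (F i)) ->
  cint (fun x => \sum_(i <- s) F i x) = \sum_(i <- s) cint (F i).
Proof.
move=> bf; elim: s => [|i s IH].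
  rewrite big_nil; under eq_fun do rewrite big_nil.
  by rewrite cintE /= cube_int_cst.
under eq_fun do rewrite big_cons.
by rewrite big_cons cintD ?IH //; exact: cbmfun_sum.
Qed.

Lemma normcE_sqr (z : R[i]) :
  normc z ^+ 2 = complex.Re z ^+ 2 + complex.Im z ^+ 2.
Proof. by case: z => a b; rewrite /normc sqr_sqrtr // addr_ge0 ?sqr_ge0. Qed.

Lemma normc_ge0 (z : R[i]) : 0 <= normc z.
Proof. by case: z => a b; exact: sqrtr_ge0. Qed.

Lemma mul_conjc (z : R[i]) : z * z^*%C = (normc z ^+ 2)%:C.
Proof.
rewrite normcE_sqr; case: z => a b; apply/eqP; rewrite eq_complex /=.
by apply/andP; split; apply/eqP; ring.
Qed.

Lemma normcJ' (z : R[i]) : normc z^*%C = normc z.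
Proof. by case: z => a b; rewrite /normc /= sqrrN. Qed.

Lemma normc_real (r : R) : normc r%:C = `|r|.
Proof. by rewrite /normc /= expr0n /= addr0 sqrtr_sqr. Qed.

Lemma ler_normc_sum (I : Type) (s : seq I) (F : I -> R[i]) :
  normc (\sum_(i <- s) F i) <= \sum_(i <- s) normc (F i).
Proof.
elim: s => [|i s IH]; first by rewrite !big_nil /normc /= expr0n /= addr0 sqrtr0.
by rewrite !big_cons (le_trans (le_normcD _ _)) // lerD2l.
Qed.

Lemma normcN' (z : R[i]) : normc (- z) = normc z.
Proof. by case: z => a b; rewrite /normc /= !sqrrN. Qed.

Lemma cbmfun_L2 f : cbounded_measurable f -> L2 f.
Proof.
move=> [rf jf]; have mc := @measurable_cube R d; split.
- by case: rf => [m _]; exact: measurable_funTS.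
- by case: jf => [m _]; exact: measurable_funTS.
have bn : bounded_measurable (fun x => normc (f x) ^+ 2).
  by under eq_fun do rewrite normcE_sqr; apply: bmfunD; exact: bmfunM.
have := cube_integrable bn.
move=> /integrableP[_]; under eq_integral => x _.
  rewrite gee0_abs; last by rewrite lee_fin exprn_ge0 ?normc_ge0.
  over.
by [].
Qed.

End ComplexIntegration.

(** * Worst-case errors in weighted orthonormal bases *)

Section WorstCaseError.
Variables (R : realType) (d : nat) (I : choiceType).
Local Notation normc := Normc.normc.
Variables (b b' : I -> d.-tuple R -> R[i]) (r : I -> R) (i0 : I).

(** [b] synthesises and [b'] analyses: they coincide for the cosine basis and are conjugate for the
    characters. Both spaces of the theorem are instances by conversion, and the rule [Q] has
    arbitrary nodes and weights so that it also covers general cubature. *)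
Definition series_norm (f : d.-tuple R -> R[i]) : \bar R :=
  sqrte (\esum_(i in [set: I])
    (normc (cint (fun x => f x * b' i x)) ^+ 2 * r i)%:E).

Definition series_space : fun_space R d :=
  FunSpace series_norm
    [set f : d.-tuple R -> R[i] | [/\ L2 f, (series_norm f < +oo)%E &
      forall x, cube R d x ->
        has_sum (fun i => cint (fun x => f x * b' i x) * b i x) (f x)]].

Hypothesis bb : forall i, cbounded_measurable (b i).
Hypothesis bb' : forall i, cbounded_measurable (b' i).
Hypothesis orth : forall i j, cint (fun x => b i x * b' j x) = (i == j)%:R.
Hypothesis b'0 : forall x, b' i0 x = 1.
Hypothesis r_gt0 : forall i, 0 < r i.

Variables (J : Type) (s : seq J) (w : J -> R[i]) (x : J -> d.-tuple R).
Hypothesis xcube : forall j, cube R d (x j).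

Let Q (f : d.-tuple R -> R[i]) := \sum_(j <- s) w j * f (x j).
Let E (f : d.-tuple R -> R[i]) := cint f - Q f.
Let c (f : d.-tuple R -> R[i]) i := cint (fun x => f x * b' i x).

Let c0 f : c f i0 = cint f.
Proof. by rewrite /c; under eq_fun do rewrite b'0 mulr1. Qed.

Let cintb i : cint (b i) = (i == i0)%:R.
Proof. by rewrite -orth; under [in RHS]eq_fun do rewrite b'0 mulr1. Qed.

(** The error may be taken termwise without exchanging sum and integral: the series converges at
    each of the finitely many nodes, and the integral of [f] is its single coefficient at [i0]. *)
Lemma error_has_sum f : fs_mem series_space f ->
  has_sum (fun i => c f i * E (b i)) (E f).
Proof.
move=> [_ _ hs] e e0.
have [A hA] : exists A : {fset I}, forall B : {fset I}, (A `<=` B)%fset ->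
    normc (\sum_(j <- s) w j * (\sum_(i <- B) c f i * b i (x j) - f (x j))) < e.
  have : forall e, 0 < e -> exists A : {fset I}, forall B : {fset I}, (A `<=` B)%fset ->
    normc (\sum_(j <- s) w j * (\sum_(i <- B) c f i * b i (x j) - f (x j))) < e.
    elim: s => [|j l IH] e' e'0.
      exists fset0 => B _; rewrite big_nil.
      by rewrite (_ : normc 0 = 0) // /normc /= expr0n /= addr0 sqrtr0.
    have e2 : 0 < e' / 2 by rewrite divr_gt0.
    have [A1 h1] := IH _ e2.
    have e3 : 0 < e' / 2 / (1 + normc (w j)).
      by rewrite divr_gt0 // ltr_pwDl // normc_ge0.
    have [A2 h2] := hs (x j) (xcube j) _ e3.
    exists (A1 `|` A2)%fset => B AB; rewrite big_cons.
    apply: (le_lt_trans (le_normcD _ _)).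
    rewrite [e']splitr ltrD // ?h1 ?(fsubset_trans _ AB) ?fsubsetUl //.
    rewrite Normc.normcM.
    have := h2 B (fsubset_trans (fsubsetUr _ _) AB).
    rewrite ltr_pdivlMr; last by rewrite ltr_pwDl // normc_ge0.
    apply: le_lt_trans; rewrite mulrC ler_wpM2l ?normc_ge0 //.
    by rewrite lerDr.
  exact.
(* Once [i0] belongs to [B], the partial sum over [B] has the same integral as [f], so only the node
   values contribute to the difference. *)
exists (i0 |` A)%fset => B AB.
have i0B : i0 \in B by apply: (fsubsetP AB); rewrite !inE eqxx.
rewrite (_ : _ - _ = - \sum_(j <- s) w j * (\sum_(i <- B) c f i * b i (x j) - f (x j))).
  by rewrite normcN' hA // (fsubset_trans _ AB) // fsubsetUr.
rewrite /E /Q.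
under eq_bigr do rewrite mulrBr.
under [in RHS]eq_bigr do rewrite mulrBr.
rewrite !big_split /= !sumrN.
have -> : \sum_(i <- B) c f i * cint (b i) = cint f.
  rewrite (big_fsetD1 i0) //= cintb eqxx mulr1 c0 big1_seq ?addr0 //.
  move=> i /andP[_]; rewrite !inE => /andP[/negbTE ii0 _].
  by rewrite cintb ii0 mulr0.
have -> : \sum_(i <- B) c f i * (\sum_(j <- s) w j * b i (x j)) =
          \sum_(j <- s) w j * (\sum_(i <- B) c f i * b i (x j)).
  under eq_bigr do rewrite mulr_sumr.
  rewrite exchange_big /=; apply: eq_bigr => j _.
  by rewrite mulr_sumr; apply: eq_bigr => i _; rewrite mulrCA.
by ring.
Qed.

(** Cauchy-Schwarz on partial sums, through AM-GM with parameter [t]: the coefficients of [f] and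
    the errors of the basis contribute at most [t / 2] each. *)
Lemma error_le f (t : R) : fs_mem series_space f -> (series_norm f <= 1)%E ->
  0 < t ->
  (\esum_(i in [set: I]) (normc (E (b i)) ^+ 2 / r i)%:E <= (t ^+ 2)%:E)%E ->
  normc (E f) <= t.
Proof.
move=> fm f1 t0 ht; apply/ler_addgt0Pr => e e0.
have [A hA] := error_has_sum fm e0.
have := hA A (fsubset_refl _).
set S := \sum_(i <- A) _ => hS.
have St : normc S <= t.
  rewrite (le_trans (ler_normc_sum _ _)) //.
  have h1 : \sum_(i <- A) (normc (c f i) ^+ 2 * r i) <= 1.
    rewrite -lee_fin -sumEFin.
    have : (\esum_(i in [set: I]) (normc (c f i) ^+ 2 * r i)%:E <= 1)%E.
      by rewrite -lee_sqrt // [leRHS](_ : _ = 1%E) //= sqrtr1.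
    apply: le_trans; apply: esum_ge; exists [set` A] => //.
    by rewrite fsbig_finite //= set_fsetK.
  have h2 : \sum_(i <- A) (normc (E (b i)) ^+ 2 / r i) <= t ^+ 2.
    rewrite -lee_fin -sumEFin; apply: le_trans ht.
    apply: esum_ge; exists [set` A] => //.
    by rewrite fsbig_finite //= set_fsetK.
  have : \sum_(i <- A) normc (c f i * E (b i)) <= \sum_(i <- A)
     (t / 2 * (normc (c f i) ^+ 2 * r i) + (2 * t)^-1 * (normc (E (b i)) ^+ 2 / r i)).
    apply: ler_sum => i _; rewrite Normc.normcM.
    set u := normc (c f i); set v := normc (E (b i)).
    have ri := r_gt0 i.
    (* AM-GM: 2 u v <= t r u^2 + v^2 / (t r) *)
    rewrite -subr_ge0.
    have -> : t / 2 * (u ^+ 2 * r i) + (2 * t)^-1 * (v ^+ 2 / r i) - u * v =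
       (t * r i * u - v) ^+ 2 / (2 * t * r i).
      by field; rewrite !gt_eqF.
    by rewrite divr_ge0 ?sqr_ge0 // !mulr_ge0 // ltW.
  move=> /le_trans -> //.
  rewrite big_split /= -!mulr_sumr.
  apply: (@le_trans _ _ (t / 2 * 1 + (2 * t)^-1 * t ^+ 2)).
    by rewrite lerD // ler_wpM2l // ?invr_ge0 ?divr_ge0 // ?mulr_ge0 // ltW.
  by rewrite le_eqVlt; apply/orP; left; apply/eqP; field; rewrite gt_eqF.
have -> : E f = S - (S - E f) by ring.
by rewrite (le_trans (le_normcD _ _)) // normcN' lerD // ltW.
Qed.

Lemma wor_error_ge0 : (0 <= wor_error series_space Q)%E.
Proof.
have c00 i : c (fun=> 0) i = 0.
  rewrite /c; under eq_fun do rewrite mul0r.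
  by rewrite cintE /= cube_int_cst.
have n0 : series_norm (fun=> 0) = 0%E.
  rewrite /series_norm esum1 ?sqrte0 // => i _; rewrite -/(c (fun=> 0) i) c00.
  by rewrite /normc /= expr0n /= addr0 sqrtr0 expr0n mul0r.
apply: (@le_trans _ _ (normc (E (fun=> 0)))%:E); first by rewrite lee_fin normc_ge0.
apply: ereal_sup_ubound; exists (fun=> 0) => //.
split; last by rewrite /= n0.
split; [exact/cbmfun_L2/cbmfun_cst|by rewrite n0|move=> y _ e e0].
exists fset0 => B _; rewrite big1 => [|i _]; last by rewrite -/(c (fun=> 0) i) c00 mul0r.
by rewrite subrr /normc /= expr0n /= addr0 sqrtr0.
Qed.

(** The witness is the normalised Riesz representer of the error restricted to [A]: its coefficients
    are the conjugate of [E (b i)] over [r i * sqrt S], its norm is 1 and its error is [sqrt S].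
    Being a finite combination, it has a series that is eventually constant. *)
Lemma error_ge (A : {fset I}) :
  ((\sum_(i <- A) normc (E (b i)) ^+ 2 / r i)%:E <=
   wor_error series_space Q ^+ 2)%E.
Proof.
set S := \sum_(i <- A) _.
have S_ge0 : 0 <= S.
  by apply: sumr_ge0 => i _; rewrite divr_ge0 ?exprn_ge0 ?normc_ge0 ?ltW.
have [S0|Sn0] := eqVneq S 0.
  by rewrite S0 expe2 mule_ge0 // wor_error_ge0.
have S_gt0 : 0 < S by rewrite lt_neqAle eq_sym Sn0.
pose a i : R[i] := (E (b i))^*%C * (r i * Num.sqrt S)^-1%:C.
pose f x := \sum_(i <- A) a i * b i x.
have cb i : cbounded_measurable (fun x => a i * b i x).
  by apply: cbmfunM => //; exact: cbmfun_cst.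
have bf : cbounded_measurable f by apply: cbmfun_sum.
have cf j : c f j = if j \in A then a j else 0.
  rewrite /c /f; under eq_fun do rewrite mulr_suml.
  rewrite cint_sum; last by move=> i; exact: cbmfunM.
  transitivity (\sum_(i <- A) a i * (i == j)%:R).
    apply: eq_bigr => i _; rewrite -orth -cintZ; last exact: cbmfunM.
    by congr cint; apply/funext => y; rewrite mulrA.
  case: ifPn => jA.
    rewrite (big_fsetD1 j) //= eqxx mulr1 big1_seq ?addr0 // => i.
    by rewrite !inE => /andP[_ /andP[/negbTE -> _]]; rewrite mulr0.
  rewrite big1_seq // => i /andP[_ iA]; case: eqP => [ij|_]; last by rewrite mulr0.
  by rewrite -ij iA in jA.
have nf : series_norm f = 1%E.
  rewrite /series_norm (_ : esum _ _ = 1%E); first by rewrite /= sqrtr1.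
  transitivity (\esum_(i in [set` A]) (normc (a i) ^+ 2 * r i)%:E)%E.
    rewrite [RHS]esum_mkcond; apply: eq_esum => i _; rewrite -/(c f i) cf.
    rewrite mem_setE; case: ifP => // _.
    by rewrite /normc /= expr0n /= addr0 sqrtr0 expr0n mul0r.
  rewrite esum_fset //; last first.
    by move=> i _; rewrite lee_fin mulr_ge0 ?exprn_ge0 ?normc_ge0 ?ltW.
  rewrite fsbig_finite //= set_fsetK sumEFin; congr _%:E.
  transitivity (\sum_(i <- A) (normc (E (b i)) ^+ 2 / r i) / S).
    apply: eq_bigr => i _; have ri := r_gt0 i.
    rewrite /a Normc.normcM normcJ' normc_real exprMn real_normK ?num_real //.
    rewrite exprVn exprMn sqr_sqrtr //; field.
    by rewrite !gt_eqF.
  by rewrite -mulr_suml divff.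
have fm : fs_mem series_space f.
  split; [exact: cbmfun_L2|by rewrite nf ltry|move=> y _ e e0].
  exists A => B AB.
  rewrite (_ : \sum_(i <- B) _ = f y).
    by rewrite subrr /normc /= expr0n /= addr0 sqrtr0.
  rewrite /f (big_fsetID _ (fun i => i \in A)) /= [X in _ + X]big1_seq ?addr0.
    have -> : [fset i in B | i \in A]%fset = A.
      by apply/fsetP => i; rewrite !inE /=; case: (boolP (i \in A)) => iA;
        rewrite ?andbF ?andbT // (fsubsetP AB).
    by apply: eq_big_seq => i iA; rewrite -/(c f i) cf iA.
  move=> i /andP[_]; rewrite !inE /= => /andP[_ iA].
  by rewrite -/(c f i) cf (negbTE iA) mul0r.
have Ef : E f = (Num.sqrt S)%:C.
  transitivity (\sum_(i <- A) a i * E (b i)).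
    rewrite /E /f cint_sum //; under [in RHS]eq_bigr do rewrite mulrBr.
    rewrite sumrB; congr (_ - _).
      by apply: eq_bigr => i _; rewrite cintZ.
    rewrite /Q; under [in RHS]eq_bigr do rewrite mulr_sumr.
    rewrite exchange_big /=; apply: eq_bigr => j _.
    by rewrite mulr_sumr; apply: eq_bigr => i _; rewrite mulrCA.
  transitivity (\sum_(i <- A) ((normc (E (b i)) ^+ 2 / r i) / Num.sqrt S)%:C).
    apply: eq_bigr => i _; rewrite /a mulrAC [_^*%C * _]mulrC mul_conjc.
    by rewrite -rmorphM invfM mulrA.
  rewrite -rmorph_sum /= -mulr_suml -/S; congr _%:C.
  rewrite -{1}(sqr_sqrtr S_ge0) expr2 mulfK //.
  by rewrite gt_eqF // sqrtr_gt0.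
have -> : S%:E = ((Num.sqrt S)%:E ^+ 2)%E by rewrite -EFin_expe sqr_sqrtr.
have h : ((Num.sqrt S)%:E <= wor_error series_space Q)%E.
  apply: ereal_sup_ubound; exists f; first by split => //; rewrite /= nf.
  by rewrite -/(E f) Ef normc_real ger0_norm ?sqrtr_ge0.
by rewrite !expe2 lee_pmul // lee_fin sqrtr_ge0.
Qed.

Lemma esum_le_fset (u : I -> \bar R) M :
  (forall A : {fset I}, (\sum_(i <- A) u i <= M)%E) ->
  (\esum_(i in [set: I]) u i <= M)%E.
Proof.
move=> h; apply: ub_ereal_sup => _ [B [finB _] <-].
rewrite fsbig_finite //=; exact: h.
Qed.

Theorem wor_errorE : wor_error series_space Q =
  sqrte (\esum_(i in [set: I]) (normc (cint (b i) - Q (b i)) ^+ 2 / r i)%:E).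
Proof.
set S := esum _ _.
have S_ge0 : (0 <= S)%E.
  by apply: esum_ge0 => i _; rewrite lee_fin divr_ge0 ?exprn_ge0 ?normc_ge0 ?ltW.
apply/eqP; rewrite eq_le; apply/andP; split.
  apply: ub_ereal_sup => _ [f [fm f1] <-].
  rewrite -/(E f).
  move: S_ge0; case ES : S => [t| |] // t0; last by rewrite leey.
  (* [error_le] takes a positive bound; relaxing by [e] covers the case [t = 0]. *)
  rewrite /= lee_fin; apply/ler_addgt0Pr => e e0.
  have st0 := sqrtr_ge0 t; rewrite lee_fin in t0.
  apply: error_le => //; first by rewrite ltr_wpDl.
  rewrite -/S ES lee_fin -{1}(sqr_sqrtr t0) ler_sqr ?nnegrE ?addr_ge0 //.
  - by rewrite lerDl ltW.
  - by rewrite ltW.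
rewrite -[leRHS]gee0_abs ?wor_error_ge0 // -sqrte_sqr lee_sqrt; last first.
  by rewrite expe2 mule_ge0 // wor_error_ge0.
apply: esum_le_fset => A; rewrite sumEFin; exact: error_ge.
Qed.

End WorstCaseError.

(** * Trigonometric bases *)

Section TrigonometricIntegrals.
Variable R : realType.

Lemma continuous_cos_affine (a b : R) : continuous (fun x : R => cos (a * x + b)).
Proof.
move=> x; apply: continuous_comp; last exact: continuous_cos.
by apply: cvgD; [apply: cvgM; [exact: cvg_cst|exact: cvg_id]|exact: cvg_cst].
Qed.

Lemma bmfun_cos_affine (a b : R) :
  bounded_measurable (fun x : measurableTypeR R => cos (a * x + b)).
Proof.
split; last by exists 1 => x; exact: cos_max.
by apply: (@continuous_measurable_fun R (fun x => cos (a * x + b))); exact: continuous_cos_affine.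
Qed.

Lemma sin_cos_affine (a b x : R) : sin (a * x + b) = cos (a * x + (b - pi / 2)).
Proof. by rewrite addrA cosBpihalf. Qed.

Lemma bmfun_sin_affine (a b : R) :
  bounded_measurable (fun x : measurableTypeR R => sin (a * x + b)).
Proof.
by under eq_fun do rewrite sin_cos_affine; exact: bmfun_cos_affine.
Qed.

Lemma unit_int_cos (a b : R) : a != 0 ->
  unit_int (fun x => cos (a * x + b)) = (sin (a + b) - sin b) / a.
Proof.
move=> a0; rewrite /unit_int /Rintegral.
have dF (x : R) : is_derive x 1 (fun x => a^-1 * sin (a * x + b)) (cos (a * x + b)).
  by apply: is_derive_eq; rewrite addr0 /GRing.scale /= mulr1 mulrCA mulVf ?mulr1.
rewrite (@continuous_FTC2 _ _ (fun x => a^-1 * sin (a * x + b))) //=.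
- by rewrite mulr1 mulr0 add0r; field.
- exact/continuous_subspaceT/continuous_cos_affine.
- split.
  + by move=> x _; exact: (@ex_derive _ _ _ _ _ _ _ (dF x)).
  + apply: cvg_at_right_filter.
    apply: (@differentiable_continuous _ _ _ _ (fun x => a^-1 * sin (a * x + b))).
    by apply/derivable1_diffP; exact: (@ex_derive _ _ _ _ _ _ _ (dF 0)).
  + apply: cvg_at_left_filter.
    apply: (@differentiable_continuous _ _ _ _ (fun x => a^-1 * sin (a * x + b))).
    by apply/derivable1_diffP; exact: (@ex_derive _ _ _ _ _ _ _ (dF 1)).
- by move=> x _; rewrite derive1E; exact: derive_val.
Qed.

Lemma unit_int_cst (c : R) : unit_int (fun=> c) = c.
Proof.
rewrite /unit_int Rintegral_cst //= lebesgue_measure_itv /= lte_fin ltr01.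
by rewrite oppr0 adde0 /= mulr1.
Qed.

Lemma tnth_liftS (T : Type) d (x : d.+1.-tuple T) (j : 'I_d) :
  tnth x (lift ord0 j) = tnth [tuple of behead x] j.
Proof. by case/tupleP: x => y t; rewrite !(tnth_nth y). Qed.

Lemma cube_int_prod d (u : nat -> measurableTypeR R -> R) :
  (forall j, bounded_measurable (u j)) ->
  cube_int (fun x : d.-tuple R => \prod_(j < d) u j (tnth x j)) =
  \prod_(j < d) unit_int (u j).
Proof.
elim: d u => [|d IH] u bu.
  by under eq_fun do rewrite big_ord0; rewrite big_ord0 cube_int_cst.
rewrite big_ord_recl -(IH (fun j => u j.+1)) // -cube_int_split //; last first.
  apply: bmfun_prod => j.
  exact: (bmfun_comp (@measurable_tnth _ (measurableTypeR R) d j)).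
congr cube_int; apply/funext => x; rewrite big_ord_recl; congr (_ * _).
by apply: eq_bigr => j _; rewrite tnth_liftS.
Qed.

Lemma cos2pi_int (m : int) (x : R) : cos (2 * pi * m%:~R + x) = cos x.
Proof.
case: m => n; rewrite ?NegzE ?mulrNz ?mulrN addrC.
  by rewrite mulr_natl mulr_natr (periodicn (@cosD2pi R)).
rewrite -[in RHS](subrK (2 * pi * n.+1%:R) x) mulr_natl mulr_natr.
by rewrite (periodicn (@cosD2pi R)).
Qed.

Lemma sin2pi_int (m : int) (x : R) : sin (2 * pi * m%:~R + x) = sin x.
Proof. by rewrite -!cosBpihalf -addrA cos2pi_int. Qed.

Lemma sin_pi_int (m : int) : sin (pi * m%:~R) = 0 :> R.
Proof.
case: m => n; rewrite ?NegzE ?mulrNz ?mulrN ?sinN.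
  rewrite -pmulrn; elim: n => [|n IH]; first by rewrite mulr0 sin0.
  by rewrite -natr1 mulrDr mulr1 sinDpi IH oppr0.
rewrite -pmulrn; elim: n.+1 => [|k IH]; first by rewrite mulr0 sin0 oppr0.
by rewrite -natr1 mulrDr mulr1 sinDpi opprK; rewrite -[LHS]opprK IH oppr0.
Qed.

Lemma unit_int_cos2pi (m : int) (b : R) :
  unit_int (fun x : R => cos (2 * pi * m%:~R * x + b)) = if m == 0 then cos b else 0.
Proof.
case: eqP => [->|/eqP m0].
  by under eq_fun do rewrite mulr0 mul0r add0r; rewrite unit_int_cst.
rewrite unit_int_cos; last by rewrite !(mulf_eq0, negb_or) intr_eq0 m0 !gt_eqF ?pi_gt0.
by rewrite sin2pi_int subrr mul0r.
Qed.

Lemma unit_int_sin2pi (m : int) : unit_int (fun x : R => sin (2 * pi * m%:~R * x)) = 0.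
Proof.
under eq_fun do rewrite -[_ * _]addr0 sin_cos_affine sub0r.
by rewrite unit_int_cos2pi cosN cos_pihalf if_same.
Qed.

Lemma unit_int_cospi (m : int) :
  unit_int (fun x : R => cos (pi * m%:~R * x)) = (m == 0)%:R.
Proof.
case: eqP => [->|/eqP m0].
  by under eq_fun do rewrite mulr0 mul0r cos0; rewrite unit_int_cst.
under eq_fun do rewrite -[_ * _]addr0.
rewrite unit_int_cos; last by rewrite !(mulf_eq0, negb_or) intr_eq0 m0 !gt_eqF ?pi_gt0.
by rewrite addr0 sin_pi_int sin0 subrr mul0r.
Qed.

Lemma dotz_recl d (m : int) (t : d.-tuple int) (x : d.+1.-tuple R) :
  dotz [tuple of m :: t] x = m%:~R * thead x + dotz t [tuple of behead x].
Proof.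
rewrite /dotz big_ord_recl (tnth_nth 0) /=; congr (_ + _).
apply: eq_bigr => j _; rewrite !tnth_liftS.
by rewrite (_ : [tuple of behead [tuple of m :: t]] = t) //; apply/val_inj.
Qed.

(** Cosine and sine are treated together because the addition formulas mix them when the first
    coordinate is split off. *)
Lemma bmfun_dotz d (h : d.-tuple int) (a : R) :
  bounded_measurable (fun x : d.-tuple R => cos (a * dotz h x)) /\
  bounded_measurable (fun x : d.-tuple R => sin (a * dotz h x)).
Proof.
elim: d h => [|d IH] h.
  split; rewrite /dotz; under eq_fun do rewrite big_ord0; exact: bmfun_cst.
case/tupleP: h => m t; have [bc bs] := IH t.
have bt (f : measurableTypeR R -> R) : bounded_measurable f ->
    bounded_measurable (fun x : d.+1.-tuple R => f (thead x)).
  exact: (bmfun_comp (@measurable_tnth _ (measurableTypeR R) d.+1 ord0)).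
have bb (f : d.-tuple R -> R) : bounded_measurable f ->
    bounded_measurable (fun x : d.+1.-tuple R => f [tuple of behead x]).
  apply: (bmfun_comp (h := fun x : d.+1.-tuple R => [tuple of behead x])).
  exact: measurable_behead.
have bc0 := bmfun_cos_affine (a * m%:~R) 0.
have bs0 := bmfun_sin_affine (a * m%:~R) 0.
split; under eq_fun do rewrite dotz_recl mulrDr ?cosD ?sinD mulrA -[_ * _ * thead _]addr0.
  by apply: bmfunD; [|apply: bmfunN]; apply: bmfunM; (exact: (bt _ bc0) ||
    exact: (bt _ bs0) || exact: (bb _ bc) || exact: (bb _ bs)).
by apply: bmfunD; apply: bmfunM; (exact: (bt _ bc0) ||
    exact: (bt _ bs0) || exact: (bb _ bc) || exact: (bb _ bs)).
Qed.

Lemma cube_int_dotz d (h : d.-tuple int) :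
  cube_int (fun x : d.-tuple R => cos (2 * pi * dotz h x)) = (all (pred1 0) h)%:R /\
  cube_int (fun x : d.-tuple R => sin (2 * pi * dotz h x)) = 0.
Proof.
elim: d h => [|d IH] h.
  rewrite (tuple0 h); split; rewrite /dotz; under eq_fun do rewrite big_ord0 mulr0.
    by rewrite cube_int_cst cos0.
  by rewrite cube_int_cst sin0.
case/tupleP: h => m t; have [hc hs] := IH t; have [bc bs] := bmfun_dotz t (2 * pi).
have bc0 := bmfun_cos_affine (2 * pi * m%:~R) 0.
have bs0 := bmfun_sin_affine (2 * pi * m%:~R) 0.
have ic0 : unit_int (fun x : R => cos (2 * pi * m%:~R * x + 0)) = (m == 0)%:R.
  by rewrite unit_int_cos2pi cos0; case: eqP.
have is0 : unit_int (fun x : R => sin (2 * pi * m%:~R * x + 0)) = 0.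
  by under eq_fun do rewrite addr0; exact: unit_int_sin2pi.
have bt (f : measurableTypeR R -> R) : bounded_measurable f ->
    bounded_measurable (fun x : d.+1.-tuple R => f (thead x)).
  exact: (bmfun_comp (@measurable_tnth _ (measurableTypeR R) d.+1 ord0)).
have bb (f : d.-tuple R -> R) : bounded_measurable f ->
    bounded_measurable (fun x : d.+1.-tuple R => f [tuple of behead x]).
  apply: (bmfun_comp (h := fun x : d.+1.-tuple R => [tuple of behead x])).
  exact: measurable_behead.
split; under eq_fun do rewrite dotz_recl mulrDr ?cosD ?sinD mulrA -[_ * _ * thead _]addr0.
  rewrite cube_intB.
  - rewrite (cube_int_split bc0 bc) (cube_int_split bs0 bs) hc hs is0 ic0 /=.
    by rewrite mulr0 subr0 -natrM mulnb.
  - by apply: bmfunM; [exact: (bt _ bc0)|exact: (bb _ bc)].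
  - by apply: bmfunM; [exact: (bt _ bs0)|exact: (bb _ bs)].
rewrite cube_intD.
- by rewrite (cube_int_split bc0 bs) (cube_int_split bs0 bc) hs is0 mulr0 mul0r addr0.
- by apply: bmfunM; [exact: (bt _ bs0)|exact: (bb _ bc)].
- by apply: bmfunM; [exact: (bt _ bc0)|exact: (bb _ bs)].
Qed.

Lemma unit_intD (u v : measurableTypeR R -> R) :
  bounded_measurable u -> bounded_measurable v ->
  unit_int (fun x => u x + v x) = unit_int u + unit_int v.
Proof.
have ui (w : measurableTypeR R -> R) : bounded_measurable w ->
    lebesgue_measure.-integrable `[0 : R, 1] (EFin \o w).
  move=> [mw [M wM]]; apply: measurable_bounded_integrable => //.
  - by rewrite /= lebesgue_measure_itv /= lte01 ltry.
  - exact: measurable_funTS.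
  - exists M; split; first by rewrite num_real.
    by move=> y My x _ /=; rewrite (le_trans (wM x))// ltW.
by move=> bu bv; apply: RintegralD => //; exact: ui.
Qed.

(** Both sides are the integral of the same function over the one-dimensional cube, factored by
    [cube_int_split] in two ways. *)
Lemma unit_intZ (c : R) (u : measurableTypeR R -> R) : bounded_measurable u ->
  unit_int (fun x => c * u x) = c * unit_int u.
Proof.
move=> bu; have := cube_int_split (d := 0) bu (bmfun_cst (0.-tuple R : measurableType _) c).
have bcu := bmfunM (bmfun_cst (measurableTypeR R : measurableType _) c) bu.
have := cube_int_split (d := 0) bcu (bmfun_cst (0.-tuple R : measurableType _) 1).
rewrite !cube_int_cst mulr1 mulrC => <- <-; congr cube_int.
by apply/funext => x; rewrite mulr1 mulrC.
Qed.
End TrigonometricIntegrals.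

(** * Characters, the cosine basis and the error formulas of the two spaces *)

Section Bases.
Variable R : realType.
Local Notation normc := Normc.normc.

Lemma cis2piD (x y : R) : cis2pi (x + y) = cis2pi x * cis2pi y.
Proof.
rewrite /cis2pi mulrDr cosD sinD; apply/eqP; rewrite eq_complex /=.
by apply/andP; split; apply/eqP; ring.
Qed.

Lemma cis2pi0 : cis2pi 0 = 1 :> R[i].
Proof. by rewrite /cis2pi mulr0 cos0 sin0. Qed.

Lemma cis2piDz (x : R) (m : int) : cis2pi (x + m%:~R) = cis2pi x.
Proof. by rewrite /cis2pi mulrDr addrC cos2pi_int sin2pi_int. Qed.

Lemma cis2pi_sum (I : Type) (s : seq I) (f : I -> R) :
  cis2pi (\sum_(i <- s) f i) = \prod_(i <- s) cis2pi (f i).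
Proof.
elim: s => [|i s IH]; first by rewrite !big_nil cis2pi0.
by rewrite !big_cons cis2piD IH.
Qed.

Lemma cis2piX (x : R) (n : nat) : cis2pi (n%:R * x) = cis2pi x ^+ n.
Proof.
elim: n => [|n IH]; first by rewrite mul0r cis2pi0.
by rewrite -natr1 mulrDl mul1r cis2piD IH exprSr.
Qed.

Lemma cbmfun_cis2pi_dotz d (h : d.-tuple int) :
  cbounded_measurable (fun x : d.-tuple R => cis2pi (dotz h x)).
Proof. exact: bmfun_dotz. Qed.

Lemma dotzN d (h : d.-tuple int) (x : d.-tuple R) :
  - dotz h x = dotz [tuple - tnth h j | j < d] x.
Proof.
rewrite /dotz -sumrN; apply: eq_bigr => j _.
by rewrite tnth_mktuple mulrNz mulNr.
Qed.

Lemma cint_cis2pi d (h k : d.-tuple int) :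
  cint (fun x : d.-tuple R => cis2pi (dotz h x) * cis2pi (- dotz k x)) = (h == k)%:R.
Proof.
have E x : cis2pi (dotz h x) * cis2pi (- dotz k x) =
    cis2pi (dotz [tuple tnth h j - tnth k j | j < d] x) :> R[i].
  rewrite -cis2piD; congr cis2pi; rewrite /dotz -sumrB; apply: eq_bigr => j _.
  by rewrite tnth_mktuple mulrzBr mulrBl.
under eq_fun do rewrite E.
have [hc hs] := cube_int_dotz R [tuple tnth h j - tnth k j | j < d].
rewrite cintE hc hs (_ : all _ _ = (h == k)).
  by case: (h == k).
apply/all_tnthP/eqP => [H|-> j]; last by rewrite tnth_mktuple /= subrr.
apply: eq_from_tnth => j; apply/eqP; rewrite -subr_eq0.
by have := H j; rewrite tnth_mktuple.
Qed.

Definition cos1 (m : nat) (y : R) : R :=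
  (if m == 0%N then 1 else Num.sqrt 2) * cos (pi * m%:R * y).

Lemma cos_basisE d (k : d.-tuple nat) (x : d.-tuple R) :
  cos_basis k x = \prod_(j < d) cos1 (tnth k j) (tnth x j).
Proof.
rewrite /cos1 big_split /= /cos_basis; congr (_ * _).
rewrite -(big_tuple _ _ k xpredT (fun m => if m == 0%N then 1 else Num.sqrt 2)).
elim: (tval k) => [|m s IH]; first by rewrite big_nil expr0.
rewrite big_cons /= exprD IH; congr (_ * _).
by case: eqP => _; rewrite ?expr0 ?expr1.
Qed.

Lemma bmfun_cos1 m : bounded_measurable (cos1 m : measurableTypeR R -> R).
Proof.
apply: bmfunM; first exact: bmfun_cst.
by under eq_fun do rewrite -[_ * _]addr0; exact: bmfun_cos_affine.
Qed.

Lemma unit_int_cos1 m p : unit_int (fun y => cos1 m y * cos1 p y) = (m == p)%:R.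
Proof.
pose a (m : nat) : R := if m == 0%N then 1 else Num.sqrt 2.
have E y : cos1 m y * cos1 p y = a m * a p / 2 *
    (cos (pi * (m%:Z + p%:Z)%:~R * y + 0) + cos (pi * (m%:Z - p%:Z)%:~R * y + 0)).
  rewrite /cos1 -/(a m) -/(a p) !addr0; move: (pi : R) => P.
  rewrite rmorphD rmorphB /= -!pmulrn.
  have -> : P * (m%:R + p%:R) * y = P * m%:R * y + P * p%:R * y by ring.
  have -> : P * (m%:R - p%:R) * y = P * m%:R * y - P * p%:R * y by ring.
  by rewrite cosD cosB; field.
under eq_fun do rewrite E.
rewrite unit_intZ ?unit_intD; try exact: bmfun_cos_affine; last first.
  by apply: bmfunD; exact: bmfun_cos_affine.
under eq_fun do rewrite addr0.
under [X in _ + unit_int X]eq_fun do rewrite addr0.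
rewrite !unit_int_cospi subr_eq0 !eqz_nat addn_eq0.
case: (eqVneq m p) => [<-|mp]; last first.
  by case: (eqVneq m 0%N) mp => [->|] //=; case: (eqVneq p 0%N) => //=;
    rewrite ?addr0 ?mulr0.
rewrite andbb /a; case: eqP => _ /=; first by field.
by rewrite -expr2 sqr_sqrtr // add0r mulr1 divff.
Qed.

Lemma bmfun_cos_basis d (k : d.-tuple nat) :
  bounded_measurable (cos_basis k : d.-tuple R -> R).
Proof.
have -> : (cos_basis k : d.-tuple R -> R) = fun x => \prod_(j < d) cos1 (tnth k j) (tnth x j).
  by apply/funext => x; rewrite cos_basisE.
apply: bmfun_prod => j.
exact: (bmfun_comp (@measurable_tnth _ (measurableTypeR R) d j) (bmfun_cos1 _)).
Qed.

Lemma cint_cos_basis d (k l : d.-tuple nat) :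
  cint (fun x : d.-tuple R => (cos_basis k x)%:C * (cos_basis l x)%:C) = (k == l)%:R.
Proof.
under eq_fun do rewrite -rmorphM.
rewrite cint_real.
have E (x : d.-tuple R) : cos_basis k x * cos_basis l x =
    \prod_(j < d) (fun j y => cos1 (nth 0%N k j) y * cos1 (nth 0%N l j) y) j (tnth x j).
  rewrite !cos_basisE -big_split /=; apply: eq_bigr => j _.
  by rewrite !(tnth_nth 0%N).
under eq_fun do rewrite E.
rewrite (cube_int_prod d (u := fun j y => cos1 (nth 0%N k j) y * cos1 (nth 0%N l j) y)); last by move=> j; apply: bmfunM; exact: bmfun_cos1.
under eq_bigr do rewrite unit_int_cos1 -!tnth_nth.
rewrite -[RHS](rmorph_nat (@real_complex R)); congr _%:C.
case: eqP => [->|kl]; first by rewrite big1 // => j _; rewrite eqxx.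
have [j kj] : exists j, tnth k j != tnth l j.
  apply/existsP; rewrite -negb_forall; apply/negP => /forallP h; apply: kl.
  by apply: eq_from_tnth => j; apply/eqP.
by rewrite (bigD1 j) //= (negbTE kj) mul0r.
Qed.

Lemma rfac_gt0 (a g : R) (k : int) : 0 < g -> 0 < rfac a g k.
Proof.
rewrite /rfac => g0; case: eqP => // /eqP k0.
by rewrite divr_gt0 // powR_gt0 // ltr0n absz_gt0.
Qed.

Lemma rweight_gt0 d (a : R) (g : nat -> R) (k : d.-tuple int) :
  (forall j, 0 < g j) -> 0 < rweight a g k.
Proof. by move=> g0; apply: prodr_gt0 => j _; exact: rfac_gt0. Qed.

Lemma korobov_errorE d (a : R) (g : nat -> R) (J : Type) (s : seq J)
    (w : J -> R[i]) (x : J -> d.-tuple R) :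
  (forall j, 0 < g j) -> (forall j, cube R d (x j)) ->
  wor_error (korobov_space d a g) (fun f => \sum_(j <- s) w j * f (x j)) =
  sqrte (\esum_(h in [set: d.-tuple int])
    (normc ((h == nseq_tuple d 0)%:R - \sum_(j <- s) w j * cis2pi (dotz h (x j))) ^+ 2 /
      rweight a g h)%:E).
Proof.
move=> g0 xc.
have cN (h : d.-tuple int) : cbounded_measurable (fun x : d.-tuple R => cis2pi (- dotz h x)).
  by under eq_fun do rewrite dotzN; exact: cbmfun_cis2pi_dotz.
have z0 (y : d.-tuple R) : dotz (nseq_tuple d 0) y = 0.
  by rewrite /dotz big1 // => j _; rewrite tnth_nseq mul0r.
rewrite -[korobov_space d a g]/(series_space
  (fun (h : d.-tuple int) x => cis2pi (dotz h x)) (fun h x => cis2pi (- dotz h x))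
  (rweight a g)).
rewrite (wor_errorE (i0 := nseq_tuple d 0) _ cN) //.
- congr sqrte; apply: eq_esum => h _.
  rewrite -[in RHS]cint_cis2pi; congr ((normc (cint _ - _) ^+ 2 / _)%:E).
  by apply/funext => y; rewrite z0 oppr0 cis2pi0 mulr1.
- exact: cbmfun_cis2pi_dotz.
- exact: cint_cis2pi.
- by move=> y; rewrite z0 oppr0 cis2pi0.
- by move=> h; exact: rweight_gt0.
Qed.

Lemma cosine_errorE d (a : R) (g : nat -> R) (J : Type) (s : seq J)
    (w : J -> R[i]) (x : J -> d.-tuple R) :
  (forall j, 0 < g j) -> (forall j, cube R d (x j)) ->
  wor_error (cosine_space d a g) (fun f => \sum_(j <- s) w j * f (x j)) =
  sqrte (\esum_(k in [set: d.-tuple nat])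
    (normc ((k == nseq_tuple d 0%N)%:R - \sum_(j <- s) w j * (cos_basis k (x j))%:C) ^+ 2 /
      rweight a g (map_tuple Posz k))%:E).
Proof.
move=> g0 xc.
have cb (k : d.-tuple nat) : cbounded_measurable (fun x : d.-tuple R => (cos_basis k x)%:C).
  exact/cbmfun_real/bmfun_cos_basis.
have z0 (y : d.-tuple R) : cos_basis (nseq_tuple d 0%N) y = 1.
  rewrite cos_basisE big1 // => j _.
  by rewrite tnth_nseq /cos1 eqxx mulr0 mul0r cos0 mulr1.
rewrite -[cosine_space d a g]/(series_space
  (fun (k : d.-tuple nat) x => (cos_basis k x)%:C) (fun k x => (cos_basis k x)%:C)
  (fun k => rweight a g (map_tuple Posz k))).
rewrite (wor_errorE (i0 := nseq_tuple d 0%N) _ cb) //.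
- congr sqrte; apply: eq_esum => h _.
  rewrite -[in RHS]cint_cos_basis; congr ((normc (cint _ - _) ^+ 2 / _)%:E).
  by apply/funext => y; rewrite z0 mulr1.
- exact: cint_cos_basis.
- by move=> y; rewrite z0.
- by move=> h; exact: rweight_gt0.
Qed.

End Bases.

(** * Sums over boxes, the zeta function and the kernel *)

Lemma ler_sum_subseq (R : realDomainType) (I : eqType) (s t : seq I) (u : I -> R) :
  uniq s -> uniq t -> {subset s <= t} -> (forall i, 0 <= u i) ->
  \sum_(i <- s) u i <= \sum_(i <- t) u i.
Proof.
move=> us ut st u0; rewrite [leRHS](bigID (mem s)) /=.
have -> : \sum_(i <- t | i \in s) u i = \sum_(i <- s) u i.
  rewrite -big_filter; apply/perm_big/uniq_perm => //; first by rewrite filter_uniq.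
  by move=> i; rewrite mem_filter /=; apply: andb_idr => /st.
by rewrite lerDl sumr_ge0.
Qed.

Section BoxSums.
Variables (R : realType) (d : nat) (K : choiceType).
Variables (e : nat -> K) (M : nat -> nat).
Hypothesis e_inj : injective e.
Hypothesis e_surj : forall k, exists n, e n = k.
Hypothesis M_homo : {homo M : m n / (m <= n)%N}.
Hypothesis M_ge : forall n, (n <= M n)%N.

Definition box_point m (F : {ffun 'I_d -> 'I_m}) : d.-tuple K :=
  [tuple e (F j) | j < d].

(** Boxes are the exhausting sets for which a sum of products is a product of one-dimensional sums.
    [e] enumerates the frequencies of one coordinate, and [M] selects the box sizes in use. *)
Definition box_seq m : seq (d.-tuple K) :=
  [seq box_point F | F : {ffun 'I_d -> 'I_m}].

Lemma box_point_inj m : injective (@box_point m).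
Proof.
move=> F G FG; apply/ffunP => j; apply/val_inj/e_inj.
by have := congr1 (fun t => tnth t j) FG; rewrite !tnth_mktuple.
Qed.

Lemma box_seq_uniq m : uniq (box_seq m).
Proof. by rewrite map_inj_uniq ?enum_uniq //; exact: box_point_inj. Qed.

Lemma mem_box_seq m (k : d.-tuple K) :
  reflect (forall j, exists2 i, (i < m)%N & e i = tnth k j) (k \in box_seq m).
Proof.
apply: (iffP mapP) => [[F _ ->] j|h].
  by exists (F j) => //; rewrite tnth_mktuple.
have h' j : exists i : 'I_m, e i == tnth k j.
  by have [i im <-] := h j; exists (Ordinal im).
exists [ffun j => xchoose (h' j)]; first by rewrite mem_enum.
apply: eq_from_tnth => j; rewrite tnth_mktuple ffunE.
exact/esym/eqP/(xchooseP (h' j)).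
Qed.

Lemma sub_box_seq m n : (m <= n)%N -> {subset box_seq m <= box_seq n}.
Proof.
move=> mn k /mem_box_seq h; apply/mem_box_seq => j.
by have [i im <-] := h j; exists i => //; exact: leq_trans mn.
Qed.

Lemma box_sum_le (u : d.-tuple K -> R) m n : (forall k, 0 <= u k) -> (m <= n)%N ->
  \sum_(k <- box_seq m) u k <= \sum_(k <- box_seq n) u k.
Proof.
by move=> u0 mn; apply: ler_sum_subseq => //; [exact: box_seq_uniq..|exact: sub_box_seq].
Qed.

(** For nonnegative terms the unordered sum is the supremum of the finite sums, and every finite set
    of tuples lies in some box. *)
Lemma box_sum_cvg (u : d.-tuple K -> R) : (forall k, 0 <= u k) ->
  (\sum_(k <- box_seq (M N)) u k)%:E @[N --> \oo] -->
  (\esum_(k in [set: d.-tuple K]) (u k)%:E)%E.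
Proof.
move=> u0.
have -> : (\esum_(k in [set: d.-tuple K]) (u k)%:E)%E =
    ereal_sup (range (fun N => (\sum_(k <- box_seq (M N)) u k)%:E)).
  apply/eqP; rewrite eq_le; apply/andP; split.
    apply: esum_le_fset => A.
    have [N hN] : exists N, forall k, k \in A -> k \in box_seq (M N).
      have : forall s : seq (d.-tuple K), exists N, forall k, k \in s -> k \in box_seq (M N).
        elim=> [|k s [N hN]]; first by exists 0%N.
        have [i hi] := choice (fun j : 'I_d => e_surj (tnth k j)).
        exists (maxn N (\max_(j < d) i j).+1) => k'; rewrite inE => /predU1P[->|/hN].
          apply/mem_box_seq => j; exists (i j) => //.
          apply: leq_trans (M_ge _); rewrite leq_max; apply/orP; right.
          by rewrite ltnS; exact: leq_bigmax.
        by apply: sub_box_seq; apply: M_homo; exact: leq_maxl.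
      by move=> /(_ (enum_fset A)).
    apply: (@le_trans _ _ (\sum_(k <- box_seq (M N)) u k)%:E).
      rewrite sumEFin lee_fin; by apply: ler_sum_subseq; rewrite ?box_seq_uniq ?fset_uniq.
    by apply: ereal_sup_ubound; exists N.
  apply: ub_ereal_sup => _ [N _ <-].
  apply: esum_ge; exists [set` box_seq (M N)] => //; first by split => //; exact: finite_seq.
  rewrite fsbig_finite /=; last exact: finite_seq.
  rewrite -sumEFin.
  rewrite [leRHS](perm_big (box_seq (M N))) //=.
  apply: uniq_perm => [||k]; rewrite ?fset_uniq ?box_seq_uniq //.
  by rewrite in_fset_set ?mem_setE //; exact: finite_seq.
apply: ereal_nondecreasing_cvgn => m n mn.
by rewrite lee_fin box_sum_le // M_homo.
Qed.

Lemma box_sum_prod (S : comNzRingType) m (f : 'I_d -> K -> S) :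
  \sum_(k <- box_seq m) \prod_(j < d) f j (tnth k j) =
  \prod_(j < d) \sum_(i < m) f j (e i).
Proof.
rewrite bigA_distr_bigA big_map big_enum; apply: eq_bigr => F _.
by apply: eq_bigr => j _; rewrite tnth_mktuple.
Qed.

End BoxSums.

(** The enumeration 0, -1, 1, -2, 2, ...; its first 2N+1 values are the integers of absolute value
    at most N. *)
Definition zigzag (n : nat) : int := if odd n then Negz n./2 else Posz n./2.

Lemma zigzag_inj : injective zigzag.
Proof.
move=> m n; rewrite /zigzag; have := odd_double_half m; have := odd_double_half n.
by case: (odd m); case: (odd n) => //= Hn Hm [E]; rewrite -Hm -Hn E.
Qed.

Lemma zigzag_surj k : exists n, zigzag n = k.
Proof.
case: k => n; [exists n.*2|exists n.*2.+1]; rewrite /zigzag /=.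
  by rewrite odd_double doubleK.
by rewrite odd_double uphalf_double.
Qed.

Lemma zigzag_sum (V : zmodType) (f : int -> V) N :
  \sum_(i < N.*2.+1) f (zigzag i) = f 0 + \sum_(1 <= k < N.+1) (f k%:Z + f (- k%:Z)).
Proof.
elim: N => [|N IH]; first by rewrite big_ord_recl big_ord0 big_nil.
rewrite doubleS 2!big_ord_recr /= IH [in RHS]big_nat_recr //= -!addrA; congr (_ + (_ + _)).
by rewrite /zigzag /= odd_double /= uphalf_double doubleK addrC NegzE.
Qed.

Lemma nat_box_sum (V : zmodType) (f : nat -> V) N :
  \sum_(i < N.+1) f i = f 0%N + \sum_(1 <= k < N.+1) f k.
Proof. by rewrite -(big_mkord xpredT) big_ltn. Qed.

(** * The zeta function, the kernel series and subadditivity of powers *)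

Section PowerSeries.
Variable R : realType.
Implicit Types s t x : R.

Definition psum s N : R := \sum_(1 <= k < N.+1) k%:R `^ (- s).

Lemma psum_homo s : {homo psum s : m n / (m <= n)%N >-> m <= n}.
Proof.
move=> m n mn; rewrite /psum [leRHS](big_cat_nat (n := m.+1)) //= lerDl.
by apply: sumr_ge0 => k _; exact: powR_ge0.
Qed.

(** Cauchy condensation: the block of indices from 2^m to 2^(m+1) - 1 has 2^m terms of size at most
    2^(-m s), hence total at most [t ^+ m]. *)
Lemma psum_bound s : 1 < s -> exists B, forall N, psum s N <= B.
Proof.
move=> s1; pose t : R := 2 `^ (1 - s).
have t0 : 0 < t by exact: powR_gt0.
have t1 : t < 1.
  rewrite /t -opprB powRN invf_lt1 ?powR_gt0 //.
  have := @gt0_ltr_powR R (s - 1); rewrite subr_gt0 => /(_ s1 1 2).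
  by rewrite powR1 !nnegrE; apply => //; rewrite ltr1n.
exists (1 - t)^-1 => N.
have h m : psum s (2 ^ m).-1 <= \sum_(j < m) t ^+ j.
  elim: m => [|m IH]; first by rewrite expn0 /psum big_nil big_ord0.
  have e2 : (0 < 2 ^ m)%N by rewrite expn_gt0.
  rewrite big_ord_recr /= /psum prednK ?expn_gt0 //.
  rewrite (big_cat_nat (n := (2 ^ m)%N)) //=; last by rewrite leq_pexp2l.
  apply: lerD; first by move: IH; rewrite /psum prednK.
  apply: (@le_trans _ _ (\sum_(2 ^ m <= k < 2 ^ m.+1) (2 ^ m)%:R `^ (- s))).
    rewrite !big_seq; apply: ler_sum => k; rewrite mem_index_iota => /andP[k1 k2].
    rewrite !powRN lef_pV2 ?posrE ?powR_gt0 ?ltr0n //; last exact: leq_trans k1.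
    rewrite ge0_ler_powR ?nnegrE ?ler0n ?ler_nat //.
    by rewrite (le_trans _ (ltW s1)).
  rewrite sumr_const_nat expnS mul2n -addnn addnK.
  rewrite -[_ *+ _]mulr_natl /t -[in leRHS]powR_mulrn ?powR_ge0 // -powRrM.
  rewrite natrX -powR_mulrn // -powRrM -powRD; last by rewrite pnatr_eq0 implybT.
  by rewrite mulrBl mul1r mulrN [s * _]mulrC.
have [m hm] : exists m, (N <= (2 ^ m).-1)%N.
  by exists N; rewrite -ltnS prednK ?expn_gt0 // ltn_expl.
apply: (le_trans (psum_homo _ hm)); apply: (le_trans (h m)).
rewrite -[leRHS]mul1r ler_pdivlMr ?subr_gt0 // mulrC.
have := subrXX 1 t m; rewrite expr1n => E.
under eq_bigr do rewrite -[t ^+ _]mul1r.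
under eq_bigr => j _ do rewrite -(expr1n R (m.-1 - j)).
have -> : \sum_(j < m) 1 ^+ (m.-1 - j) * t ^+ j = \sum_(i < m) 1 ^+ (m.-1 - i) * t ^+ i by [].
rewrite -E; first by rewrite lerBlDr lerDl exprn_ge0 // ltW.
Qed.

Lemma psum_cvg s : 1 < s -> psum s N @[N --> \oo] --> zeta s.
Proof.
move=> s1; have [B hB] := psum_bound s1.
apply: nondecreasing_is_cvgn; first exact: psum_homo.
by exists B => _ [N _ <-].
Qed.

Lemma psum_le_zeta s N : 1 < s -> psum s N <= zeta s.
Proof.
move=> s1; apply: (@nondecreasing_cvgn_le _ (psum s)); first exact: psum_homo.
by apply/cvg_ex; exists (zeta s); exact: psum_cvg.
Qed.

Lemma zeta_ge0 s : 1 < s -> 0 <= zeta s.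
Proof.
by move=> s1; apply: le_trans (psum_le_zeta 0 s1); rewrite /psum big_nil.
Qed.

Lemma psum_mul_cvg s (c : nat -> R) : 1 < s -> (forall k, `|c k| <= 2) ->
  cvgn (fun N => \sum_(1 <= k < N.+1) c k / k%:R `^ s).
Proof.
move=> s1 c2.
have E (f : nat -> R) : (fun N => \sum_(1 <= k < N.+1) f k) = series (fun k => f k.+1).
  by apply/funext => N; rewrite big_add1.
rewrite E; apply: normed_cvg.
apply: (@series_le_cvg _ _ (fun k => 2 * k.+1%:R `^ (- s))).
- by move=> n /=; exact: normr_ge0.
- by move=> n; rewrite mulr_ge0 ?powR_ge0.
- move=> n /=; rewrite normrM normfV [X in _ * X^-1]ger0_norm ?powR_ge0 // powRN.
  by rewrite ler_wpM2r ?invr_ge0 ?powR_ge0.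
rewrite -(E (fun k => 2 * k%:R `^ (- s))).
apply/cvg_ex; exists (2 * zeta s).
under eq_fun do rewrite -mulr_sumr.
by apply: cvgMr; exact: psum_cvg.
Qed.

Lemma korobov_kernel_cvg (a x : R) : 2^-1 < a ->
  \sum_(1 <= h < N.+1) 2 * cos (2 * pi * h%:R * x) / h%:R `^ (2 * a)
    @[N --> \oo] --> korobov_kernel a x.
Proof.
move=> a2; apply: (@psum_mul_cvg _ (fun h => 2 * cos (2 * pi * h%:R * x))).
  by rewrite mulrC -ltr_pdivrMr // mul1r.
by move=> k; rewrite normrM ger0_norm // ler_piMr // cos_max.
Qed.

(** For two terms: the shares x/(x+y) and y/(x+y) lie in [0,1], where raising to the power [l <= 1]
    does not decrease a number, and they add up to 1. *)
Lemma powR_subadditive (I : Type) (r : seq I) (f : I -> R) (l : R) :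
  0 < l <= 1 -> (forall i, 0 <= f i) ->
  (\sum_(i <- r) f i) `^ l <= \sum_(i <- r) f i `^ l.
Proof.
move=> /andP[l0 l1] f0; elim: r => [|i r IH].
  by rewrite !big_nil powR0 // gt_eqF.
rewrite !big_cons; apply: le_trans (lerD (lexx _) IH).
have: 0 <= \sum_(j <- r) f j by exact: sumr_ge0.
move: (f0 i) (\sum_(j <- r) f j) => + y; move: (f i) => x x0 y0.
have [s0|sn0] := eqVneq (x + y) 0.
  by rewrite s0 powR0 ?gt_eqF // addr_ge0 ?powR_ge0.
have sp : 0 < x + y by rewrite lt_neqAle eq_sym sn0 addr_ge0.
have h z : 0 <= z -> z <= x + y -> z / (x + y) <= (z / (x + y)) `^ l.
  move=> z0 zs; have [->|zn0] := eqVneq z 0; first by rewrite mul0r powR_ge0.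
  apply: ger1_powR => //; rewrite ler_pdivrMr // mul1r zs andbT.
  by rewrite divr_gt0 // lt_neqAle eq_sym zn0.
have hx := h x x0; rewrite lerDl y0 in hx; have {}hx := hx isT.
have hy := h y y0; rewrite lerDr x0 in hy; have {}hy := hy isT.
have : 1 <= (x / (x + y)) `^ l + (y / (x + y)) `^ l.
  by apply: le_trans (lerD hx hy); rewrite -mulrDl divff.
rewrite !powRM ?invr_ge0 ?(ltW sp) // -mulrDl.
rewrite -powR_inv1 ?(ltW sp) // -powRrM mulN1r powRN ler_pdivlMr ?powR_gt0 //.
by rewrite mul1r.
Qed.
End PowerSeries.

(** * Errors of lattice rules and of tent-transformed lattice rules *)

Section CvgBig.
Variables (R : realType) (I : Type).

Lemma cvgn_sum (s : seq I) (f : I -> nat -> R) (l : I -> R) :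
  (forall i, f i N @[N --> \oo] --> l i) ->
  \sum_(i <- s) f i N @[N --> \oo] --> \sum_(i <- s) l i.
Proof.
move=> h; elim: s => [|i s IH].
  by under eq_fun do rewrite big_nil; rewrite big_nil; exact: cvg_cst.
by under eq_fun do rewrite big_cons; rewrite big_cons; exact: cvgD.
Qed.

Lemma cvgn_prod (s : seq I) (f : I -> nat -> R) (l : I -> R) :
  (forall i, f i N @[N --> \oo] --> l i) ->
  \prod_(i <- s) f i N @[N --> \oo] --> \prod_(i <- s) l i.
Proof.
move=> h; elim: s => [|i s IH].
  by under eq_fun do rewrite big_nil; rewrite big_nil; exact: cvg_cst.
by under eq_fun do rewrite big_cons; rewrite big_cons; exact: cvgM.
Qed.
End CvgBig.

(** * Truncated dual lattice sums and kernel means *)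

Section KorobovError.
Variable R : realType.
Local Notation normc := Normc.normc.

Definition lattice_dot d n (h : d.-tuple int) (z : d.-tuple 'I_n) : int :=
  \sum_(j < d) tnth h j * (tnth z j)%:Z.

Definition in_dual d n (z : d.-tuple 'I_n) (h : d.-tuple int) : bool :=
  (n%:Z %| lattice_dot h z)%Z.

Lemma fracpartE (x : R) : fracpart x = x + (- Num.floor x)%:~R.
Proof. by rewrite mulrNz. Qed.

Lemma fracpart_itv (x : R) : 0 <= fracpart x <= 1.
Proof.
rewrite subr_ge0 floor_le_tmp //= lerBlDl; apply/ltW.
by rewrite (lt_le_trans (floorD1_gt x)) // intrD1.
Qed.

Lemma lattice_point_cube d n (z : d.-tuple 'I_n) i : cube R d (lattice_point R z i).
Proof. by move=> j; rewrite tnth_mktuple fracpart_itv. Qed.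

Lemma dotz_lattice_point d n (z : d.-tuple 'I_n) (h : d.-tuple int) i :
  cis2pi (dotz h (lattice_point R z i)) =
  \prod_(j < d) cis2pi ((tnth h j)%:~R * ((i * tnth z j)%N%:R / n%:R)).
Proof.
rewrite cis2pi_sum; apply: eq_bigr => j _.
by rewrite tnth_mktuple fracpartE mulrDr -intrM cis2piDz.
Qed.

Lemma dotz_lattice_point_dot d n (z : d.-tuple 'I_n) (h : d.-tuple int) i :
  cis2pi (dotz h (lattice_point R z i)) =
  cis2pi (i%:R * ((lattice_dot h z)%:~R / n%:R)).
Proof.
rewrite dotz_lattice_point -cis2pi_sum; congr cis2pi.
rewrite /lattice_dot rmorph_sum /= mulr_suml mulr_sumr; apply: eq_bigr => j _.
by rewrite natrM intrM -!pmulrn; ring.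
Qed.

(** Cosine is injective on [0, pi], which settles t <= 1/2; a larger t is reflected to 1 - t. *)
Lemma cos2pi_neq1 (t : R) : 0 < t < 1 -> cos (2 * pi * t) != 1.
Proof.
have half (s : R) : 0 < s <= 2^-1 -> cos (2 * pi * s) != 1.
  move=> /andP[s0 s1]; apply/eqP => c1.
  have p0 := pi_gt0 R.
  have := @cos_inj R (2 * pi * s) 0; rewrite cos0 c1 !in_itv /= lexx pi_ge0.
  have h1 : 0 <= 2 * pi * s <= pi.
    rewrite !mulr_ge0 ?(ltW p0) ?(ltW s0) //= mulrC mulrA.
    by rewrite ger_pMl // -ler_pdivlMr // mul1r.
  move=> /(_ h1 isT erefl) /eqP; rewrite !mulf_eq0 pnatr_eq0 /=.
  by rewrite !gt_eqF.
move=> /andP[t0 t1]; have [tl|tr] := leP t 2^-1; first by apply: half; rewrite t0.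
have -> : 2 * pi * t = 2 * pi * 1%:~R + - (2 * pi * (1 - t)) by ring.
rewrite cos2pi_int cosN; apply: half; lra.
Qed.

Lemma cis2pi_neq1 (t : R) : 0 < t < 1 -> cis2pi t != 1.
Proof.
by move=> /cos2pi_neq1 h; apply: contra h => /eqP [-> _].
Qed.

Lemma cis2piDN (t : R) : cis2pi t + cis2pi (- t) = (2 * cos (2 * pi * t))%:C.
Proof.
rewrite /cis2pi mulrN cosN sinN; apply/eqP; rewrite eq_complex /= subrr eqxx andbT.
by apply/eqP; ring.
Qed.

(** A geometric sum whose ratio is an [n]-th root of unity, equal to 1 exactly when [n] divides
    [m]. *)
Lemma unity_root_sum n (m : int) : (0 < n)%N ->
  (n%:R)^-1 * \sum_(1 <= i < n.+1) cis2pi (i%:R * (m%:~R / n%:R)) =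
  ((n%:Z %| m)%Z)%:R :> R[i].
Proof.
move=> n0; have nR : (n%:R : R) != 0 by rewrite pnatr_eq0 -lt0n.
have nC : (n%:R : R[i]) != 0 by rewrite pnatr_eq0 -lt0n.
pose x := cis2pi (m%:~R / n%:R) : R[i].
under eq_bigr do rewrite cis2piX -/x.
have xn : x ^+ n = 1.
  by rewrite -cis2piX mulrCA divff // mulr1 -[_%:~R]add0r cis2piDz cis2pi0.
case: (boolP (n%:Z %| m)%Z) => [/dvdzP[q mq]|nm].
  have -> : x = 1.
    rewrite /x mq intrM -pmulrn mulfK // -[_%:~R]add0r cis2piDz cis2pi0 //.
  under eq_bigr do rewrite expr1n.
  by rewrite sumr_const_nat subSS subn0 mulVf.
have x1 : x != 1.
  have -> : x = cis2pi ((m %% n)%Z%:~R / n%:R).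
    rewrite /x {1}(divz_eq m n%:Z) intrD intrM -pmulrn mulrDl mulfK //.
    by rewrite addrC cis2piDz.
  apply: cis2pi_neq1.
  have mn0 : 0 < (m %% n)%Z.
    rewrite lt_neqAle modz_ge0 ?eqz_nat -?lt0n // andbT eq_sym.
    by apply: contra nm => /eqP h; exact/dvdz_mod0P.
  rewrite divr_gt0 ?ltr0z ?ltr0n //= ltr_pdivrMr ?ltr0n // mul1r pmulrn ltr_int.
  by rewrite ltz_pmod.
rewrite big_add1 /= big_mkord.
under eq_bigr do rewrite exprS.
rewrite -mulr_sumr.
have := subrX1 x n; rewrite xn subrr => /esym/eqP.
by rewrite mulf_eq0 subr_eq0 (negbTE x1) /= => /eqP ->; rewrite !mulr0.
Qed.

(** The truncated one-dimensional Korobov kernel for the weight [g / 2], as a function of the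
    difference of its arguments; the frequencies k and -k combine into [2 * cos]. *)
Definition kernel_factor (a : R) (g : R) N (t : R) : R :=
  1 + g / 2 * \sum_(1 <= k < N.+1) 2 * cos (2 * pi * k%:R * t) / k%:R `^ (2 * a).

Definition kernel_mean_trunc d n (a : R) (g : nat -> R) (z : d.-tuple 'I_n) N : R :=
  n%:R^-1 * \sum_(1 <= i < n.+1)
    \prod_(j < d) kernel_factor a (g j) N ((i * tnth z j)%N%:R / n%:R).

Definition kernel_mean d n (a : R) (g : nat -> R) (z : d.-tuple 'I_n) : R :=
  n%:R^-1 * \sum_(1 <= i < n.+1)
    \prod_(j < d) (1 + g j / 2 * korobov_kernel a ((i * tnth z j)%N%:R / n%:R)).

Lemma kernel_mean_cvg d n (a : R) (g : nat -> R) (z : d.-tuple 'I_n) : 2^-1 < a ->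
  kernel_mean_trunc a g z N @[N --> \oo] --> kernel_mean a g z.
Proof.
move=> a2; apply: cvgMr; apply: cvgn_sum => i; apply: cvgn_prod => j.
by apply: cvgD; [exact: cvg_cst|apply: cvgMr; exact: korobov_kernel_cvg].
Qed.

Definition dual_sum_trunc d n (a : R) (g : nat -> R) (z : d.-tuple 'I_n) N : R :=
  \sum_(h <- box_seq d zigzag N.*2.+1)
    (in_dual z h)%:R / rweight a (half_weights g) h.

(** Expanding the product of kernels over the box gives characters, and the mean of a character over
    the nodes is the indicator of the dual lattice. The computation is done in [R[i]], where
    characters are multiplicative. *)
Lemma dual_sum_truncE d n (a : R) (g : nat -> R) (z : d.-tuple 'I_n) N : (0 < n)%N ->
  dual_sum_trunc a g z N = kernel_mean_trunc a g z N.
Proof.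
move=> n0; apply/(@complexI R); rewrite /dual_sum_trunc /kernel_mean_trunc.
rewrite rmorph_sum rmorphM rmorph_sum /= fmorphV rmorph_nat.
transitivity (n%:R^-1 * \sum_(1 <= i < n.+1) \sum_(h <- box_seq d zigzag N.*2.+1)
    \prod_(j < d) (cis2pi ((tnth h j)%:~R * ((i * tnth z j)%N%:R / n%:R)) *
      ((rfac a (half_weights g j) (tnth h j))^-1)%:C) : R[i]).
  rewrite exchange_big /= mulr_sumr; apply: eq_bigr => h _.
  rewrite rmorphM /= rmorph_nat -unity_root_sum // -mulrA; congr (_ * _).
  rewrite mulr_suml; apply: eq_bigr => i _.
  rewrite big_split /= -dotz_lattice_point dotz_lattice_point_dot; congr (_ * _).
  by rewrite /rweight fmorphV rmorph_prod -prodfV; apply: eq_bigr => j _; rewrite fmorphV.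
congr (_ * _); apply: eq_bigr => i _.
rewrite (@box_sum_prod d _ zigzag _ _ (fun j m => cis2pi (m%:~R * ((i * tnth z j)%N%:R / n%:R)) *
      ((rfac a (half_weights g j) m)^-1)%:C)).
rewrite rmorph_prod; apply: eq_bigr => j _ /=.
set t := (_ / _); rewrite (zigzag_sum (fun m : int => cis2pi (m%:~R * t) * ((rfac a (half_weights g j) m)^-1)%:C)).
rewrite mul0r cis2pi0 /rfac eqxx invr1 mulr1 rmorphD rmorph1; congr (_ + _).
rewrite mulr_sumr rmorph_sum /=.
apply: eq_big_nat => k /andP[k0 _].
rewrite oppr_eq0 eqz_nat gtn_eqF //= abszN.
rewrite absz_nat -mulrDl mulrNz mulNr cis2piDN -rmorphM /= -pmulrn; congr _%:C.
by rewrite /half_weights invfM invrK !mulrA; ring.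
Qed.

End KorobovError.

(** * The Korobov error, the mean square error of the tent rule, and the shift *)

Section ErrorFormulas.
Variable R : realType.
Local Notation normc := Normc.normc.
Variables (d n : nat) (a : R) (g : nat -> R) (z : d.-tuple 'I_n).
Hypothesis n0 : (0 < n)%N.
Hypothesis a2 : 2^-1 < a.
Hypothesis g0 : forall j, 0 < g j.

Lemma half_weights_gt0 j : 0 < half_weights g j.
Proof. by rewrite divr_gt0. Qed.

Lemma rweight_nseq0 (g' : nat -> R) : rweight a g' (nseq_tuple d 0) = 1.
Proof. by rewrite /rweight big1 // => j _; rewrite tnth_nseq /rfac eqxx. Qed.

Lemma in_dual0 : in_dual z (nseq_tuple d 0).
Proof.
by rewrite /in_dual /lattice_dot big1 ?dvdz0 // => j _; rewrite tnth_nseq mul0r.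
Qed.

Lemma zigzag_homo : {homo (fun N => N.*2.+1) : m n / (m <= n)%N}.
Proof. by move=> p q pq; rewrite ltnS leq_double. Qed.

Lemma zigzag_ge N : (N <= N.*2.+1)%N.
Proof. by rewrite -addnn -addSn leq_addl. Qed.

Lemma dual_sum_cvg :
  (\sum_(h <- box_seq d zigzag N.*2.+1)
     ((h != nseq_tuple d 0) && in_dual z h)%:R / rweight a (half_weights g) h)%:E
   @[N --> \oo] --> (kernel_mean a g z - 1)%:E.
Proof.
apply: cvg_EFin; first exact: nearW.
rewrite (_ : _ \o _ = fun N => kernel_mean_trunc a g z N - 1).
  by apply: cvgB; [exact: kernel_mean_cvg|exact: cvg_cst].
apply/funext => N /=; rewrite -dual_sum_truncE // /dual_sum_trunc.
have z_in : nseq_tuple d 0 \in box_seq d zigzag N.*2.+1.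
  by apply/mem_box_seq => j; exists 0%N => //; rewrite tnth_nseq.
rewrite !(bigD1_seq _ z_in) ?box_seq_uniq //=; try exact: zigzag_inj.
rewrite eqxx mul0r add0r in_dual0 rweight_nseq0 divr1 addrC addrK.
by apply: eq_bigr => h /negbTE ->.
Qed.

Lemma korobov_esum :
  (\esum_(h in [set: d.-tuple int])
    (((h != nseq_tuple d 0) && in_dual z h)%:R / rweight a (half_weights g) h)%:E =
   (kernel_mean a g z - 1)%:E)%E.
Proof.
rewrite -(cvg_lim (@ereal_hausdorff R) dual_sum_cvg).
apply/esym/(cvg_lim (@ereal_hausdorff R)).
apply: box_sum_cvg; [exact: zigzag_inj|exact: zigzag_surj|exact: zigzag_homo|
  exact: zigzag_ge|move=> h].
by rewrite divr_ge0 // ltW // rweight_gt0 // => j; exact: half_weights_gt0.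
Qed.

Lemma kernel_mean_ge1 : 0 <= kernel_mean a g z - 1.
Proof.
rewrite -lee_fin -korobov_esum; apply: esum_ge0 => h _.
by rewrite lee_fin divr_ge0 // ltW // rweight_gt0 // => j; exact: half_weights_gt0.
Qed.

Lemma lattice_korobov_errorE :
  lattice_korobov_error a g z = (Num.sqrt (kernel_mean a g z - 1))%:E.
Proof.
rewrite /lattice_korobov_error.
rewrite (_ : lattice_rule z = fun f => \sum_(i <- index_iota 1 n.+1)
    (n%:R)^-1 * f (lattice_point R z i)); last first.
  by apply/funext => f; rewrite /lattice_rule mulr_sumr.
rewrite korobov_errorE; [|exact: half_weights_gt0|exact: lattice_point_cube].
rewrite -[RHS]/(sqrte (kernel_mean a g z - 1)%:E) -korobov_esum.
congr sqrte; apply: eq_esum => h _; congr (_ / _)%:E.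
under eq_bigr do rewrite dotz_lattice_point_dot.
rewrite -mulr_sumr unity_root_sum //.
case: eqP => [->|_] /=.
  have := in_dual0; rewrite /in_dual => ->.
  by rewrite subrr /normc /= expr0n /= addr0 sqrtr0 expr0n.
rewrite sub0r normcN' /in_dual; case: (n%:Z %| _)%Z.
  by rewrite /normc /= expr0n /= addr0 expr1n sqrtr1 expr1n.
by rewrite /normc /= expr0n /= addr0 sqrtr0 expr0n.
Qed.

Definition tent_quad (k : d.-tuple nat) (D : d.-tuple R) : R :=
  n%:R^-1 * \sum_(1 <= i < n.+1) cos_basis k (tent_point z D i).

(** On [0, 1/2] the tent is 2t, on [1/2, 1] it is 2 - 2t, and the cosine of pi m times either is the
    same by evenness and periodicity. The frequency has doubled, so the fractional part
    disappears. *)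
Lemma cos1_tent m (y : R) :
  cos1 m (tent (fracpart y)) = (if m == 0%N then 1 else Num.sqrt 2) * cos (2 * pi * m%:R * y).
Proof.
have -> : cos (2 * pi * m%:R * y) = cos (2 * pi * m%:R * fracpart y).
  rewrite fracpartE -(cos2pi_int (m%:Z * - Num.floor y)) intrM -pmulrn.
  by congr cos; ring.
rewrite /cos1; congr (_ * _); have := fracpart_itv y; move: (fracpart y) => t.
move=> /andP[t0 t1]; rewrite /tent; have [tl|tr] := leP (2 * t - 1) 0.
  by rewrite ler0_norm //; congr cos; ring.
rewrite gtr0_norm // (_ : pi * _ * _ = 2 * pi * m%:Z%:~R + - (2 * pi * m%:R * t)).
  by rewrite cos2pi_int cosN.
by rewrite -pmulrn; ring.
Qed.

Lemma cos_basis_tent (k : d.-tuple nat) (D : d.-tuple R) i :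
  cos_basis k (tent_point z D i) =
  \prod_(j < d) ((if tnth k j == 0%N then 1 else Num.sqrt 2) *
     cos (2 * pi * (tnth k j)%:R * tnth D j +
          2 * pi * (tnth k j)%:R * ((i * tnth z j)%N%:R / n%:R))).
Proof.
rewrite cos_basisE; apply: eq_bigr => j _; rewrite tnth_mktuple cos1_tent.
by rewrite mulrDr addrC.
Qed.

Lemma bmfun_tent (k : d.-tuple nat) i :
  bounded_measurable (fun D : d.-tuple R => cos_basis k (tent_point z D i)).
Proof.
under eq_fun do rewrite cos_basis_tent.
apply: bmfun_prod => j; apply: bmfunM; first exact: bmfun_cst.
exact: (bmfun_comp (@measurable_tnth _ (measurableTypeR R) d j) (bmfun_cos_affine _ _)).
Qed.

Lemma bmfun_tent_quad (k : d.-tuple nat) :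
  bounded_measurable (fun D : d.-tuple R => tent_quad k D).
Proof.
apply: bmfunM; first exact: bmfun_cst.
by apply: bmfun_sum => i; exact: bmfun_tent.
Qed.

Lemma tent_point_cube (D : d.-tuple R) i : cube R d (tent_point z D i).
Proof.
move=> j; rewrite tnth_mktuple /tent; have := fracpart_itv ((i * tnth z j)%N%:R / n%:R + tnth D j).
move: (fracpart _) => t /andP[t0 t1].
have [tl|tr] := leP (2 * t - 1) 0; [rewrite ler0_norm //|rewrite gtr0_norm //]; lra.
Qed.

(** Frequency 0 contributes nothing because the rule is exact on constants; any other basis function
    has integral 0, so its error is the quadrature value up to sign. *)
Definition tent_term (k : d.-tuple nat) (D : d.-tuple R) : R :=
  (k != nseq_tuple d 0%N)%:R * tent_quad k D ^+ 2 / rweight a g (map_tuple Posz k).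

Lemma tent_term_ge0 k D : 0 <= tent_term k D.
Proof.
rewrite /tent_term; apply: divr_ge0; last exact/ltW/rweight_gt0.
by rewrite mulr_ge0 ?sqr_ge0.
Qed.

Lemma tent_errorE (D : d.-tuple R) :
  tent_error a g z D = sqrte (\esum_(k in [set: d.-tuple nat]) (tent_term k D)%:E).
Proof.
rewrite /tent_error.
rewrite (_ : tent_lattice_rule z D = fun f => \sum_(i <- index_iota 1 n.+1)
    (n%:R)^-1 * f (tent_point z D i)); last first.
  by apply/funext => f; rewrite /tent_lattice_rule mulr_sumr.
rewrite cosine_errorE //; last exact: tent_point_cube.
congr sqrte; apply: eq_esum => k _; congr (_ / _)%:E.
have -> : \sum_(i <- index_iota 1 n.+1) n%:R^-1 * (cos_basis k (tent_point z D i))%:C =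
    (tent_quad k D)%:C.
  by rewrite /tent_quad rmorphM rmorph_sum fmorphV rmorph_nat mulr_sumr.
case: eqP => [->|_] /=.
  rewrite mul0r (_ : tent_quad _ _ = 1).
    by rewrite /normc /= !subrr expr0n /= addr0 sqrtr0 expr0n.
  rewrite /tent_quad (eq_bigr (fun=> 1)) => [|i _].
    by rewrite sumr_const_nat subSS subn0 mulVf // pnatr_eq0 -lt0n.
  rewrite cos_basis_tent big1 // => j _.
  by rewrite tnth_nseq eqxx mulr0 !mul0r addr0 cos0 mulr1.
by rewrite /normc /= sub0r subrr expr0n addr0 sqrtr_sqr normrN mul1r real_normK ?num_real.
Qed.

Lemma cos_mul2 (u v : R) : 2 * (cos u * cos v) = cos (u + v) + cos (u - v).
Proof. by rewrite cosD cosB; ring. Qed.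

(** For [m != 0] the square of sqrt 2 cancels the 1/2 of the product-to-sum formula and the term in
    [b + c] integrates to 0: averaging over the shift leaves the phase difference only. *)
Lemma unit_int_tent m (b c : R) :
  unit_int (fun y => ((if m == 0%N then 1 else Num.sqrt 2) * cos (2 * pi * m%:R * y + b)) *
     ((if m == 0%N then 1 else Num.sqrt 2) * cos (2 * pi * m%:R * y + c))) =
  if m == 0%N then cos b * cos c else cos (b - c).
Proof.
have [->|m0] := eqVneq m 0%N.
  by under eq_fun do rewrite mulr0 mul0r !add0r !mul1r; exact: unit_int_cst.
under eq_fun => y.
  rewrite mulrACA -expr2 sqr_sqrtr //.
  rewrite cos_mul2.
  rewrite (_ : 2 * pi * m%:R * y + b + _ = 2 * pi * (m%:Z + m%:Z)%:~R * y + (b + c)); last first.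
    by rewrite intrD -pmulrn; ring.
  rewrite (_ : 2 * pi * m%:R * y + b - _ = b - c); last by ring.
  over.
rewrite unit_intD; [|exact: bmfun_cos_affine|exact: bmfun_cst].
by rewrite unit_int_cst unit_int_cos2pi -PoszD eqz_nat addn_eq0 andbb (negbTE m0) add0r.
Qed.

Lemma periodic_sum_shift (G : R -> R) (m : nat) : (forall x, G (x + n%:R) = G x) ->
  \sum_(1 <= i < n.+1) G (i%:R - m%:R) = \sum_(1 <= i < n.+1) G i%:R.
Proof.
move=> per; elim: m => [|m <-]; first by under eq_bigr do rewrite subr0.
rewrite big_add1 /=.
rewrite [LHS](_ : _ = \sum_(0 <= i < n) G (i%:R - m%:R)).
  rewrite [LHS]big_ltn // [RHS]big_nat_recr //= [RHS]addrC; congr (_ + _).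
  by rewrite -[LHS]per; congr G; ring.
by apply: eq_bigr => i _; congr G; rewrite -!natr1; ring.
Qed.


Lemma kernel_factorDz (g1 : R) N (t : R) (m : int) :
  kernel_factor a g1 N (t + m%:~R) = kernel_factor a g1 N t.
Proof.
rewrite /kernel_factor; congr (_ + _ * _); apply: eq_bigr => k _; congr (2 * _ / _).
rewrite -[in RHS](cos2pi_int (k%:Z * m)) intrM -pmulrn.
by congr cos; ring.
Qed.

Lemma cube_int_tent_quad (k : d.-tuple nat) :
  cube_int (fun D => tent_quad k D ^+ 2) =
  n%:R^-1 ^+ 2 * \sum_(1 <= i' < n.+1) \sum_(1 <= i < n.+1)
    \prod_(j < d) cos (2 * pi * (tnth k j)%:R * ((i%:R - i'%:R) * (tnth z j)%:R / n%:R)).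
Proof.
have E D : tent_quad k D ^+ 2 = n%:R^-1 ^+ 2 *
    \sum_(1 <= i' < n.+1) \sum_(1 <= i < n.+1)
      (cos_basis k (tent_point z D i) * cos_basis k (tent_point z D i')).
  rewrite /tent_quad exprMn; congr (_ * _); rewrite expr2 mulr_sumr.
  by apply: eq_bigr => i' _; rewrite mulr_suml.
under eq_fun do rewrite E.
rewrite cube_intZ; last first.
  by apply: bmfun_sum => i'; apply: bmfun_sum => i; apply: bmfunM; exact: bmfun_tent.
congr (_ * _); rewrite cube_int_sum; last first.
  by move=> i'; apply: bmfun_sum => i; apply: bmfunM; exact: bmfun_tent.
apply: eq_bigr => i' _; rewrite cube_int_sum; last first.
  by move=> i; apply: bmfunM; exact: bmfun_tent.
apply: eq_bigr => i _.
pose zz j := nth 0%N (map (@nat_of_ord n) z) j.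
have zzE (j : 'I_d) : zz j = tnth z j.
  by rewrite /zz (nth_map (tnth z j)) ?size_tuple // -tnth_nth.
pose u (i : nat) (j : nat) (y : R) := (if nth 0%N k j == 0%N then 1 else Num.sqrt 2) *
     cos (2 * pi * (nth 0%N k j)%:R * y + 2 * pi * (nth 0%N k j)%:R * ((i * zz j)%N%:R / n%:R)).
have bu i1 j : bounded_measurable (u i1 j : measurableTypeR R -> R).
  by apply: bmfunM; [exact: bmfun_cst|exact: bmfun_cos_affine].
under eq_fun => D.
  rewrite !cos_basis_tent -big_split /=.
  rewrite (eq_bigr (fun j : 'I_d => (fun j y => u i j y * u i' j y) j (tnth D j))); last first.
    by move=> j _; rewrite /u -tnth_nth zzE.
  over.
rewrite (cube_int_prod d (u := fun j y => u i j y * u i' j y)); last first.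
  by move=> j; exact: bmfunM.
apply: eq_bigr => j _; rewrite /u -tnth_nth unit_int_tent zzE.
case: eqP => [->|_]; first by rewrite mulr0 !mul0r cos0 mulr1.
by rewrite !natrM; congr cos; ring.
Qed.

(** Here the weights are halved: g cos(2 pi k t) / k^(2a) is g/2 times the kernel term 2 cos(2 pi k
    t) / k^(2a). The double sum over pairs of nodes depends on their difference only and collapses
    to [n] times a single sum. *)
Lemma tent_box_sum N :
  \sum_(k <- box_seq d id N.+1) cube_int (tent_term k) = kernel_mean_trunc a g z N - 1.
Proof.
have nR : (n%:R : R) != 0 by rewrite pnatr_eq0 -lt0n.
have cubeE k : cube_int (tent_term k) =
    (k != nseq_tuple d 0%N)%:R / rweight a g (map_tuple Posz k) * cube_int (fun D => tent_quad k D ^+ 2).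
  rewrite -cube_intZ; last by apply: bmfunM; exact: bmfun_tent_quad.
  by congr cube_int; apply/funext => D; rewrite /tent_term mulrAC.
have z_in : nseq_tuple d 0%N \in box_seq d id N.+1.
  by apply/mem_box_seq => j; exists 0%N => //; rewrite tnth_nseq.
under eq_bigr do rewrite cubeE.
transitivity (\sum_(k <- box_seq d id N.+1)
    cube_int (fun D => tent_quad k D ^+ 2) / rweight a g (map_tuple Posz k) - 1).
  rewrite !(bigD1_seq _ z_in) ?box_seq_uniq //=.
  rewrite eqxx !mul0r add0r cube_int_tent_quad.
  rewrite (_ : map_tuple Posz _ = nseq_tuple d 0); last first.
    by apply: eq_from_tnth => j; rewrite tnth_map !tnth_nseq.
  rewrite rweight_nseq0 divr1 [X in _ * X](_ : _ = n%:R ^+ 2).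
    rewrite -exprMn mulVf // expr1n addrC addrK.
    by apply: eq_bigr => h /negbTE ->; rewrite /= mul1r mulrC.
  rewrite (eq_bigr (fun=> n%:R)) => [|i' _].
    by rewrite sumr_const_nat subSS subn0 expr2 mulr_natr.
  rewrite (eq_bigr (fun=> 1)) => [|i _]; first by rewrite sumr_const_nat subSS subn0.
  by rewrite big1 // => j _; rewrite tnth_nseq mulr0 mul0r cos0.
congr (_ - 1).
transitivity (n%:R^-1 ^+ 2 * \sum_(1 <= i' < n.+1) \sum_(1 <= i < n.+1)
    \prod_(j < d) kernel_factor a (g j) N ((i%:R - i'%:R) * (tnth z j)%:R / n%:R)).
  under eq_bigr do rewrite cube_int_tent_quad -mulrA.
  rewrite -mulr_sumr; congr (_ * _).
  under eq_bigr do rewrite mulr_suml.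
  rewrite exchange_big /=; apply: eq_bigr => i' _.
  under eq_bigr do rewrite mulr_suml.
  rewrite exchange_big /=; apply: eq_bigr => i _.
  rewrite (eq_bigr (fun k : d.-tuple nat => \prod_(j < d) (fun (j : 'I_d) (m : nat) =>
     cos (2 * pi * m%:R * ((i%:R - i'%:R) * (tnth z j)%:R / n%:R)) / rfac a (g j) m) j (tnth k j))).
    rewrite (@box_sum_prod d _ id _ _ (fun (j : 'I_d) (m : nat) =>
     cos (2 * pi * m%:R * ((i%:R - i'%:R) * (tnth z j)%:R / n%:R)) / rfac a (g j) m)); apply: eq_bigr => j _.
    set t := _ * _ / _.
    rewrite (nat_box_sum (fun m => cos (2 * pi * m%:R * t) / rfac a (g j) m)).
    rewrite mulr0 mul0r cos0 /rfac eqxx divr1 /kernel_factor; congr (_ + _).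
    rewrite mulr_sumr; apply: eq_big_nat => m /andP[m0 _].
    rewrite eqz_nat gtn_eqF // absz_nat invf_div.
    by rewrite !mulrA; congr (_ / _); field.
  move=> k _; rewrite /rweight -prodfV -big_split /=; apply: eq_bigr => j _.
  by rewrite tnth_map.
rewrite /kernel_mean_trunc expr2 -mulrA; congr (_ * _).
(* For fixed [i'] the differences [i - i'] run through a full period modulo [n]. *)
have -> : \sum_(1 <= i' < n.+1) \sum_(1 <= i < n.+1)
    \prod_(j < d) kernel_factor a (g j) N ((i%:R - i'%:R) * (tnth z j)%:R / n%:R) =
    \sum_(1 <= i' < n.+1) \sum_(1 <= i < n.+1)
    \prod_(j < d) kernel_factor a (g j) N (i%:R * (tnth z j)%:R / n%:R).
  apply: eq_bigr => i' _.
  apply: (periodic_sum_shift (G := fun x => \prod_(j < d) kernel_factor a (g j) N (x * (tnth z j)%:R / n%:R))).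
  move=> x; apply: eq_bigr => j _.
  rewrite mulrDl mulrDl [n%:R * _]mulrC mulfK // pmulrn.
  by rewrite kernel_factorDz.
rewrite sumr_const_nat subSS subn0 -[X in _ * X]mulr_natl mulrA mulVf // mul1r.
by apply: eq_bigr => i _; apply: eq_bigr => j _; rewrite natrM.
Qed.

(** The squared error is the increasing limit of the box sums [S N]; this yields its measurability,
    and monotone convergence exchanges the sum over frequencies with the integral over shifts. *)
Lemma tent_error_sqr :
  measurable_fun (cube R d) (fun D => tent_error a g z D ^+ 2)%E /\
  (\int[cube_measure R d]_(D in cube R d) (tent_error a g z D ^+ 2) =
   (kernel_mean a g z - 1)%:E)%E.
Proof.
pose S N (D : d.-tuple R) := \sum_(k <- box_seq d id N.+1) tent_term k D.
have bt k : bounded_measurable (tent_term k : d.-tuple R -> R).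
  apply: bmfunM; last exact: bmfun_cst.
  by apply: bmfunM; [exact: bmfun_cst|apply: bmfunM; exact: bmfun_tent_quad].
have bS N : bounded_measurable (S N) by exact: bmfun_sum.
have id_surj (k : nat) : exists m, id m = k by exists k.
have homoS : {homo S : p q / (p <= q)%N >-> (forall D, p D <= q D)}.
  move=> p q pq D; apply: box_sum_le => //; first by move=> k; exact: tent_term_ge0.
have limS D : (S N D)%:E @[N --> \oo] --> (tent_error a g z D ^+ 2)%E.
  rewrite tent_errorE sqr_sqrte; last first.
    by apply: esum_ge0 => k _; rewrite lee_fin tent_term_ge0.
  apply: (@box_sum_cvg R d _ id succn) => //.
  by move=> k; exact: tent_term_ge0.
have mS N : measurable_fun (cube R d) (fun D => (S N D)%:E).
  by apply/measurable_EFinP; apply: measurable_funTS; case: (bS N).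
split; first by apply: (emeasurable_fun_cvg (fun N D => (S N D)%:E)) => // D _; exact: limS.
transitivity (\int[cube_measure R d]_(D in cube R d) limn (fun N => (S N D)%:E))%E.
  apply: eq_integral => D _.
  by apply/esym/(cvg_lim (@ereal_hausdorff R)); exact: limS.
rewrite monotone_convergence.
- have -> : (fun N => \int[cube_measure R d]_(D in cube R d) (S N D)%:E)%E =
    (fun N => (kernel_mean_trunc a g z N - 1)%:E).
    apply/funext => N; rewrite -tent_box_sum -cube_int_sum //.
    rewrite /cube_int /Rintegral fineK //.
    exact: (integrable_fin_num (measurable_cube (d := d)) (cube_integrable (bS N))).
  apply/(cvg_lim (@ereal_hausdorff R)); apply: cvg_EFin; first exact: nearW.
  by apply: cvgB; [exact: kernel_mean_cvg|exact: cvg_cst].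
- exact: measurable_cube.
- exact: mS.
- by move=> N D _; rewrite lee_fin sumr_ge0 // => k _; exact: tent_term_ge0.
- by move=> D _ p q pq; rewrite lee_fin homoS.
Qed.

Lemma tent_rms_errorE :
  tent_rms_error a g z = (Num.sqrt (kernel_mean a g z - 1))%:E.
Proof. by rewrite /tent_rms_error tent_error_sqr.2. Qed.

Lemma tent_error_ge0 D : (0 <= tent_error a g z D)%E.
Proof. by rewrite tent_errorE sqrte_ge0. Qed.

(** If the squared error exceeded its mean [c] at every shift, the integral of the distance to [c]
    would vanish, so the error would equal [c] almost everywhere and the cube, of measure 1, would
    be a null set. *)
Lemma exists_good_shift : exists2 D : d.-tuple R, cube R d D &
  (tent_error a g z D <= tent_rms_error a g z)%E.
Proof.
apply: contrapT => h; have [mF iF] := tent_error_sqr.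
set c := kernel_mean a g z - 1 in iF.
have c0 : 0 <= c by exact: kernel_mean_ge1.
have mc := measurable_cube (R := R) (d := d).
have Fgt D : cube R d D -> (c%:E < tent_error a g z D ^+ 2)%E.
  move=> cD; rewrite ltNge; apply/negP => le; apply: h; exists D => //.
  rewrite tent_rms_errorE -/c -[leRHS]/(sqrte c%:E).
  by rewrite -[leLHS]gee0_abs ?tent_error_ge0 // -sqrte_sqr lee_sqrt // lee_fin.
have iFc : (cube_measure R d).-integrable (cube R d) (fun D => tent_error a g z D ^+ 2)%E.
  apply/integrableP; split=> //.
  under eq_integral => D _ do rewrite gee0_abs ?expe_ge0 ?tent_error_ge0 //.
  by rewrite iF ltry.
have ic : (cube_measure R d).-integrable (cube R d) (fun=> c%:E).
  exact: (cube_integrable (bmfun_cst _ c)).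
have iG : (\int[cube_measure R d]_(D in cube R d) `|tent_error a g z D ^+ 2 - c%:E| = 0)%E.
  transitivity (\int[cube_measure R d]_(D in cube R d) (tent_error a g z D ^+ 2 - c%:E))%E.
    apply: eq_integral => D /set_mem cD; rewrite gee0_abs // sube_ge0 ?ltW ?Fgt //.
  rewrite integralB // iF integral_cst // [X in (_ - _ * X)%E]cube_measure_cube.
  by rewrite mule1 subee.
have mG : measurable_fun (cube R d) (fun D => tent_error a g z D ^+ 2 - c%:E)%E.
  by apply: emeasurable_funB => //; exact: measurable_cst.
move/(ae_eq_integral_abs (cube_measure R d) mc mG) : iG => /= [N [mN N0 sub]].
have cN : cube R d `<=` N.
  move=> D cD; apply: sub => /= H; have := H cD; have := Fgt D cD.
  by rewrite -sube_gt0 => /[swap] ->; rewrite ltxx.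
have := le_measure (cube_measure R d) (mem_set mc) (mem_set mN) cN.
by rewrite [X in (X <= _)%E -> _]cube_measure_cube [X in (_ <= X)%E -> _]N0 lee_fin ler10.
Qed.

End ErrorFormulas.

(** * The component-by-component bound *)

Section BoxSumRecr.
Variables (K : choiceType) (e : nat -> K).
Hypothesis e_inj : injective e.

Lemma tnth_rcons_widen (T : Type) s (k : s.-tuple T) (x : T) (j : 'I_s) :
  tnth [tuple of rcons k x] (widen_ord (leqnSn s) j) = tnth k j.
Proof. by rewrite !(tnth_nth x) /= nth_rcons size_tuple ltn_ord. Qed.

Lemma tnth_rcons_max (T : Type) s (k : s.-tuple T) (x : T) :
  tnth [tuple of rcons k x] ord_max = x.
Proof. by rewrite (tnth_nth x) /= nth_rcons size_tuple ltnn eqxx. Qed.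

Lemma box_sum_recr (V : nmodType) s m (F : s.+1.-tuple K -> V) :
  \sum_(k <- box_seq s.+1 e m) F k =
  \sum_(k <- box_seq s e m) \sum_(i < m) F [tuple of rcons k (e i)].
Proof.
under [in RHS]eq_bigr do rewrite -(big_enum _ _ predT).
rewrite -(@big_allpairs_dep _ _ _ _ _ _ (fun (k : s.-tuple K) (i : 'I_m) => [tuple of rcons k (e i)]) _ (fun=> enum 'I_m)) /=.
apply: perm_big; apply: uniq_perm; first exact: box_seq_uniq.
  apply: allpairs_uniq_dep => [|k _|]; rewrite ?box_seq_uniq ?enum_uniq //.
  move=> [k i] [k' i'] _ _ /(congr1 val) /= /eqP; rewrite eqseq_rcons => /andP[/eqP kk /eqP/e_inj ii].
  have kk' : k = k' by exact/val_inj.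
  by rewrite -{}kk'; congr existT; apply/val_inj.
move=> k; apply/mem_box_seq/allpairsPdep => [h|[k' [i [/mem_box_seq k'b _ ->]]] j].
  have [i im ei] := h ord_max.
  exists [tuple tnth k (widen_ord (leqnSn s) j) | j < s], (Ordinal im); split.
  - by apply/mem_box_seq => j; have [i' im' ei'] := h (widen_ord (leqnSn s) j);
       exists i' => //; rewrite tnth_mktuple.
  - by rewrite mem_enum.
  apply: eq_from_tnth => j; case: (unliftP ord_max j) => [j' ->|->].
    rewrite (_ : lift ord_max j' = widen_ord (leqnSn s) j').
      by rewrite tnth_rcons_widen tnth_mktuple.
    by apply/val_inj; rewrite /= /bump leqNgt ltn_ord.
  by rewrite tnth_rcons_max.
case: (unliftP ord_max j) => [j' ->|->]; last by exists i => //; rewrite tnth_rcons_max.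
have [i' im' ei'] := k'b j'; exists i' => //.
rewrite (_ : lift ord_max j' = widen_ord (leqnSn s) j') ?tnth_rcons_widen //.
by apply/val_inj; rewrite /= /bump leqNgt ltn_ord.
Qed.

End BoxSumRecr.

(** Each multiple of [n] is charged to the block of [n] indices that ends at it, over which [f] is
    at least its value at the multiple. *)
Lemma multiples_sum_le (R : realDomainType) (f : nat -> R) n N : (0 < n)%N ->
  (forall k, 0 <= f k) -> (forall k, (0 < k)%N -> f k.+1 <= f k) ->
  n%:R * (\sum_(1 <= k < N.+1 | (n %| k)%N) f k) <= \sum_(1 <= k < N.+1) f k.
Proof.
move=> n0 f0 fd.
(* The additional term accounts for the incomplete last block and makes the induction on [N] go
   through. *)
suff : n%:R * (\sum_(1 <= k < N.+1 | (n %| k)%N) f k) + (N %% n)%:R * f N <=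
    \sum_(1 <= k < N.+1) f k.
  by apply: le_trans; rewrite lerDl mulr_ge0.
elim: N => [|N IH]; first by rewrite !big_nil mod0n mulr0 mul0r addr0.
have step : (N %% n)%:R * f N.+1 <= (N %% n)%:R * f N.
  case: N {IH} => [|N]; first by rewrite mod0n !mul0r.
  by rewrite ler_wpM2l // fd.
have -> : \sum_(1 <= k < N.+2 | (n %| k)%N) f k =
    \sum_(1 <= k < N.+1 | (n %| k)%N) f k + if (n %| N.+1)%N then f N.+1 else 0.
  by rewrite big_mkcond big_nat_recr //= -big_mkcond.
rewrite [leRHS]big_nat_recr //=.
rewrite (modnS N n); case: ifP => dn.
  have nE : n%:R = (N %% n)%:R + 1 :> R.
    have := modnS N n; rewrite dn => h.
    have lt := ltn_pmod N n0.
    have : (N %% n).+1 = n.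
      apply/eqP; rewrite eqn_leq lt /= leqNgt; apply/negP => lt'.
      have := modn_small lt'; rewrite -addn1 modnDml addn1 h => /esym/eqP.
      by rewrite addn1.
    by move=> h'; rewrite natr1 h'.
  rewrite mul0r addr0 mulrDr {2}nE mulrDl mul1r addrA lerD2r.
  by apply: le_trans IH; rewrite lerD2l.
rewrite addr0 -natr1 mulrDl mul1r addrA lerD2r.
by apply: le_trans IH; rewrite lerD2l.
Qed.

(** If [n] divides [m] the condition does not depend on [c]. Otherwise [m] is invertible modulo [n]
    and there is one solution, which is 0 when [n] divides [D]; thus the nonzero candidates contain
    none in that case and at most one in the other. *)
Lemma count_solutions_le n (D m : int) : prime n ->
  (\sum_(c < n | (0 < c)%N) (n%:Z %| (D + m * c%:Z)%R)%Z <=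
   if (n%:Z %| m)%Z then (n%:Z %| D)%Z * n.-1 else ~~ (n%:Z %| D)%Z)%N.
Proof.
move=> pn; have n0 := prime_gt0 pn; have n1 := prime_gt1 pn.
have card : (\sum_(c < n | (0 < c)%N) 1 = n.-1)%N.
  case: n n0 {pn n1} => // k _; rewrite big_mkcond big_ord_recl /= add0n.
  by rewrite sum_nat_const muln1 card_ord.
case: ifPn => [nm|nm].
  rewrite -card big_distrr /=; apply: leq_sum => c _; rewrite muln1.
  by rewrite rpredDr ?dvdz_mulr //; case: (_ %| _)%Z.
have cop : coprimez n%:Z m.
  by rewrite coprimezE prime_coprime //; move: nm; rewrite dvdzE.
have [c0|c0] := pickP [pred c : 'I_n | (0 < c)%N && (n%:Z %| D + m * c%:Z)%Z]; last first.
  rewrite big1 // => c c0'; have /= := c0 c; rewrite c0' /=; by case: (_ %| _)%Z.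
move=> /andP[c00 dc0].
have nD : ~~ (n%:Z %| D)%Z.
  apply/negP => nD; move: dc0; rewrite rpredDl // Gauss_dvdzr // dvdzE /=.
  by move=> /(dvdn_leq c00); rewrite leqNgt ltn_ord.
rewrite nD (bigD1 c0) //= dc0 big1 //= => c /andP[c0' cc0].
apply/eqP; rewrite eqb0; apply: contra cc0 => dc.
have : (n%:Z %| m * (c%:Z - c0%:Z))%Z.
  rewrite (_ : m * _ = (D + m * c%:Z) - (D + m * c0%:Z)); last by ring.
  by rewrite rpredB.
rewrite Gauss_dvdzr // => h; apply/eqP/val_inj => /=.
have : (c = c0 %[mod n])%N by apply/eqP; move: h; rewrite -eqz_mod_dvd !modz_nat eqz_nat.
by rewrite !modn_small.
Qed.

Lemma sum_ord_pos (R : pzRingType) n (x : R) : (0 < n)%N ->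
  \sum_(c < n | (0 < c)%N) x = (n%:R - 1) * x.
Proof.
case: n => // n _; rewrite big_mkcond big_ord_recl /= add0r sumr_const card_ord.
by rewrite -natr1 addrK mulr_natl.
Qed.

(** * Averaging the increments over the candidates *)

Section CbcBound.
Variables (R : realType) (n : nat) (a : R) (g : nat -> R) (l : R).
Hypothesis pn : prime n.
Hypothesis a2 : 2^-1 < a.
Hypothesis g0 : forall j, 0 < g j.
Hypothesis l0 : 0 < l.
Hypothesis l1 : l <= 1.
Hypothesis al : 1 < 2 * a * l.

(** The vectors of all dimensions are prefixes of one sequence [y], which avoids casts between tuple
    lengths; [upd y s c] puts the candidate [c] in component [s]. *)
Definition prefix_tuple s (y : nat -> 'I_n) : s.-tuple 'I_n := [tuple y j | j < s].

Definition upd (y : nat -> 'I_n) s (c : 'I_n) (j : nat) : 'I_n := if j == s then c else y j.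

Let n0 : (0 < n)%N := prime_gt0 pn.
Let rho (s : nat) (m : int) : R := (rfac a (half_weights g s) m)^-1.

Lemma in_dual_rcons s (y : nat -> 'I_n) c (h : s.-tuple int) (m : int) :
  in_dual (prefix_tuple s.+1 (upd y s c)) [tuple of rcons h m] =
  (n%:Z %| lattice_dot h (prefix_tuple s y) + m * c%:Z)%Z.
Proof.
rewrite /in_dual /lattice_dot big_ord_recr /=; congr (_ %| _ + _)%Z.
  apply: eq_bigr => j _; rewrite tnth_rcons_widen !tnth_mktuple /upd /=.
  by rewrite ltn_eqF.
by rewrite tnth_rcons_max tnth_mktuple /upd /= eqxx.
Qed.

Lemma rweight_rcons s (g' : nat -> R) (h : s.-tuple int) (m : int) :
  rweight a g' [tuple of rcons h m] = rweight a g' h * rfac a (g' s) m.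
Proof.
rewrite /rweight big_ord_recr /= tnth_rcons_max; congr (_ * _).
by apply: eq_bigr => j _; rewrite tnth_rcons_widen.
Qed.

(* the part of the truncated dual sum in dimension s+1 that depends on c *)
Definition cbc_increment s (y : nat -> 'I_n) N (c : 'I_n) : R :=
  \sum_(h <- box_seq s zigzag N.*2.+1) \sum_(i < N.*2.+1 | zigzag i != 0)
    (n%:Z %| lattice_dot h (prefix_tuple s y) + zigzag i * c%:Z)%Z%:R *
    ((rweight a (half_weights g) h)^-1 * rho s (zigzag i)).

Lemma dual_sum_increment s y N c :
  dual_sum_trunc a g (prefix_tuple s.+1 (upd y s c)) N =
  dual_sum_trunc a g (prefix_tuple s y) N + cbc_increment s y N c.
Proof.
rewrite /dual_sum_trunc (box_sum_recr zigzag_inj) -big_split /=.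
apply: eq_bigr => h _.
rewrite (bigD1 ord0) //= in_dual_rcons rweight_rcons mul0r addr0.
rewrite {1}/rfac eqxx mulr1; congr (_ + _).
apply: eq_big => [i|i _].
  by rewrite -[X in _ = (_ != X)]/(zigzag 0) (inj_eq zigzag_inj).
by rewrite in_dual_rcons rweight_rcons invfM.
Qed.

Lemma powR_prod (I : Type) (r : seq I) (f : I -> R) (e : R) : (forall i, 0 <= f i) ->
  (\prod_(i <- r) f i) `^ e = \prod_(i <- r) f i `^ e.
Proof.
move=> f0; elim: r => [|i r IH]; first by rewrite !big_nil powR1.
by rewrite !big_cons powRM ?IH // prodr_ge0.
Qed.

Lemma zigzag_sum_neq0 (f : int -> R) N : (forall m, f (- m) = f m) ->
  \sum_(i < N.*2.+1 | zigzag i != 0) f (zigzag i) = \sum_(1 <= k < N.+1) 2 * f k%:Z.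
Proof.
move=> fN; rewrite big_mkcond.
rewrite (zigzag_sum (fun m => if m != 0 then f m else 0)) eqxx add0r.
apply: eq_big_nat => k /andP[k0 _].
by rewrite oppr_eq0 eqz_nat gtn_eqF //= fN; ring.
Qed.

(** The sum of 1 / r(m)^l over all nonzero integers m, for the weight [g j / 2]: the factor 2 for
    the sign of m and 2^(-l) from the halved weight give the power of 2. *)
Definition cbc_factor j : R := 2 `^ (1 - l) * zeta (2 * a * l) * g j `^ l.

Let half_gt0 j : 0 < half_weights g j. Proof. by rewrite divr_gt0. Qed.

Let rho_gt0 s m : 0 < rho s m. Proof. by rewrite invr_gt0 rfac_gt0. Qed.

Let rhoN s m : rho s (- m) = rho s m.
Proof. by rewrite /rho /rfac oppr_eq0 abszN. Qed.

Let rho_nat s k : (0 < k)%N ->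
  2 * rho s k%:Z `^ l = 2 `^ (1 - l) * g s `^ l * k%:R `^ (- (2 * a * l)).
Proof.
move=> k0; rewrite /rho /rfac eqz_nat gtn_eqF // absz_nat invf_div.
rewrite powRM ?invr_ge0 ?powR_ge0 ?ltW // /half_weights powRM ?(ltW (g0 _)) ?invr_ge0 //.
have -> : 2^-1 `^ l = 2 `^ (- l) :> R by rewrite -powR_inv1 // -powRrM mulN1r.
rewrite -powRN -powRrM mulNr.
have -> : 2 `^ (1 - l) = 2 * 2 `^ (- l) :> R.
  by rewrite powRD ?powRr1 // pnatr_eq0 implybT.
by ring.
Qed.

Let Ssum s N := \sum_(i < N.*2.+1 | zigzag i != 0) rho s (zigzag i) `^ l.
Let Asum s N :=
  \sum_(i < N.*2.+1 | zigzag i != 0) (n%:Z %| zigzag i)%Z%:R * rho s (zigzag i) `^ l.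

Lemma Ssum_le s N : Ssum s N <= cbc_factor s.
Proof.
rewrite /Ssum (zigzag_sum_neq0 (f := fun m => rho s m `^ l)); last by move=> m; rewrite rhoN.
rewrite (eq_big_nat _ _ (F2 := fun k => 2 `^ (1 - l) * g s `^ l * k%:R `^ (- (2 * a * l)))).
  rewrite -mulr_sumr /cbc_factor mulrAC ler_wpM2r ?powR_ge0 // ler_wpM2l ?powR_ge0 //.
  exact: psum_le_zeta.
by move=> k /andP[k0 _]; exact: rho_nat.
Qed.

(** [rho s] decreases with the absolute value of the frequency, so the nonzero multiples of [n]
    carry at most the fraction 1/n of the whole sum. *)
Lemma Asum_le s N : n%:R * Asum s N <= Ssum s N.
Proof.
rewrite /Asum /Ssum.
rewrite (zigzag_sum_neq0 (f := fun m => (n%:Z %| m)%Z%:R * rho s m `^ l)); last first.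
  by move=> m; rewrite rhoN rpredN.
rewrite (zigzag_sum_neq0 (f := fun m => rho s m `^ l)); last by move=> m; rewrite rhoN.
pose f k : R := 2 * rho s k%:Z `^ l.
rewrite (eq_bigr (fun k => if (n %| k)%N then f k else 0)) => [|k _].
  rewrite -big_mkcond; apply: multiples_sum_le => // [k|k k0].
    by rewrite mulr_ge0 ?powR_ge0.
  rewrite /f !rho_nat // ler_wpM2l ?mulr_ge0 ?powR_ge0 //.
  rewrite !powRN lef_pV2 ?posrE ?powR_gt0 ?ltr0n //.
  by rewrite ge0_ler_powR ?nnegrE ?ler0n ?ler_nat // (le_trans _ (ltW al)).
rewrite dvdzE /= /f; case: ifP => _; first by rewrite mul1r.
by rewrite mul0r mulr0.
Qed.

Let rw s (h : s.-tuple int) : R := (rweight a (half_weights g) h)^-1 `^ l.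
Let Fsum s N := \sum_(h <- box_seq s zigzag N.*2.+1) rw h.
Let Dsum s y N := \sum_(h <- box_seq s zigzag N.*2.+1)
  (n%:Z %| lattice_dot h (prefix_tuple s y))%Z%:R * rw h.

Let rw_ge0 s (h : s.-tuple int) : 0 <= rw h.
Proof. exact: powR_ge0. Qed.

Let rweight_half_gt0 s (h : s.-tuple int) : 0 < rweight a (half_weights g) h.
Proof. exact: rweight_gt0. Qed.

Let rr_ge0 s (h : s.-tuple int) m : 0 <= (rweight a (half_weights g) h)^-1 * rho s m.
Proof. by rewrite mulr_ge0 ?(ltW (rho_gt0 _ _)) // invr_ge0 ltW. Qed.

Lemma Fsum_le s N : Fsum s N <= \prod_(j < s) (1 + cbc_factor j).
Proof.
rewrite /Fsum (eq_bigr (fun h : s.-tuple int => \prod_(j < s) (fun (j : 'I_s) m => rho j m `^ l) j (tnth h j))).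
  rewrite (@box_sum_prod s _ zigzag _ _ (fun (j : 'I_s) m => rho j m `^ l)).
  apply: ler_prod => j _; apply/andP; split.
    by apply: sumr_ge0 => i _; exact: powR_ge0.
  rewrite (bigD1 ord0) //= {1}/rho /rfac eqxx invr1 powR1 lerD2l.
  apply: le_trans (Ssum_le j N); rewrite le_eqVlt; apply/orP; left; apply/eqP.
  apply: eq_bigl => i.
  by rewrite -[X in _ = (_ != X)]/(zigzag 0) (inj_eq zigzag_inj).
move=> h _; rewrite /rw /rweight -prodfV powR_prod // => j.
exact: (ltW (rho_gt0 j _)).
Qed.

(** Write S and A for the sums over the last coordinate (all nonzero ones, multiples of n), F and D
    for those over the first s coordinates (all, dual ones). Subadditivity and the count of
    candidates bound the left side by (n-1) A D + (S-A) (F-D), which falls short of S F by D (S - n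
    A) + A F, a nonnegative quantity. *)
Lemma cbc_increment_average s y N :
  \sum_(c < n | (0 < c)%N) cbc_increment s y N c `^ l <=
  cbc_factor s * \prod_(j < s) (1 + cbc_factor j).
Proof.
have S0 : 0 <= Ssum s N by apply: sumr_ge0 => i _; exact: powR_ge0.
have A0 : 0 <= Asum s N by apply: sumr_ge0 => i _; rewrite mulr_ge0 ?powR_ge0.
have B0 : 0 <= cbc_factor s by apply: le_trans (Ssum_le s N).
have D0 : 0 <= Dsum s y N by apply: sumr_ge0 => i _; rewrite mulr_ge0.
have F0 : 0 <= Fsum s N by exact: sumr_ge0.
pose D (h : s.-tuple int) := lattice_dot h (prefix_tuple s y).
apply: (@le_trans _ _ (\sum_(h <- box_seq s zigzag N.*2.+1)
    \sum_(i < N.*2.+1 | zigzag i != 0)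
    (\sum_(c < n | (0 < c)%N) (n%:Z %| (D h + zigzag i * c%:Z)%R)%Z)%N%:R *
      (rw h * rho s (zigzag i) `^ l))).
  have E : forall c : 'I_n, cbc_increment s y N c `^ l <=
    \sum_(h <- box_seq s zigzag N.*2.+1) \sum_(i < N.*2.+1 | zigzag i != 0)
      (n%:Z %| (D h + zigzag i * c%:Z)%R)%Z%:R * (rw h * rho s (zigzag i) `^ l).
    move=> c; have l01 : 0 < l <= 1 by rewrite l0.
    apply: le_trans (powR_subadditive _ l01 _) _ => [h|].
      apply: sumr_ge0 => i _; by rewrite mulr_ge0.
    apply: ler_sum => h _.
    rewrite big_mkcond [leRHS]big_mkcond /=.
    apply: le_trans (powR_subadditive _ l01 _) _ => [i|].
      case: ifP => // _; by rewrite mulr_ge0.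
    apply: ler_sum => i _; case: ifP => _; last by rewrite powR0 ?gt_eqF.
    rewrite /D; case: (n%:Z %| _)%Z; last by rewrite !mul0r powR0 ?gt_eqF.
    by rewrite !mul1r powRM ?(ltW (rho_gt0 _ _)) // invr_ge0 ltW.
  apply: le_trans (ler_sum _ (fun c _ => E c)) _.
  rewrite exchange_big /= le_eqVlt; apply/orP; left; apply/eqP.
  apply: eq_bigr => h _; rewrite exchange_big /=; apply: eq_bigr => i _.
  by rewrite -mulr_suml natr_sum.
(* The cases of [count_solutions_le] are written as a polynomial in 0/1 indicators, so that the
   double sum factors. *)
apply: (@le_trans _ _ (\sum_(h <- box_seq s zigzag N.*2.+1)
    \sum_(i < N.*2.+1 | zigzag i != 0)
      ((n%:Z %| zigzag i)%Z%:R * ((n%:Z %| D h)%Z%:R * (n%:R - 1)) +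
       (1 - (n%:Z %| zigzag i)%Z%:R) * (1 - (n%:Z %| D h)%Z%:R)) *
      (rw h * rho s (zigzag i) `^ l))).
  apply: ler_sum => h _; apply: ler_sum => i _.
  apply: ler_wpM2r; first by rewrite mulr_ge0 ?powR_ge0.
  apply: (@le_trans _ _ (if (n%:Z %| zigzag i)%Z then (n%:Z %| D h)%Z * n.-1 else ~~ (n%:Z %| D h)%Z)%N%:R).
    by rewrite ler_nat count_solutions_le.
  case: ifP => _; last by rewrite mul0r subr0 add0r mul1r; case: (n%:Z %| _)%Z => /=; rewrite ?subr0 ?subrr.
  by rewrite subrr mul0r addr0 mul1r natrM -subn1 natrB.
have -> : \sum_(h <- box_seq s zigzag N.*2.+1)
    \sum_(i < N.*2.+1 | zigzag i != 0)
      ((n%:Z %| zigzag i)%Z%:R * ((n%:Z %| D h)%Z%:R * (n%:R - 1)) +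
       (1 - (n%:Z %| zigzag i)%Z%:R) * (1 - (n%:Z %| D h)%Z%:R)) *
      (rw h * rho s (zigzag i) `^ l) =
   (n%:R - 1) * Asum s N * Dsum s y N + (Ssum s N - Asum s N) * (Fsum s N - Dsum s y N).
  transitivity (\sum_(h <- box_seq s zigzag N.*2.+1)
     ((n%:R - 1) * Asum s N * ((n%:Z %| D h)%Z%:R * rw h) +
      (Ssum s N - Asum s N) * (rw h - (n%:Z %| D h)%Z%:R * rw h))).
    apply: eq_bigr => h _.
    rewrite /Ssum /Asum -sumrB mulr_sumr !mulr_suml -big_split /=.
    by apply: eq_bigr => i _; ring.
  by rewrite big_split /= -!mulr_sumr sumrB.
have hA := Asum_le s N.
apply: (@le_trans _ _ (Ssum s N * Fsum s N)).
  have : 0 <= Dsum s y N * (Ssum s N - n%:R * Asum s N) + Asum s N * Fsum s N.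
    by rewrite addr_ge0 ?mulr_ge0 ?subr_ge0.
  move=> H; rewrite -subr_ge0.
  rewrite (_ : _ - _ = Dsum s y N * (Ssum s N - n%:R * Asum s N) + Asum s N * Fsum s N) //.
  by ring.
by rewrite ler_pM // ?Ssum_le ?Fsum_le.
Qed.


Definition cbc_mean s (y : nat -> 'I_n) : R := kernel_mean a g (prefix_tuple s y).

Lemma cbc_increment_cvg s y c :
  cbc_increment s y N c @[N --> \oo] --> cbc_mean s.+1 (upd y s c) - cbc_mean s y.
Proof.
rewrite (_ : (fun N => cbc_increment s y N c) = fun N =>
    kernel_mean_trunc a g (prefix_tuple s.+1 (upd y s c)) N -
    kernel_mean_trunc a g (prefix_tuple s y) N).
  by apply: cvgB; exact: kernel_mean_cvg.
by apply/funext => N; rewrite -!dual_sum_truncE // dual_sum_increment addrC addKr.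
Qed.

Lemma cbc_increment_ge0 s y N c : 0 <= cbc_increment s y N c.
Proof.
apply: sumr_ge0 => h _; apply: sumr_ge0 => i _.
by rewrite mulr_ge0.
Qed.

Lemma cbc_factor_ge0 s : 0 <= cbc_factor s.
Proof. by rewrite !mulr_ge0 ?powR_ge0 // zeta_ge0. Qed.

Lemma cbc_factor_prod_ge1 s : 1 <= \prod_(j < s) (1 + cbc_factor j).
Proof.
elim/big_ind: _ => // [x y x1 y1|j _]; first exact: mulr_ege1.
by rewrite lerDl cbc_factor_ge0.
Qed.

Lemma upd_id s (y : nat -> 'I_n) : upd y s (y s) = y.
Proof. by apply/funext => j; rewrite /upd; case: eqP => [->|]. Qed.

Lemma cbc_mean_homo s (y : nat -> 'I_n) : 0 <= cbc_mean s.+1 y - cbc_mean s y.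
Proof.
rewrite -{1}(upd_id s y) -(cvg_lim (@Rhausdorff R) (@cbc_increment_cvg s y (y s))).
apply: limr_ge; first by apply/cvg_ex; eexists; exact: cbc_increment_cvg.
by apply: nearW => N; exact: cbc_increment_ge0.
Qed.

(** The chosen increment is at most that of each of the [n - 1] candidates, so its [l]-th power is
    at most their average. Since the average is controlled at each truncation and the comparison
    holds between limits, a number [t] strictly below the increment mediates. *)
Lemma cbc_step s (y : nat -> 'I_n) :
  (forall c : 'I_n, (0 < c)%N -> cbc_mean s.+1 y <= cbc_mean s.+1 (upd y s c)) ->
  (cbc_mean s.+1 y - cbc_mean s y) `^ l <=
  cbc_factor s * \prod_(j < s) (1 + cbc_factor j) / (n%:R - 1).
Proof.
move=> hmin; set th := _ - _; set X := _ * _ / _.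
have n1 : 0 < n%:R - 1 :> R by rewrite subr_gt0 ltr1n prime_gt1.
have X0 : 0 <= X.
  rewrite divr_ge0 ?(ltW n1) // mulr_ge0 ?cbc_factor_ge0 //.
  exact: le_trans (cbc_factor_prod_ge1 s).
have th0 : 0 <= th by exact: cbc_mean_homo.
(* If [X] were smaller than the [l]-th power of [th], the midpoint of [th] and the [l]-th root of
   [X] would be a [t] violating this claim. *)
suff h t : 0 <= t -> t < th -> t `^ l <= X.
  rewrite leNgt; apply/negP => lt.
  have t0 : 0 <= X `^ l^-1 by exact: powR_ge0.
  have tth : X `^ l^-1 < th.
    rewrite ltNge; apply/negP => le.
    have := @ge0_ler_powR _ l (ltW l0) th (X `^ l^-1).
    rewrite !nnegrE => /(_ th0 t0 le); rewrite -powRrM mulVf ?gt_eqF // powRr1 //.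
    by rewrite leNgt lt.
  have := h ((X `^ l^-1 + th) / 2).
  have t1 : X `^ l^-1 < (X `^ l^-1 + th) / 2 by lra.
  have t2 : (X `^ l^-1 + th) / 2 < th by lra.
  move=> /(_ (le_trans t0 (ltW t1)) t2); apply/negP; rewrite -ltNge.
  have := @gt0_ltr_powR _ l l0 (X `^ l^-1) ((X `^ l^-1 + th) / 2).
  rewrite !nnegrE => /(_ t0 (le_trans t0 (ltW t1)) t1).
  by rewrite -powRrM mulVf ?gt_eqF // powRr1.
move=> t0 tth; rewrite /X ler_pdivlMr // mulrC.
(* The candidates are finite in number, so one truncation serves all of them. *)
have ev : \forall N \near \oo, forall c : 'I_n, (0 < c)%N -> t < cbc_increment s y N c.
  apply: filter_forall => c; case: (posnP c) => [c0|c0].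
    by apply: nearW => N.
  have tc : t < cbc_mean s.+1 (upd y s c) - cbc_mean s y.
    by rewrite (lt_le_trans tth) // lerD2r hmin.
  have [M _ hM] : \forall N \near \oo, t < cbc_increment s y N c.
    exact: (cvgr_gt _ (@cbc_increment_cvg s y c)).
  by exists M => // N MN _; exact: hM.
case: ev => N _ /(_ N (leqnn N)) hN.
apply: le_trans (cbc_increment_average s y N).
rewrite -sum_ord_pos //; apply: ler_sum => c c0.
by rewrite ge0_ler_powR ?nnegrE ?(ltW l0) ?cbc_increment_ge0 // ltW // hN.
Qed.

(** The power [l] is subadditive on the squared error in dimension d plus the increment, and the
    right side telescopes: multiplying the product by its next factor adds exactly the bound of
    [cbc_step]. *)
Theorem cbc_bound d (y : nat -> 'I_n) :
  (forall s, (s < d)%N -> forall c : 'I_n, (0 < c)%N ->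
    cbc_mean s.+1 y <= cbc_mean s.+1 (upd y s c)) ->
  (cbc_mean d y - 1) `^ l <= (\prod_(j < d) (1 + cbc_factor j) - 1) / (n%:R - 1).
Proof.
have n1 : 0 < n%:R - 1 :> R by rewrite subr_gt0 ltr1n prime_gt1.
elim: d => [|d IH] hmin.
  rewrite big_ord0 subrr mul0r /cbc_mean /kernel_mean.
  rewrite (eq_bigr (fun=> 1)) => [|i _]; last by rewrite big_ord0.
  by rewrite sumr_const_nat subSS subn0 mulVf ?subrr ?powR0 ?gt_eqF ?ltr0n.
have {}IH := IH (fun s sd => hmin s (ltnW sd)).
have st := cbc_step (hmin d (ltnSn d)).
have e0 : 0 <= cbc_mean d y - 1 by exact: kernel_mean_ge1.
have th0 : 0 <= cbc_mean d.+1 y - cbc_mean d y.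
  exact: cbc_mean_homo.
have := @powR_subadditive R bool [:: true; false]
  (fun b => if b then cbc_mean d y - 1 else cbc_mean d.+1 y - cbc_mean d y) l.
rewrite !big_cons !big_nil !addr0 l0 l1 => /(_ isT).
have -> : cbc_mean d y - 1 + (cbc_mean d.+1 y - cbc_mean d y) = cbc_mean d.+1 y - 1.
  by ring.
move=> h; apply: le_trans (h _) _; first by case.
apply: le_trans (lerD IH st) _.
by rewrite -mulrDl ler_wpM2r ?invr_ge0 ?(ltW n1) // big_ord_recr /= le_eqVlt;
  apply/orP; left; apply/eqP; ring.
Qed.

End CbcBound.

(** * Straight-line programs and fast convolution *)

Section StraightLine.
Variables (R : realType) (In A : Type).
Implicit Types (f g : In -> R) (mem : seq (In -> R)) (F G H : set (In -> R)).

Definition memory mem (x : In) : seq R := [seq f x | f <- mem].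

Definition stored F mem := forall f, F f ->
  exists2 i, (i < size mem)%N & nth (fun=> 0) mem i = f.

(** A program carries its continuation, so a fragment of code is encoded as a map on
    continuations. *)
Definition reaches c mem mem' := exists T : program R A -> program R A,
  (forall p, cost (T p) = (c + cost p)%N) /\
  (forall p x, run (T p) (memory mem x) = run p (memory mem' x)).

(* Registers hold functions of the input; from any registers containing F, c more
   instructions suffice to have G as well. *)
Definition derives c F G := forall mem, stored F mem ->
  exists ext, reaches c mem (mem ++ ext) /\ stored G (mem ++ ext).

(* D collects what the branches taken so far have revealed about the input. *)
Definition solves (D : set In) c F (Phi : In -> A -> Prop) :=
  forall mem, stored F mem -> exists p : program R A, (cost p <= c)%N /\
    forall x, D x -> Phi x (run p (memory mem x)).

Lemma nth_memory mem x i : (i < size mem)%N ->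
  nth 0 (memory mem x) i = nth (fun=> 0) mem i x.
Proof. by move=> h; rewrite (nth_map (fun=> 0)). Qed.

Lemma stored_cat F mem ext : stored F mem -> stored F (mem ++ ext).
Proof.
move=> h f /h [i im <-]; exists i; first by rewrite size_cat ltn_addr.
by rewrite nth_cat im.
Qed.

Lemma storedU F G mem : stored F mem -> stored G mem -> stored (F `|` G) mem.
Proof. by move=> hF hG f [/hF|/hG]. Qed.

Lemma storedS F G mem : F `<=` G -> stored G mem -> stored F mem.
Proof. by move=> FG h f /FG/h. Qed.

Lemma derivesS F G F' G' c : F `<=` F' -> G' `<=` G -> derives c F G -> derives c F' G'.
Proof.
move=> FF GG h mem /(storedS FF)/h [ext [re sG]].
by exists ext; split => //; exact: storedS sG.
Qed.

Lemma derives_sub F G : G `<=` F -> derives 0 F G.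
Proof.
move=> GF mem h; exists [::]; rewrite cats0; split; last exact: storedS h.
by exists id.
Qed.

Lemma derives_trans c c' F G H : derives c F G -> derives c' (F `|` G) H ->
  derives (c + c') F (G `|` H).
Proof.
move=> h h' mem sF; have [e1 [[T1 [cT1 rT1]] s1]] := h _ sF.
have [e2 [[T2 [cT2 rT2]] s2]] := h' _ (storedU (stored_cat e1 sF) s1).
exists (e1 ++ e2); rewrite catA; split; last by apply: storedU => //; exact: stored_cat.
exists (T1 \o T2); split => [p|p x] /=; first by rewrite cT1 cT2 addnA.
by rewrite rT1 rT2.
Qed.

Lemma derivesU c c' F G H : derives c F G -> derives c' F H ->
  derives (c + c') F (G `|` H).
Proof.
by move=> h h'; apply: derives_trans h _; apply: derivesS h' => // f; left.
Qed.

Lemma derives_chain c c' F G H : derives c F G -> derives c' (F `|` G) H ->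
  derives (c + c') F H.
Proof. by move=> h h'; apply: derivesS (derives_trans h h') => // f; right. Qed.

Lemma derives_const F (k : R) : derives 1 F [set (fun=> k)].
Proof.
move=> mem sF; exists [:: fun=> k]; split.
  exists (fun p => Const k p); split => [p|p x] //=.
  by rewrite /memory map_cat /= cats1.
move=> _ ->; exists (size mem); first by rewrite size_cat addn1.
by rewrite nth_cat ltnn subnn.
Qed.

Lemma derives_arith F (o : arith) f g : F f -> F g ->
  derives 1 F [set (fun x => arith_eval o (f x) (g x))].
Proof.
move=> Ff Fg mem sF; have [i im fi] := sF _ Ff; have [j jm gj] := sF _ Fg.
exists [:: fun x => arith_eval o (f x) (g x)]; split.
  exists (fun p => Arith o i j p); split => [p|p x] //=.
  by rewrite !nth_memory // fi gj /memory map_cat /= cats1.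
move=> _ ->; exists (size mem); first by rewrite size_cat addn1.
by rewrite nth_cat ltnn subnn.
Qed.

Lemma derives_seq c F (h : nat) (u : nat -> set (In -> R)) :
  (forall i, (i < h)%N -> derives c F (u i)) ->
  derives (h * c) F (\bigcup_(i in [set i | (i < h)%N]) u i).
Proof.
elim: h => [|h IH] H.
  by apply: derives_sub => f [k].
rewrite mulSn addnC.
apply: derivesS (derivesU (IH (fun i ih => H i (ltnW ih))) (H h (ltnSn h))) => //.
move=> f [i /=]; rewrite ltnS leq_eqVlt => /orP[/eqP ->|ih] ui; first by right.
by left; exists i.
Qed.

Lemma solves_derives D c c' F G Phi : derives c F G -> solves D c' (F `|` G) Phi ->
  solves D (c + c') F Phi.
Proof.
move=> h h' mem sF; have [ext [[T [cT rT]] sG]] := h _ sF.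
have [p [cp rp]] := h' _ (storedU (stored_cat ext sF) sG).
exists (T p); split; first by rewrite cT leq_add2l.
by move=> x Dx; rewrite rT; exact: rp.
Qed.

Lemma solvesS D D' c c' F F' Phi : D `<=` D' -> (c' <= c)%N -> F' `<=` F ->
  solves D' c' F' Phi -> solves D c F Phi.
Proof.
move=> DD cc FF h mem sF; have [p [cp rp]] := h _ (storedS FF sF).
by exists p; split; [exact: leq_trans cc|move=> x /DD; exact: rp].
Qed.

Lemma solves_return D F (Phi : In -> A -> Prop) z :
  (forall x, D x -> Phi x z) -> solves D 0 F Phi.
Proof. by move=> h mem _; exists (Return R z); split. Qed.

Lemma solves_branch D c F Phi f g : F f -> F g ->
  solves (D `&` [set x | f x <= g x]) c F Phi ->
  solves (D `&` [set x | ~~ (f x <= g x)]) c F Phi -> solves D c.+1 F Phi.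
Proof.
move=> Ff Fg h1 h2 mem sF; have [i im fi] := sF _ Ff; have [j jm gj] := sF _ Fg.
have [p [cp rp]] := h1 _ sF; have [q [cq rq]] := h2 _ sF.
exists (Branch i j p q); split; first by rewrite /= ltnS geq_max cp cq.
move=> x Dx /=; rewrite !nth_memory // fi gj.
by case: ifPn => fg; [apply: rp|apply: rq].
Qed.

(** A linear scan in which [b] is the best candidate among those seen. Every leaf has its own
    continuation, specialised to the winner there; this duplication is free because the cost of a
    branching is a maximum. *)
Lemma solves_argmin (C : eqType) D c F Phi (O : C -> In -> R) (b : C) (cs seen : seq C) :
  F (O b) -> (forall e, e \in cs -> F (O e)) ->
  (forall b', b' \in b :: cs ->
    solves (D `&` [set x | forall e, e \in seen ++ b :: cs -> O b' x <= O e x]) c F Phi) ->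
  solves (D `&` [set x | forall e, e \in seen -> O b x <= O e x]) (size cs + c) F Phi.
Proof.
elim: cs b seen => [|e cs IH] b seen Fb Fcs H.
  apply: solvesS (H b _) => //; last by rewrite inE.
  move=> x [Dx hx]; split => // e; rewrite mem_cat inE => /orP[/hx //|/eqP ->].
  exact: lexx.
have Fe : F (O e) by apply: Fcs; rewrite inE eqxx.
rewrite addSn; apply: (solves_branch Fb Fe).
  apply: solvesS (IH b (rcons seen e) Fb _ _) => //.
  - move=> x [[Dx hx] be]; split => // e'.
    by rewrite mem_rcons inE => /predU1P[->|/hx].
  - by move=> e' e's; apply: Fcs; rewrite inE e's orbT.
  move=> b' b'm; apply: solvesS (H b' _) => //.
  - move=> x [Dx hx]; split => // e' e'm; apply: hx; move: e'm.
    by rewrite !mem_cat mem_rcons !inE; case/or4P => ->; rewrite ?orbT.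
  - by move: b'm; rewrite !inE => /orP[->|->]; rewrite ?orbT.
apply: solvesS (IH e (rcons seen b) Fe _ _) => //.
- move=> x [[Dx hx]]; rewrite /= -ltNge => eb; split => // e'.
  rewrite mem_rcons inE => /predU1P[->|/hx]; first exact: ltW.
  exact: le_trans (ltW eb).
- by move=> e' e's; apply: Fcs; rewrite inE e's orbT.
move=> b' b'm; apply: solvesS (H b' _) => //.
- move=> x [Dx hx]; split => // e' e'm; apply: hx; move: e'm.
  by rewrite !mem_cat mem_rcons !inE; case/or4P => ->; rewrite ?orbT.
- by move: b'm; rewrite !inE => /orP[->|->]; rewrite ?orbT.
Qed.

End StraightLine.

(** * Complex arithmetic on pairs of real registers *)

Section ComplexStraightLine.
Variables (R : realType) (In A : Type).
Implicit Types (u v : In -> R[i]) (F : set (In -> R)).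
Local Notation derives := (@derives R In A).

Definition cpair u : set (In -> R) :=
  [set (fun x => complex.Re (u x)); (fun x => complex.Im (u x))].

Definition cfamily h (a : nat -> In -> R[i]) : set (In -> R) :=
  \bigcup_(i in [set i | (i < h)%N]) cpair (a i).

Lemma derives_cadd F u v : cpair u `<=` F -> cpair v `<=` F ->
  derives 2 F (cpair (fun x => u x + v x)).
Proof.
move=> uF vF; rewrite -[2%N]/(1 + 1)%N /cpair.
have -> : (fun x => complex.Re (u x + v x)) =
    (fun x => arith_eval Add (complex.Re (u x)) (complex.Re (v x))).
  by apply/funext => x /=; case: (u x) (v x) => [? ?] [].
have -> : (fun x => complex.Im (u x + v x)) =
    (fun x => arith_eval Add (complex.Im (u x)) (complex.Im (v x))).
  by apply/funext => x /=; case: (u x) (v x) => [? ?] [].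
have u1 : F (fun x => complex.Re (u x)) by apply: uF; left.
have u2 : F (fun x => complex.Im (u x)) by apply: uF; right.
have v1 : F (fun x => complex.Re (v x)) by apply: vF; left.
have v2 : F (fun x => complex.Im (v x)) by apply: vF; right.
by apply: derivesU; apply: derives_arith.
Qed.

Lemma derives_csub F u v : cpair u `<=` F -> cpair v `<=` F ->
  derives 2 F (cpair (fun x => u x - v x)).
Proof.
move=> uF vF; rewrite -[2%N]/(1 + 1)%N /cpair.
have -> : (fun x => complex.Re (u x - v x)) =
    (fun x => arith_eval Defs.Sub (complex.Re (u x)) (complex.Re (v x))).
  by apply/funext => x /=; case: (u x) (v x) => [? ?] [].
have -> : (fun x => complex.Im (u x - v x)) =
    (fun x => arith_eval Defs.Sub (complex.Im (u x)) (complex.Im (v x))).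
  by apply/funext => x /=; case: (u x) (v x) => [? ?] [].
have u1 : F (fun x => complex.Re (u x)) by apply: uF; left.
have u2 : F (fun x => complex.Im (u x)) by apply: uF; right.
have v1 : F (fun x => complex.Re (v x)) by apply: vF; left.
have v2 : F (fun x => complex.Im (v x)) by apply: vF; right.
by apply: derivesU; apply: derives_arith.
Qed.

Lemma derives_cmul F u v : cpair u `<=` F -> cpair v `<=` F ->
  derives 6 F (cpair (fun x => u x * v x)).
Proof.
move=> uF vF.
pose ru x := complex.Re (u x); pose iu x := complex.Im (u x).
pose rv x := complex.Re (v x); pose iv x := complex.Im (v x).
have Fru : F ru by apply: uF; left.
have Fiu : F iu by apply: uF; right.
have Frv : F rv by apply: vF; left.
have Fiv : F iv by apply: vF; right.
have dm f g : F f -> F g -> derives 1 F [set (fun x => f x * g x)].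
  by move=> Ff Fg; exact: (derives_arith A Mul Ff Fg).
rewrite -[6%N]/(1 + 1 + (1 + 1) + (1 + 1))%N.
apply: derives_chain.
  apply: derivesU; apply: derivesU.
  - exact: (dm ru rv).
  - exact: (dm iu iv).
  - exact: (dm ru iv).
  - exact: (dm iu rv).
rewrite /cpair.
have -> : (fun x => complex.Re (u x * v x)) =
    (fun x => arith_eval Defs.Sub (ru x * rv x) (iu x * iv x)).
  by apply/funext => x; rewrite /ru /rv /iu /iv /=; case: (u x) (v x) => [? ?] [].
have -> : (fun x => complex.Im (u x * v x)) =
    (fun x => arith_eval Add (ru x * iv x) (iu x * rv x)).
  by apply/funext => x; rewrite /ru /rv /iu /iv /=; case: (u x) (v x) => [? ?] [].
apply: derivesU.
  apply: (derives_arith A Defs.Sub (f := fun x => ru x * rv x) (g := fun x => iu x * iv x)).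
    by right; left; left.
  by right; left; right.
apply: (derives_arith A Add (f := fun x => ru x * iv x) (g := fun x => iu x * rv x)).
  by right; right; left.
by right; right; right.
Qed.

Lemma derives_cconst F (k : R[i]) : derives 2 F (cpair (fun=> k)).
Proof.
rewrite -[2%N]/(1 + 1)%N /cpair; apply: derivesU.
  exact: derives_const.
exact: derives_const.
Qed.

Lemma derives_cscale F (k : R[i]) u : cpair u `<=` F ->
  derives 8 F (cpair (fun x => k * u x)).
Proof.
move=> uF; rewrite -[8%N]/(2 + 6)%N; apply: (derives_chain (G := cpair (fun=> k))); first exact: derives_cconst.
apply: derives_cmul => [f kf|f uf]; first by right.
by left; apply: uF.
Qed.

End ComplexStraightLine.

(** * Polynomial multiplication by divide and conquer *)

Section FastConvolution.
Variables (R : realType) (In A : Type).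
Implicit Types (F : set (In -> R)) (a b r : nat -> In -> R[i]).
Local Notation derives := (@derives R In A).

Lemma derives_cfamily c F h a :
  (forall i, (i < h)%N -> derives c F (cpair (a i))) -> derives (h * c) F (cfamily h a).
Proof. exact: derives_seq. Qed.

Lemma cpair_cfamily h a i : (i < h)%N -> cpair (a i) `<=` cfamily h a.
Proof. by move=> ih f fi; exists i. Qed.

(* Cooley-Tukey: X^(2h) - c = (X^h - c') (X^h + c') when c'^2 = c *)
Lemma split_modulus (T : comNzRingType) (Y C D p0 p1 q0 q1 r1 r2 e1 e2 : T) :
  D * (C + C) = 1 ->
  (p0 + C * p1) * (q0 + C * q1) = r1 + (Y - C) * e1 ->
  (p0 - C * p1) * (q0 - C * q1) = r2 + (Y + C) * e2 ->
  exists e, (p0 + Y * p1) * (q0 + Y * q1) =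
    (D * C * (r1 + r2) + Y * (D * (r1 - r2))) + (Y * Y - C * C) * e.
Proof.
move=> DC h1 h2.
pose s := D * (r1 - r2).
pose f1 := p1 * (q0 + C * q1) + (p0 + Y * p1) * q1 + e1 - s.
pose f2 := p1 * (q0 - C * q1) + (p0 + Y * p1) * q1 + e2 - s.
have DCh : D * C + D * C = 1 by rewrite -mulrDr.
set X := (p0 + Y * p1) * (q0 + Y * q1) - (D * C * (r1 + r2) + Y * s).
have X1 : X = (Y - C) * f1.
  have -> : X = (p0 + C * p1) * (q0 + C * q1) + (Y - C) * (f1 - e1 + s) - (D * C * (r1 + r2) + Y * s).
    by rewrite /X /f1; ring.
  rewrite h1 -[RHS]addr0 -(mul0r r1) -(subrr 1) -{2}DCh /s; ring.
have X2 : X = (Y + C) * f2.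
  have -> : X = (p0 - C * p1) * (q0 - C * q1) + (Y + C) * (f2 - e2 + s) - (D * C * (r1 + r2) + Y * s).
    by rewrite /X /f2; ring.
  rewrite h2 -[RHS]addr0 -(mul0r r2) -(subrr 1) -{2}DCh /s; ring.
(* Bezout: D (Y + C) - D (Y - C) = 1, so [X], a multiple of both Y - C and Y + C, is a multiple of
   their product. *)
exists (D * (f1 - f2)).
have -> : (Y * Y - C * C) * (D * (f1 - f2)) =
  D * ((Y + C) * ((Y - C) * f1)) - D * ((Y - C) * ((Y + C) * f2)) by ring.
rewrite -X1 -X2 -[LHS](subrK (D * C * (r1 + r2) + Y * s)) -/X addrC; congr (_ + _).
by rewrite -[LHS]mul1r -DC; ring.
Qed.

(** A leaf is one complex product, of cost 6. Passing from m to m+1 doubles the cost and adds 12 +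
    12 + 20 instructions for each of 2^m indices, that is 22 for each of 2^(m+1). *)
Definition fft_cost m := ((6 + 22 * m) * 2 ^ m)%N.

Lemma poly_split (T : nzRingType) h (f : nat -> T) :
  \poly_(i < h + h) f i = \poly_(i < h) f i + 'X^h * \poly_(i < h) f (i + h)%N.
Proof.
apply/polyP => i; rewrite coefD coefXnM !coef_poly.
case: (ltnP i h) => ih; first by rewrite (leq_trans ih (leq_addl _ _)) addr0.
by rewrite add0r subnK // -ltn_subLR.
Qed.

Lemma poly_scale (T : nzRingType) h (k : T) (f : nat -> T) :
  k%:P * \poly_(i < h) f i = \poly_(i < h) (k * f i).
Proof.
apply/polyP => i; rewrite mul_polyC coefZ !coef_poly.
by case: ifP => _; rewrite ?mulr0.
Qed.

Lemma poly_add (T : nzRingType) h (f g : nat -> T) :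
  \poly_(i < h) f i + \poly_(i < h) g i = \poly_(i < h) (f i + g i).
Proof.
by apply/polyP => i; rewrite coefD !coef_poly; case: ifP; rewrite ?addr0.
Qed.

Lemma poly_sub (T : nzRingType) h (f g : nat -> T) :
  \poly_(i < h) f i - \poly_(i < h) g i = \poly_(i < h) (f i - g i).
Proof.
by apply/polyP => i; rewrite coefB !coef_poly; case: ifP; rewrite ?subr0.
Qed.

(** A general nonzero [c] closes the recursion: the two half-size moduli have constants [C] and
    [- C] with [C] a square root of [c], and recombination divides by [C + C]. *)
Lemma derives_mulmod m (c : R[i]) a b : c != 0 ->
  exists r, derives (fft_cost m) (cfamily (2 ^ m) a `|` cfamily (2 ^ m) b) (cfamily (2 ^ m) r) /\
    forall x, exists q : {poly R[i]},
      (\poly_(i < 2 ^ m) a i x) * (\poly_(i < 2 ^ m) b i x) =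
      \poly_(i < 2 ^ m) r i x + ('X^(2 ^ m) - c%:P) * q.
Proof.
elim: m c a b => [|m IH] c a b c0.
  exists (fun i x => a i x * b i x); split.
    rewrite /fft_cost muln0 addn0 mulnC expn0.
    apply: derives_cfamily => i ih; apply: derives_cmul => f fi.
      by left; exact: cpair_cfamily fi.
    by right; exact: cpair_cfamily fi.
  move=> x; exists 0; rewrite mulr0 addr0 expn0.
  by rewrite !poly_def !big_ord1 !expr0 !alg_polyC polyCM.
pose h := (2 ^ m)%N; have hh : (2 ^ m.+1 = h + h)%N by rewrite expnS mul2n -addnn.
pose C := sqrtc c; have CC : C * C = c by rewrite -expr2 sqr_sqrtc.
have C0 : C != 0 by apply: contra c0 => /eqP C0; rewrite -CC C0 mul0r.
pose a1 i x := a i x + C * a (i + h)%N x.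
pose a2 i x := a i x - C * a (i + h)%N x.
pose b1 i x := b i x + C * b (i + h)%N x.
pose b2 i x := b i x - C * b (i + h)%N x.
have [r1 [d1 s1]] := IH C a1 b1 C0.
have C0' : - C != 0 by rewrite oppr_eq0.
have [r2 [d2 s2]] := IH (- C) a2 b2 C0'.
pose D := (C + C)^-1.
have CC0 : C + C != 0 by rewrite -mulr2n mulrn_eq0.
pose lo i x := (D * C) * (r1 i x + r2 i x).
pose hi i x := D * (r1 i x - r2 i x).
exists (fun i => if (i < h)%N then lo i else hi (i - h)%N); split; last first.
  move=> x; have [q1 E1] := s1 x; have [q2 E2] := s2 x.
  have [|||e E] := @split_modulus {poly R[i]} 'X^h C%:P D%:P
     (\poly_(i < h) a i x) (\poly_(i < h) a (i + h)%N x)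
     (\poly_(i < h) b i x) (\poly_(i < h) b (i + h)%N x)
     (\poly_(i < h) r1 i x) (\poly_(i < h) r2 i x) q1 q2.
  - by rewrite -polyCD -polyCM mulVf.
  - by rewrite !poly_scale !poly_add.
  - by move: E2; rewrite polyCN opprK => <-; rewrite !poly_scale !poly_sub.
  exists e; rewrite hh !poly_split E; congr (_ + _ * _).
    rewrite -polyCM poly_add poly_sub !poly_scale; congr (_ + _ * _).
      by apply/polyP => i; rewrite !coef_poly; case: ifP.
    apply/polyP => i; rewrite !coef_poly; case: ifP => // ih.
    by rewrite ltnNge leq_addl /= addnK.
  by rewrite -exprD -CC polyCM.
have Fa i : (i < h + h)%N -> cpair (a i) `<=` cfamily (2 ^ m.+1) a `|` cfamily (2 ^ m.+1) b.
  by rewrite -hh => ih f fi; left; exact: cpair_cfamily fi.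
have Fb i : (i < h + h)%N -> cpair (b i) `<=` cfamily (2 ^ m.+1) a `|` cfamily (2 ^ m.+1) b.
  by rewrite -hh => ih f fi; right; exact: cpair_cfamily fi.
have butterfly (F : set (In -> R)) u v : cpair u `<=` F -> cpair v `<=` F ->
    derives 12 F (cpair (fun x => u x + C * v x) `|` cpair (fun x => u x - C * v x)).
  move=> uF vF; rewrite -[12%N]/(8 + (2 + 2))%N.
  apply: (derives_chain (G := cpair (fun x => C * v x))); first exact: derives_cscale.
  by apply: derivesU; [apply: derives_cadd|apply: derives_csub] => f fi;
    (by right) || by left; apply: uF.
pose F0 := cfamily (2 ^ m.+1) a `|` cfamily (2 ^ m.+1) b.
have dA : derives (h * 12) F0 (cfamily h a1 `|` cfamily h a2).
  apply: derivesS (@derives_seq R In A 12 F0 h (fun i => cpair (a1 i) `|` cpair (a2 i)) _) => //.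
    by move=> f [[i ih fi]|[i ih fi]]; exists i => //; [left|right].
  move=> i ih; apply: butterfly; apply: Fa; first by rewrite (leq_trans ih) ?leq_addr.
  by rewrite ltn_add2r.
have dB : derives (h * 12) F0 (cfamily h b1 `|` cfamily h b2).
  apply: derivesS (@derives_seq R In A 12 F0 h (fun i => cpair (b1 i) `|` cpair (b2 i)) _) => //.
    by move=> f [[i ih fi]|[i ih fi]]; exists i => //; [left|right].
  move=> i ih; apply: butterfly; apply: Fb; first by rewrite (leq_trans ih) ?leq_addr.
  by rewrite ltn_add2r.
have combine (F : set (In -> R)) i : cpair (r1 i) `<=` F -> cpair (r2 i) `<=` F ->
    derives 20 F (cpair (lo i) `|` cpair (hi i)).
  move=> uF vF; rewrite -[20%N]/((2 + 8) + (2 + 8))%N; apply: derivesU.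
    apply: (derives_chain (G := cpair (fun x => r1 i x + r2 i x))); first exact: derives_cadd.
    by apply: derives_cscale => f; right.
  apply: (derives_chain (G := cpair (fun x => r1 i x - r2 i x))); first exact: derives_csub.
  by apply: derives_cscale => f; right.
have cE : fft_cost m.+1 = ((h * 12 + h * 12) + ((fft_cost m + fft_cost m) + h * 20))%N.
  by rewrite /fft_cost hh -/h; lia.
rewrite cE; apply: (derives_chain (derivesU dA dB)).
have e1 := derivesS _ (fun f H => H) d1; have e2 := derivesS _ (fun f H => H) d2.
have {}e1 : derives (fft_cost m) (F0 `|` ((cfamily h a1 `|` cfamily h a2) `|` (cfamily h b1 `|` cfamily h b2))) (cfamily h r1).
  by apply: e1 => f [Hf|Hf]; right; [left; left|right; left].
have {}e2 : derives (fft_cost m) (F0 `|` ((cfamily h a1 `|` cfamily h a2) `|` (cfamily h b1 `|` cfamily h b2))) (cfamily h r2).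
  by apply: e2 => f [Hf|Hf]; right; [left; right|right; right].
apply: (derives_chain (derivesU e1 e2)).
apply: (derivesS (@subset_refl _ _) _ (@derives_seq R In A 20 _ h (fun i => cpair (lo i) `|` cpair (hi i)) _)).
  move=> f [i /=]; rewrite hh; case: (ltnP i h) => ih ihh fi; first by exists i => //; left.
  by exists (i - h)%N; [rewrite /= ltn_subLR|right].
move=> i ih; apply: combine => f fi; right; [left|right]; exact: cpair_cfamily fi.
Qed.

(* The linear correlation has length below 2^m, so working modulo X^(2^m) - 1 loses nothing. *)
Lemma derives_correlation m N (u w : nat -> In -> R) F : (0 < N)%N -> (3 * N <= 2 ^ m)%N ->
  (forall i, F (u i)) -> (forall i, F (w i)) ->
  derives (fft_cost m).+1 F
    (\bigcup_(b in [set b | (b < N)%N]) [set (fun x => \sum_(i < N) u i x * w (i + b)%N x)]).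
Proof.
move=> N0 Nm Fu Fw; 
have [M ME] : exists M, M = (2 ^ m)%N by exists (2 ^ m)%N.
rewrite -ME in Nm.
(* Reversing [u] turns the correlation into a product: its value at lag [k] is the coefficient of
   degree [N.-1 + k]. *)
pose a i x : R[i] := if (i < N)%N then (u (N.-1 - i)%N x)%:C else 0.
pose b i x : R[i] := if (i < N + N)%N then (w i x)%:C else 0.
have [r [dr sr]] := @derives_mulmod m 1 a b (oner_neq0 _).
(* The additional instruction stores 0, used for padding and for imaginary parts. *)
rewrite -add1n; apply: (derives_chain (G := [set (fun=> 0)])); first exact: derives_const.
apply: derivesS dr.
  move=> f [[i iM]|[i iM]] /=.
    rewrite /cpair /a; case: (i < N)%N => -[->|->] /=; first by left; exact: Fu.
    - by right.
    - by right.
    - by right.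
  rewrite /cpair /b; case: (i < N + N)%N => -[->|->] /=; first by left; exact: Fw.
  - by right.
  - by right.
  - by right.
move=> f [k /= kN ->]; exists (N.-1 + k)%N; first by rewrite /=; lia.
left; apply/funext => x; have [q E] := sr x; rewrite -ME in E.
have sizeA : (size (\poly_(i < M) a i x) <= N)%N.
  apply/leq_sizeP => j Nj; by rewrite coef_poly /a [(j < N)%N]ltnNge Nj if_same.
have sizeB : (size (\poly_(i < M) b i x) <= N + N)%N.
  apply/leq_sizeP => j Nj; by rewrite coef_poly /b [(j < N + N)%N]ltnNge Nj if_same.
(* A nonzero multiple of X^M - 1 has degree at least [M], while the product and the remainder both
   have smaller degree because 3N <= M. *)
have q0 : q = 0.
  apply/eqP/negP => /negP qn0.
  have szM : size ('X^M - (1 : R[i])%:P) = M.+1 by rewrite size_XnsubC // ME expn_gt0.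
  have : (size (('X^M - 1%:P) * q : {poly R[i]})%R <= M)%N.
    have -> : ('X^M - 1%:P) * q = \poly_(i < M) a i x * \poly_(i < M) b i x - \poly_(i < M) r i x.
      by rewrite E addrAC subrr add0r.
    apply: (leq_trans (size_polyD _ _)); rewrite geq_max size_polyN size_poly andbT.
    apply: (leq_trans (size_polyMleq _ _)).
    by apply: leq_trans (leq_trans (leq_pred _) (leq_add sizeA sizeB)) _; lia.
  have Xn0 : 'X^M - (1 : R[i])%:P != 0 by rewrite -size_poly_eq0 szM.
  rewrite size_mul // szM addSn /= => h.
  move: qn0; rewrite -size_poly_eq0 -lt0n => s0.
  by move: (leq_trans (leq_add (leqnn M) s0) h); rewrite addn1 ltnn.
move: E; rewrite q0 mulr0 addr0 => /(congr1 (fun p : {poly R[i]} => p`_(N.-1 + k))).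
rewrite coefM !coef_poly ifT; last by rewrite /=; lia.
move=> <-.
rewrite -[LHS]/(complex.Re ((\sum_(i < N) u i x * w (i + k)%N x)%:C)); congr complex.Re; symmetry.
rewrite rmorph_sum /=.
rewrite (bigID (fun j : 'I_(N.-1 + k).+1 => (j < N)%N)) /= [X in _ + X]big1 => [|j]; last first.
  by rewrite -leqNgt => jN; rewrite coef_poly /a [(j < N)%N]ltnNge jN if_same mul0r.
rewrite addr0 (eq_bigl (fun j : 'I_(N.-1 + k).+1 => xpredT (j : nat) && (j < N)%N)) //.
rewrite (eq_bigr (fun j : 'I_(N.-1 + k).+1 => (fun j => (u (N.-1 - j)%N x * w (N.-1 + k - j)%N x)%:C) (j : nat))); last first.
  move=> j /andP[_ jN]; rewrite !coef_poly /a /b jN !ifT ?rmorphM //; lia.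
rewrite -(big_ord_widen_cond (N.-1 + k).+1 xpredT (fun j => (u (N.-1 - j)%N x * w (N.-1 + k - j)%N x)%:C)); last by lia.
rewrite (reindex_inj rev_ord_inj) /=; apply: eq_bigr => j _; congr (_ %:C).
have jN := ltn_ord j; congr (u _ x * w _ x); lia.
Qed.

End FastConvolution.

(** * Cost of the component-by-component search *)

(** [e] maps a to the a-th power, reduced modulo [n], of a generator of the cyclic group of units.
    It is defined on all exponents because the correlation uses sums of two of them. *)
Lemma prime_primitive_root n : prime n -> exists e : nat -> nat,
  [/\ forall a, (e a < n)%N, forall a b, ((e a * e b) %% n)%N = e (a + b)%N &
      forall c, (0 < c < n)%N -> exists2 b, (b < n.-1)%N & e b = c].
Proof.
move=> pn; have n0 := prime_gt0 pn.
have /cyclicP[u uE] := field_unit_group_cyclic [set: {unit 'F_n}]%G.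
pose g0 := nat_of_ord (val u).
have g0E : val u = g0%:R :> 'F_n by rewrite natr_Zp.
have eval (k : nat) : nat_of_ord (k%:R : 'F_n) = (k %% n)%N by rewrite val_Fp_nat.
exists (fun a => (g0 ^ a %% n)%N); split => [a|a b|c /andP[c0 cn]].
- by rewrite ltn_mod.
- by rewrite modnMml modnMmr expnD.
have cU : (c%:R : 'F_n) \is a GRing.unit.
  by rewrite unitfE -val_eqE /= eval modn_small // -lt0n.
have : FinRing.unit 'F_n cU \in <[u]>%g by rewrite -uE inE.
case/cyclePmin => b bu bE; exists b.
  by move: bu; rewrite orderE -uE card_finField_unit card_Fp.
have /(congr1 (@nat_of_ord _)) : (c%:R : 'F_n) = (g0 ^ b)%:R.
  by rewrite natrX -g0E -[LHS]/(val (FinRing.unit 'F_n cU)) bE FinRing.val_unitX.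
by rewrite !eval modn_small // => ->.
Qed.

(** A map from n - 1 exponents that covers the n - 1 nonzero residues is a bijection. *)
Lemma sum_primitive_root (V : nmodType) n (e : nat -> nat) (f : nat -> V) :
  (forall c, (0 < c < n)%N -> exists2 b, (b < n.-1)%N & e b = c) ->
  \sum_(1 <= i < n) f i = \sum_(b < n.-1) f (e b).
Proof.
move=> esurj; rewrite -(big_mkord xpredT (fun b => f (e b))) -(big_map e xpredT f).
have sub : {subset index_iota 1 n <= [seq e b | b <- index_iota 0 n.-1]}.
  move=> c; rewrite mem_index_iota => /esurj[b bn <-].
  by apply: map_f; rewrite mem_index_iota.
have sz : (size [seq e b | b <- index_iota 0 n.-1] <= size (index_iota 1 n))%N.
  by rewrite size_map !size_iota subn0 subn1.
have [_ eqi] := uniq_min_size (iota_uniq _ _) sub sz.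
apply: perm_big; apply: uniq_perm => //; first exact: iota_uniq.
by rewrite (uniq_size_uniq (iota_uniq 1 (n - 1)) eqi) size_map !size_iota subn0 subn1.
Qed.

Section CbcMinimizer.
Variables (R : realType) (n : nat) (a : R) (g : nat -> R).
Hypothesis n0 : (0 < n)%N.
Hypothesis a2 : 2^-1 < a.
Hypothesis g0 : forall j, 0 < g j.

Lemma is_cbc_mean d (y : nat -> 'I_n) : is_cbc a g (prefix_tuple d y) <->
  forall s, (s < d)%N -> (0 < y s)%N /\ forall c : 'I_n, (0 < c)%N ->
    cbc_mean a g s.+1 y <= cbc_mean a g s.+1 (upd y s c).
Proof.
have ext (s : 'I_d) c : cbc_extend (prefix_tuple d y) s c = prefix_tuple s.+1 (upd y s c).
  by apply: eq_from_tnth => j; rewrite !tnth_mktuple /upd.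
have err s (y' : nat -> 'I_n) :
    (lattice_korobov_error a g (prefix_tuple s y') ^+ 2 = (cbc_mean a g s y' - 1)%:E)%E.
  rewrite lattice_korobov_errorE // -EFin_expe sqr_sqrtr //.
  exact: kernel_mean_ge1.
have crit (s : 'I_d) c : (lattice_korobov_error a g (cbc_extend (prefix_tuple d y) s
      (tnth (prefix_tuple d y) s)) ^+ 2 <=
    lattice_korobov_error a g (cbc_extend (prefix_tuple d y) s c) ^+ 2)%E =
    (cbc_mean a g s.+1 y <= cbc_mean a g s.+1 (upd y s c)).
  by rewrite !ext !err lee_fin tnth_mktuple upd_id lerD2r.
split=> [h s sd|h s].
  have [h1 h2] := h (Ordinal sd); split; first by rewrite tnth_mktuple in h1.
  by move=> c /h2; rewrite crit.
have [h1 h2] := h s (ltn_ord s); split; first by rewrite tnth_mktuple.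
by move=> c /h2; rewrite crit.
Qed.

End CbcMinimizer.

(** * The search program and its correctness *)

Section CbcProgram.
Variables (R : realType) (n : nat).
Hypothesis pn : prime n.

(** Registers are functions of the pair (alpha, gamma): with [d] and [n] fixed, one program serves
    all such pairs. *)
Let In : Type := R * (nat -> R).
Let n0 : (0 < n)%N := prime_gt0 pn.

Definition cbc_kernel (k : nat) (x : In) : R := korobov_kernel x.1 (k%:R / n%:R).

Definition cbc_weight (j : nat) (x : In) : R := x.2 j.

Definition cbc_product (y : nat -> 'I_n) s i (x : In) : R :=
  \prod_(j < s) (1 + x.2 j / 2 * cbc_kernel ((i * y j) %% n) x).

(** The part of the kernel mean that depends on [c], up to an increasing affine map. The node
    [i = n] is left out since its kernel argument is 0 for every [c]; the remaining [i] are the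
    nonzero residues, which a primitive root enumerates. *)
Definition cbc_criterion (y : nat -> 'I_n) s (c : 'I_n) (x : In) : R :=
  \sum_(1 <= i < n) cbc_product y s i x * cbc_kernel ((i * c) %% n) x.

Lemma cbc_product_upd y s c t i : (t <= s)%N ->
  cbc_product (upd y s c) t i = cbc_product y t i.
Proof.
move=> ts; apply/funext => x; apply: eq_bigr => j _.
by rewrite /upd ltn_eqF // (leq_trans (ltn_ord j)).
Qed.

Lemma cbc_criterion_upd y s c t : (t <= s)%N ->
  cbc_criterion (upd y s c) t = cbc_criterion y t.
Proof.
move=> ts; apply/funext => c'; apply/funext => x; apply: eq_bigr => i _.
by rewrite cbc_product_upd.
Qed.

Lemma korobov_kernel_mod (a : R) k :
  korobov_kernel a (k%:R / n%:R) = korobov_kernel a ((k %% n)%:R / n%:R).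
Proof.
rewrite /korobov_kernel; congr (limn _); apply/funext => N.
apply: eq_bigr => h _; congr (_ * _ / _).
have n0' : n%:R != 0 :> R by rewrite pnatr_eq0 -lt0n.
have -> : k%:R / n%:R = (k %/ n)%:R + (k %% n)%:R / n%:R :> R.
  by rewrite {1}(divn_eq k n) natrD mulrDl natrM mulfK.
rewrite [_ * (_ + _)]mulrDr.
by rewrite -[_ * (k %/ n)%:R]mulrA -natrM -[X in cos (2 * pi * X + _)]/((h * (k %/ n))%N%:Z%:~R) cos2pi_int.
Qed.

Lemma cbc_mean_criterion y s c (x : In) :
  cbc_mean x.1 x.2 s.+1 (upd y s c) =
  n%:R^-1 * (\sum_(1 <= i < n.+1) cbc_product y s i x +
    x.2 s / 2 * (cbc_criterion y s c x + cbc_product y s n x * cbc_kernel 0 x)).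
Proof.
rewrite /cbc_mean /kernel_mean; congr (_ * _).
rewrite -[X in cbc_product y s n x * cbc_kernel X x](mod0n n) -(mul0n c).
rewrite (_ : cbc_criterion y s c x + _ =
   \sum_(1 <= i < n.+1) cbc_product y s i x * cbc_kernel ((i * c) %% n) x); last first.
  by rewrite big_nat_recr //= mul0n mod0n modnMr.
rewrite mulr_sumr -big_split /=; apply: eq_bigr => i _.
rewrite big_ord_recr /= tnth_mktuple /upd eqxx.
rewrite (eq_bigr (fun j : 'I_s => 1 + x.2 j / 2 * cbc_kernel ((i * y j) %% n) x)) => [|j _].
  by rewrite korobov_kernel_mod -/(cbc_product y s i x) -/(cbc_kernel _ x); ring.
by rewrite tnth_mktuple /= /upd ltn_eqF // korobov_kernel_mod.
Qed.

Definition cbc_optimal (y : nat -> 'I_n) s (x : In) := (0 < y s)%N /\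
  forall c : 'I_n, (0 < c)%N -> cbc_criterion y s (y s) x <= cbc_criterion y s c x.

(** The inputs on which the first [s] entries of [y] are the winners; each branch of the program has
    its own [y], through which its registers are described. *)
Definition cbc_domain (y : nat -> 'I_n) s : set In :=
  [set x | [/\ 2^-1 < x.1, weights x.2 & forall t, (t < s)%N -> cbc_optimal y t x]].

Definition cbc_registers d (y : nat -> 'I_n) s : set (In -> R) :=
  [set cbc_weight j | j in [set j | (j < d)%N]] `|`
  [set cbc_kernel k | k in [set k | (k < n)%N]] `|`
  [set cbc_product y s i | i in [set i | (i < n)%N]].

Lemma cbc_domain_is_cbc d y x : cbc_domain y d x -> is_cbc x.1 x.2 (prefix_tuple d y).
Proof.
move=> [a2 [_ _ g0] opt]; apply/is_cbc_mean => // s sd; have [y0 h] := opt s sd.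
split=> // c c0; rewrite -{1}(upd_id s y) !cbc_mean_criterion.
rewrite ler_pM2l ?invr_gt0 ?ltr0n // lerD2l ler_pM2l ?divr_gt0 // lerD2r.
exact: h.
Qed.

Section Steps.
Variables (A : Type) (d m : nat).
Hypothesis nm : (3 * n.-1 <= 2 ^ m)%N.

(* Rader: indexing the nonzero residues by powers of a primitive root turns the
   criteria of all candidates into one cyclic correlation. *)
Lemma derives_criterion y s : derives A (fft_cost m).+1 (cbc_registers d y s)
  [set cbc_criterion y s c | c in [set c : 'I_n | (0 < c)%N]].
Proof.
have [e [eb eD esurj]] := prime_primitive_root pn.
have n1 : (0 < n.-1)%N by rewrite -ltnS prednK // prime_gt1.
apply: (derivesS (@subset_refl _ _) _ (@derives_correlation R In A m n.-1
  (fun i => cbc_product y s (e i)) (fun i => cbc_kernel (e i)) _ n1 nm _ _)).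
- move=> _ [c /= c0 <-]; have [|b bn bc] := esurj c; first by rewrite c0 /=.
  exists b => //=; apply/funext => x; rewrite /cbc_criterion.
  rewrite (sum_primitive_root _ esurj) -bc.
  by apply: eq_bigr => i _; rewrite eD.
- by move=> i; right; exists (e i) => //; exact: eb.
- by move=> i; left; right; exists (e i) => //; exact: eb.
Qed.

Lemma derives_product y s c : (s < d)%N ->
  derives A (3 + n * 3) (cbc_registers d y s)
    [set cbc_product (upd y s c) s.+1 i | i in [set i | (i < n)%N]].
Proof.
move=> sd.
(* Three instructions produce 1, 2 and the halved weight; three more per node multiply in the new
   factor. *)
pose half (x : In) := arith_eval Div (x.2 s) 2.
have h1 : derives A 3 (cbc_registers d y s) ([set (fun=> 1)] `|` [set half]).
  rewrite -[3%N]/(1 + (1 + 1))%N; apply: derivesU; first exact: derives_const.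
  apply: (derives_chain (G := [set (fun=> 2)])); first exact: derives_const.
  by apply: derives_arith; [left; left; left; exists s|right].
apply: (derives_chain h1).
apply: (derivesS (@subset_refl _ _) _ (@derives_seq R In A 3 _ n (fun i => [set cbc_product (upd y s c) s.+1 i]) _)).
  by move=> _ [i /= im <-]; exists i.
move=> i im; rewrite -[3%N]/(1 + (1 + 1))%N.
have -> : cbc_product (upd y s c) s.+1 i = (fun x => arith_eval Mul (cbc_product y s i x)
    (arith_eval Add 1 (arith_eval Mul (half x) (cbc_kernel ((i * c) %% n) x)))).
  rewrite -(cbc_product_upd y c i (leqnn s)).
  by apply/funext => x; rewrite {1}/cbc_product big_ord_recr /= /upd eqxx.
have kn : ((i * c) %% n < n)%N by rewrite ltn_mod.
set F := _ `|` _; pose k := cbc_kernel ((i * c) %% n).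
pose hk (x : In) := arith_eval Mul (half x) (k x).
have Fp : F (cbc_product y s i) by left; right; exists i.
have Fk : F k by left; left; right; exists ((i * c) %% n)%N.
have F1 : F (fun=> 1) by right; left.
have Fh : F half by right; right.
apply: (derives_chain (G := [set hk])); first exact: derives_arith.
apply: (derives_chain (G := [set (fun x => arith_eval Add 1 (hk x))])).
  by apply: (@derives_arith _ _ _ _ Add (fun=> 1) hk); [left|right].
by apply: derives_arith; [left; left|right].
Qed.

(** The correlation, at most [n] comparisons, and the update of the products. *)
Definition cbc_step_cost := ((fft_cost m).+1 + (n + (3 + n * 3)))%N.

Lemma solves_step c y s (Phi : In -> A -> Prop) : (s < d)%N ->
  (forall y', solves (cbc_domain y' s.+1) c (cbc_registers d y' s.+1) Phi) ->
  solves (cbc_domain y s) (cbc_step_cost + c) (cbc_registers d y s) Phi.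
Proof.
move=> sd next.
pose G := cbc_registers d y s `|` [set cbc_criterion y s c | c in [set c : 'I_n | (0 < c)%N]].
rewrite /cbc_step_cost -!addnA; refine (solves_derives (@derives_criterion y s) _); rewrite -/G.
pose b : 'I_n := Ordinal (prime_gt1 pn).
pose cs := [seq c : 'I_n <- enum 'I_n | (0 < c)%N].
have csn : (size cs <= n)%N by rewrite size_filter (leq_trans (count_size _ _)) // size_enum_ord.
apply: solvesS (@solves_argmin R In A 'I_n (cbc_domain y s) (3 + n * 3 + c) G Phi
   (cbc_criterion y s) b cs [::] _ _ _).
- by move=> x hx; split.
- by rewrite !addnA !leq_add2r.
- by [].
- by right; exists b.
- by move=> e; rewrite mem_filter => /andP[e0 _]; right; exists e.
move=> b' b'in; have b'0 : (0 < b')%N.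
  by move: b'in; rewrite inE mem_filter => /predU1P[->|/andP[]].
have h := @derives_product y s b' sd.
have {}h := derivesS (@subsetUl _ (cbc_registers d y s) [set cbc_criterion y s c | c in [set c : 'I_n | (0 < c)%N]]) (@subset_refl _ _) h.
apply: (solves_derives h).
apply: solvesS (next (upd y s b')) => //.
- move=> x [[a2 w opt] hmin]; split => // t; rewrite ltnS leq_eqVlt => /predU1P[->|ts].
    rewrite /cbc_optimal cbc_criterion_upd // {1 2}/upd eqxx; split => // e e0.
    by apply: hmin; rewrite /= inE mem_filter e0 mem_enum orbT.
  have [yt ht] := opt t ts.
  by rewrite /cbc_optimal cbc_criterion_upd ?(ltnW ts) // {1 2}/upd ltn_eqF.
- by move=> f [[[j jd <-]|[k kn <-]]|hf]; [left; left; left; left; exists j|left; left; left; right; exists k|right].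
Qed.

Lemma solves_cbc (Phi : In -> A -> Prop) k s y : (s + k)%N = d ->
  (forall y', exists z, forall x, cbc_domain y' d x -> Phi x z) ->
  solves (cbc_domain y s) (k * cbc_step_cost) (cbc_registers d y s) Phi.
Proof.
move=> + fin; elim: k s y => [|k IH] s y skd.
  rewrite addn0 in skd; rewrite skd; have [z hz] := fin y.
  exact: solves_return hz.
rewrite mulSn; apply: solves_step; first by rewrite -skd addnS ltnS leq_addr.
by move=> y'; apply: IH; rewrite -skd addSnnS.
Qed.

End Steps.

Lemma cbc_program d m : (3 * n.-1 <= 2 ^ m)%N ->
  exists p : program R (d.-tuple 'I_n), (cost p <= 1 + d * cbc_step_cost m)%N /\
    forall a g, 2^-1 < a -> weights g -> is_cbc a g (run p (cbc_input d n a g)).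
Proof.
move=> nm; pose y : nat -> 'I_n := fun=> Ordinal n0.
pose Phi (x : In) (z : d.-tuple 'I_n) := is_cbc x.1 x.2 z.
have fin y' : exists z, forall x, cbc_domain y' d x -> Phi x z.
  by exists (prefix_tuple d y') => x; exact: cbc_domain_is_cbc.
have S := @solves_cbc (d.-tuple 'I_n) d m nm Phi d 0 y (add0n d) fin.
pose F := [set cbc_weight j | j in [set j | (j < d)%N]] `|`
  [set cbc_kernel k | k in [set k | (k < n)%N]].
have {}S : solves (cbc_domain y 0) (1 + d * cbc_step_cost m) F Phi.
  (* The empty products of dimension 0 are all the constant 1, stored by one initial instruction. *)
  refine (solves_derives (@derives_const R In _ F 1) _).
  apply: solvesS S => // f [|[i im <-]]; first by left.
  by right; apply/funext => x; rewrite /cbc_product big_ord0.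
pose mem := mkseq cbc_weight d ++ mkseq cbc_kernel n.
have sF : stored F mem.
  move=> f [[j jd <-]|[k kn <-]].
    exists j; first by rewrite size_cat !size_mkseq ltn_addr.
    by rewrite nth_cat size_mkseq jd nth_mkseq.
  exists (d + k)%N; first by rewrite size_cat !size_mkseq ltn_add2l.
  by rewrite nth_cat size_mkseq [(_ < d)%N]ltnNge leq_addr /= addKn nth_mkseq.
have [p [cp hp]] := S _ sF; exists p; split => // a g a2 wg.
have -> : cbc_input d n a g = memory mem (a, g).
  by rewrite /cbc_input /memory map_cat -!map_comp.
by apply: (hp (a, g)); split.
Qed.

End CbcProgram.

(** With [m] the rounded-up logarithm, 2^m is at most 6n, which makes the cost at most 175 d n m.
    Also 6n <= n^4 for n >= 2, so m ln 2 <= 4 ln n without an additive constant; 700 is 4 times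
    175. *)
Lemma cbc_program_cost (R : realType) d n : (0 < d)%N -> prime n ->
  exists2 m, (3 * n.-1 <= 2 ^ m)%N &
    (1 + d * cbc_step_cost n m)%:R <= 700 / ln 2 * d%:R * n%:R * ln n%:R :> R.
Proof.
move=> d0 pn; have n1 := prime_gt1 pn; pose m := up_log 2 (3 * n.-1).
have n3 : (1 < 3 * n.-1)%N by lia.
have /andP[lo hi] := up_log_bounds (isT : (1 < 2)%N) n3.
exists m => //; rewrite -/m in lo hi.
have m1 : (1 < m)%N.
  rewrite ltnNge; apply/negP => m1; have : (2 ^ m <= 2 ^ 1)%N by rewrite leq_exp2l.
  by lia.
have m6 : (2 ^ m <= 6 * n)%N.
  by rewrite -(ltn_predK m1) expnS; lia.
have m4 : (2 ^ m <= n ^ 4)%N.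
  apply: (leq_trans m6); rewrite expnSr leq_mul2r; apply/orP; right.
  by apply: (@leq_trans (2 ^ 3)%N); rewrite // leq_exp2r.
have c1 : (1 + d * cbc_step_cost n m <= 175 * (d * n * m))%N.
  rewrite /cbc_step_cost /fft_cost.
  have h1 : ((6 + 22 * m) * 2 ^ m <= (6 + 22 * m) * (6 * n))%N by rewrite leq_mul2l m6 orbT.
  have h2 : (1 + (((6 + 22 * m) * (6 * n)).+1 + (n + (3 + n * 3))) <= 175 * (n * m))%N by nia.
  rewrite -mulnA mulnCA.
  apply: (@leq_trans (d * (1 + (((6 + 22 * m) * (6 * n)).+1 + (n + (3 + n * 3)))))%N).
    rewrite [leqRHS]mulnDr muln1 leq_add // leq_mul2l; lia.
  by rewrite leq_mul2l h2 orbT.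
have l2 : 0 < ln (2 : R) by rewrite ln_gt0 // ltr1n.
have ml : m%:R * ln 2 <= 4 * ln n%:R :> R.
  rewrite !mulr_natl -!lnXn ?ltr0n // ?(ltnW n1) //.
  by rewrite ler_ln ?posrE ?exprn_gt0 ?ltr0n ?(ltnW n1) // -!natrX ler_nat.
apply: (@le_trans _ _ (175 * (d * n * m))%:R); first by rewrite ler_nat.
rewrite !natrM.
have -> : 700 / ln 2 * d%:R * n%:R * ln n%:R = 175 * (d%:R * n%:R * (4 * ln n%:R / ln 2)) :> R.
  by field; rewrite gt_eqF.
rewrite ler_wpM2l // ler_wpM2l ?mulr_ge0 //.
by rewrite ler_pdivlMr.
Qed.

(** * Lower bound for arbitrary cubature rules *)

Section Projector.
Variables (R : realFieldType) (m : nat).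

(** Gram-Schmidt: for a new vector v with residue u = v P nonzero, the rank-one projector onto u is
    subtracted, which lowers the trace by 1. *)
Lemma exists_projector (V : seq 'rV[R]_m) : exists P : 'M[R]_m,
  [/\ P^T = P, P *m P = P, m%:R - (size V)%:R <= \tr P &
      forall v, v \in V -> v *m P = 0].
Proof.
elim: V => [|v V [P [sP iP tP vP]]].
  by exists 1%:M; split; rewrite ?trmx1 ?mulmx1 ?subr0 ?mxtrace1.
have [u0|un0] := eqVneq (v *m P) 0.
  exists P; split => // [|y]; last by rewrite inE => /predU1P[->|/vP].
  by apply: le_trans tP; rewrite lerD2l lerN2 ler_nat /=.
set u := v *m P in un0; set s := (u *m u^T) 0 0.
have sE : u *m u^T = s%:M by rewrite [LHS]mx11_scalar.
have s0 : 0 < s.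
  have sS : s = \sum_j u 0 j ^+ 2.
    by rewrite /s mxE; apply: eq_bigr => j _; rewrite [u^T _ _]mxE expr2.
  rewrite sS lt_neqAle sumr_ge0 ?andbT => [|j _]; last exact: sqr_ge0.
  rewrite eq_sym; apply: contra un0; rewrite psumr_eq0 => [/allP h|j _]; last exact: sqr_ge0.
  apply/eqP/rowP => j; have := h j (mem_index_enum j); rewrite sqrf_eq0 => /eqP ->.
  by rewrite mxE.
have uP : u *m P = u by rewrite -mulmxA iP.
have Pu : P *m u^T = u^T by have := congr1 trmx uP; rewrite trmx_mul sP.
exists (P - s^-1 *: (u^T *m u)); split.
- by rewrite linearB linearZ /= trmx_mul trmxK sP.
- rewrite mulmxBl !mulmxBr iP -!scalemxAl -!scalemxAr mulmxA Pu -mulmxA uP.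
  have -> : u^T *m u *m (u^T *m u) = s *: (u^T *m u).
    by rewrite mulmxA -[u^T *m u *m u^T]mulmxA sE mul_mx_scalar scalemxAl.
  by rewrite !scalerA -mulrA mulVf ?gt_eqF // mulr1 subrr subr0.
- rewrite linearB linearZ /= mxtrace_mulC sE mxtrace_scalar mulVf ?gt_eqF //=.
  by rewrite -natr1 opprD addrA lerD2r.
move=> y; rewrite inE mulmxBr -scalemxAr => /predU1P[->|yV].
  have vu : v *m u^T = s%:M by rewrite -Pu mulmxA sE.
  by rewrite -/u mulmxA vu mul_scalar_mx scalerA mulVf ?gt_eqF // scale1r subrr.
have yu : y *m u^T = 0 by rewrite -Pu mulmxA vP // mul0mx.
by rewrite vP // mulmxA yu mul0mx scaler0 subr0.
Qed.

(** The trace is at least m/2, so some diagonal entry is at least 1/2; [c] is the corresponding row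
    of the projector. *)
Lemma exists_annihilator (V : seq 'rV[R]_m) : (0 < m)%N -> ((size V).*2 <= m)%N ->
  exists (k : 'I_m) (c : 'I_m -> R), [/\ 2^-1 <= c k, \sum_p c p ^+ 2 <= 1 &
    forall v, v \in V -> \sum_p c p * v 0 p = 0].
Proof.
move=> m0 Vm; have [P [sP iP tP vP]] := exists_projector V.
have Psym i j : P i j = P j i by rewrite -[in LHS]sP mxE.
have sq k : \sum_p P k p ^+ 2 = P k k.
  rewrite -[in RHS]iP mxE; apply: eq_bigr => p _; by rewrite [P p k]Psym.
have [k hk] : exists k, 2^-1 <= P k k.
  apply/existsP; rewrite -[[exists _, _]]negbK negb_exists; apply/negP => /forallP h.
  have : \tr P < \sum_(k < m) 2^-1.
    apply: ltr_sum => [|k _]; last by rewrite ltNge.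
    by apply/hasP; exists (Ordinal m0); rewrite ?mem_index_enum.
  rewrite sumr_const card_ord -[_ *+ m]mulr_natl ltNge => /negP; apply.
  apply: le_trans tP.
  have : ((size V).*2%:R : R) <= m%:R by rewrite ler_nat.
  by rewrite -muln2 natrM; lra.
exists k, (P k); split => //.
  (* [P k k] is the squared norm of its row, hence at least its own square, hence at most 1. *)
  rewrite sq; have : P k k ^+ 2 <= P k k.
    by rewrite -{2}sq (bigD1 k) //= lerDl sumr_ge0 // => j _; exact: sqr_ge0.
  have [//|lt] := leP (P k k) 1.
  by rewrite expr2 leNgt ltr_pMl ?lt // (lt_trans ltr01 lt).
move=> v vV; have := congr1 (fun M : 'rV_m => M 0 k) (vP v vV).
by rewrite [(_ *m _) _ _]mxE [(0 : 'rV_m) _ _]mxE => h; rewrite -[RHS]h; apply: eq_bigr => p _; rewrite mulrC Psym.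
Qed.
End Projector.

(** * The lower bound in the cosine space *)

Section CosineLowerBound.
Variables (R : realType) (d : nat) (a : R) (g : nat -> R).
Local Notation normc := Normc.normc.
Hypothesis d0 : (0 < d)%N.
Hypothesis a2 : 2^-1 < a.
Hypothesis g0 : forall j, 0 < g j.
Hypothesis g1 : g 0%N <= 1.

Let j0 : 'I_d := Ordinal d0.

(** Functions of the first coordinate alone already force the lower bound, so only frequencies on
    this axis occur. *)
Definition axis_tuple (p : nat) : d.-tuple nat := [tuple if j == 0%N :> nat then p else 0%N | j < d].

Lemma axis_tuple_inj : injective axis_tuple.
Proof.
by move=> p q /(congr1 (fun t => tnth t j0)); rewrite !tnth_mktuple eqxx.
Qed.

Lemma axis_tuple0 : axis_tuple 0 = nseq_tuple d 0%N.
Proof. by apply: eq_from_tnth => j; rewrite tnth_mktuple tnth_nseq if_same. Qed.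

Lemma cos_basis_axis p (x : d.-tuple R) : cos_basis (axis_tuple p) x = cos1 p (tnth x j0).
Proof.
rewrite cos_basisE (bigD1 j0) //= tnth_mktuple eqxx big1 ?mulr1 // => j jj0.
rewrite tnth_mktuple ifN; last by apply: contra jj0 => /eqP h; apply/eqP/val_inj.
by rewrite /cos1 eqxx mulr0 mul0r cos0 mulr1.
Qed.

Lemma rweight_axis p : rweight a g (map_tuple Posz (axis_tuple p)) = rfac a (g 0%N) p%:Z.
Proof.
rewrite /rweight (bigD1 j0) //= tnth_map tnth_mktuple eqxx big1 ?mulr1 // => j jj0.
rewrite tnth_map tnth_mktuple ifN; last by apply: contra jj0 => /eqP h; apply/eqP/val_inj.
by rewrite /rfac eqxx.
Qed.

Section Rule.
Variables (n : nat) (x : 'I_n -> d.-tuple R) (w : 'I_n -> R[i]).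
Hypothesis n0 : (0 < n)%N.
Hypothesis xc : forall i, cube R d (x i).

Definition axis_error (p : nat) : R[i] :=
  (p == 0%N)%:R - \sum_(i < n) w i * (cos1 p (tnth (x i) j0))%:C.

Variable (eps : R).
Hypothesis eps0 : 0 < eps.
Hypothesis err : (wor_error (cosine_space d a g) (cubature x w) <= eps%:E)%E.

(** Restricting the error formula to the axis. The argument works with these errors instead of
    building the test function and computing its norm. *)
Lemma axis_error_le (ps : seq nat) : uniq ps ->
  \sum_(p <- ps) normc (axis_error p) ^+ 2 / rfac a (g 0%N) p%:Z <= eps ^+ 2.
Proof.
move=> ups; move: err; rewrite /cubature.
rewrite (cosine_errorE a (index_enum 'I_n) w g0 xc); set S := esum _ _ => h.
have S0 : (0 <= S)%E.
  apply: esum_ge0 => k _; rewrite lee_fin divr_ge0 ?exprn_ge0 ?normc_ge0 //.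
  exact/ltW/rweight_gt0.
have {}h : (S <= (eps ^+ 2)%:E)%E.
  rewrite -lee_sqrt ?lee_fin ?sqr_ge0 //; apply: le_trans h _.
  by rewrite /= lee_fin sqrtr_sqr ler_norm.
rewrite -lee_fin; apply: le_trans h.
apply: esum_ge; exists [set` map axis_tuple ps] => //; first by split => //; exact: finite_seq.
rewrite fsbig_finite /=; last exact: finite_seq.
rewrite [leRHS](perm_big (map axis_tuple ps)) /=; last first.
  apply: uniq_perm => [||k]; rewrite ?fset_uniq ?map_inj_uniq //; try exact: axis_tuple_inj.
  by rewrite in_fset_set ?mem_setE //; exact: finite_seq.
rewrite big_map sumEFin lee_fin; apply: ler_sum => p _.
rewrite rweight_axis /axis_error -axis_tuple0 (inj_eq axis_tuple_inj).
by under [in leRHS]eq_bigr do rewrite cos_basis_axis.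
Qed.

(** Cauchy-Schwarz between [b] and the errors at the distinct frequencies [pi0 p], again by AM-GM;
    [t = eps / sqrt G] makes each half equal to [eps * sqrt G / 2]. *)
Lemma axis_piece_le (G : R) (ps : seq nat) (pi0 : nat -> nat) (b : nat -> R) :
  uniq (map pi0 ps) -> 0 < G -> (forall p, p \in ps -> rfac a (g 0%N) (pi0 p)%:Z <= G) ->
  \sum_(p <- ps) b p ^+ 2 <= 1 ->
  normc (\sum_(p <- ps) (b p)%:C * axis_error (pi0 p)) <= eps * Num.sqrt G.
Proof.
move=> ups G0 hG b1; apply: le_trans (ler_normc_sum _ _) _.
have sG : 0 < Num.sqrt G by rewrite sqrtr_gt0.
pose t := eps / Num.sqrt G; have t0 : 0 < t by rewrite divr_gt0.
apply: (@le_trans _ _ (\sum_(p <- ps) (t / 2 * G * b p ^+ 2 + (2 * t)^-1 *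
   (normc (axis_error (pi0 p)) ^+ 2 / rfac a (g 0%N) (pi0 p)%:Z)))).
  rewrite !big_seq; apply: ler_sum => p pps; rewrite Normc.normcM normc_real.
  set v := normc _; set r := rfac _ _ _; have r0 : 0 < r by exact: rfac_gt0.
  apply: (@le_trans _ _ (t / 2 * r * b p ^+ 2 + (2 * t)^-1 * (v ^+ 2 / r))); last first.
    rewrite lerD2r ler_wpM2r ?sqr_ge0 // ler_wpM2l ?hG // divr_ge0 // ltW //.
  rewrite -[b p ^+ 2]real_normK ?num_real // -subr_ge0.
  have -> : t / 2 * r * `|b p| ^+ 2 + (2 * t)^-1 * (v ^+ 2 / r) - `|b p| * v =
       (t * r * `|b p| - v) ^+ 2 / (2 * t * r).
    by field; rewrite !gt_eqF.
  by rewrite divr_ge0 ?sqr_ge0 // !mulr_ge0 // ltW.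
rewrite big_split /= -!mulr_sumr.
have := axis_error_le ups; rewrite big_map => h.
apply: (@le_trans _ _ (t / 2 * G * 1 + (2 * t)^-1 * eps ^+ 2)).
  rewrite lerD // ler_wpM2l // ?invr_ge0 ?mulr_ge0 ?invr_ge0 // ltW //.
rewrite le_eqVlt; apply/orP; left; apply/eqP; rewrite /t -{2}(sqr_sqrtr (ltW G0)).
by field; rewrite !gt_eqF.
Qed.

(* product-to-sum: phi_p phi_k = cosp phi_(p+k) + cosm phi_|p-k| *)
Definition sq2 (p : nat) : R := if p == 0%N then 1 else Num.sqrt 2.
Definition cosp (k p : nat) : R := sq2 p * sq2 k / (2 * sq2 (p + k)).
Definition cosm (k p : nat) : R := sq2 p * sq2 k / (2 * sq2 ((p - k) + (k - p))).

Lemma sq2_ge1 p : 1 <= sq2 p.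
Proof.
rewrite /sq2; case: eqP => // _; rewrite -[X in X <= _]sqrtr1 ler_sqrt //.
by rewrite ler1n.
Qed.

Lemma sq2_le p : sq2 p <= Num.sqrt 2.
Proof.
rewrite /sq2; case: eqP => // _; rewrite -[X in X <= _]sqrtr1 ler_sqrt //.
by rewrite ler1n.
Qed.

Lemma sq2_gt0 p : 0 < sq2 p.
Proof. exact: lt_le_trans (sq2_ge1 p). Qed.

Lemma cosp_itv k p q : 0 <= sq2 p * sq2 k / (2 * sq2 q) <= 1.
Proof.
rewrite divr_ge0 ?mulr_ge0 ?(ltW (sq2_gt0 _)) //= ler_pdivrMr ?mulr_gt0 ?sq2_gt0 // mul1r.
apply: (@le_trans _ _ (Num.sqrt 2 * Num.sqrt 2)).
  by apply: ler_pM; rewrite ?sq2_le ?(ltW (sq2_gt0 _)).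
by rewrite -expr2 sqr_sqrtr // ler_peMr // sq2_ge1.
Qed.

Lemma cos1_mul k p (y : R) :
  cos1 p y * cos1 k y = cosp k p * cos1 (p + k) y + cosm k p * cos1 ((p - k) + (k - p)) y.
Proof.
rewrite /cos1 -!/(sq2 _) /cosp /cosm.
have E : cos (pi * ((p - k) + (k - p))%N%:R * y) = cos (pi * p%:R * y - pi * k%:R * y).
  case: (leqP k p) => kp.
    rewrite (eqP kp) addn0 natrB //; congr cos; ring.
  rewrite (eqP (ltnW kp)) add0n natrB ?(ltnW kp) // -[RHS]cosN; congr cos; ring.
rewrite E natrD mulrDr mulrDl.
transitivity (sq2 p * sq2 k / 2 * (2 * (cos (pi * p%:R * y) * cos (pi * k%:R * y)))).
  by field.
rewrite cos_mul2; field; rewrite !gt_eqF ?sq2_gt0 //.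
Qed.

(** Both sides are the error of phi_p phi_k: on the left expanded by product-to-sum, on the right
    with its integral given by orthonormality. *)
Lemma axis_error_mul k p : (cosp k p)%:C * axis_error (p + k) +
   (cosm k p)%:C * axis_error ((p - k) + (k - p)) =
   (p == k)%:R - \sum_(i < n) w i * (cos1 p (tnth (x i) j0) * cos1 k (tnth (x i) j0))%:C.
Proof.
rewrite /axis_error !mulrBr addrACA -opprD; congr (_ - _).
  rewrite !addn_eq0 !subn_eq0 -eqn_leq.
  have [->|pk] := eqVneq p k; last first.
    rewrite mulr0 addr0 (_ : _ && _ = false) ?mulr0 //.
    by apply/negbTE; apply: contra pk => /andP[/eqP -> /eqP ->].
  rewrite andbb /cosp /cosm subnn addn0 /sq2 eqxx addn_eq0 andbb.
  case: eqP => k0; rewrite !(mulr0, mulr1, add0r, addr0) -?rmorphD.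
    by rewrite (_ : _ + _ = 1) //; field.
  by rewrite -expr2 sqr_sqrtr // divff.
rewrite !mulr_sumr -big_split /=; apply: eq_bigr => i _.
rewrite cos1_mul rmorphD !rmorphM /=; ring.
Qed.

(** The combination of the phi_p with coefficients [c] vanishes at the nodes, so whatever the
    weights, the error of its product with phi_k is the integral [c k], at least 1/2. The product
    has frequencies p + k, k - p and p - k, all below 4n; each of these three families contributes
    at most [eps * sqrt G]. *)
Lemma wor_error_lower : 2^-1 <=
  3 * (eps * Num.sqrt ((4 * n%:R) `^ (2 * a) / g 0%N)).
Proof.
set G := _ / _.
pose V : seq 'rV[R]_(n.*2) := [seq \row_p cos1 p (tnth (x i) j0) | i <- enum 'I_n].
have [||k [c [ck c1 cV]]] := @exists_annihilator R n.*2 V.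
- by rewrite double_gt0.
- by rewrite size_map size_enum_ord.
(* [cc] extends [c] by 0 to all naturals, so that sums can be split over lists of naturals. *)
pose cc p : R := if insub p is Some p' then c p' else 0.
have ccE (p : 'I_(n.*2)) : cc p = c p by rewrite /cc valK.
have tot : \sum_(p < n.*2) (cc p)%:C *
   ((cosp k p)%:C * axis_error (p + k) + (cosm k p)%:C * axis_error ((p - k) + (k - p))) = (c k)%:C.
  transitivity (\sum_(p < n.*2) ((c p)%:C * (p == k)%:R -
      \sum_(i < n) w i * (cos1 k (tnth (x i) j0))%:C * (c p * cos1 p (tnth (x i) j0))%:C)).
    apply: eq_bigr => p _; rewrite ccE axis_error_mul mulrBr; congr (_ - _).
    rewrite mulr_sumr; apply: eq_bigr => i _; rewrite !rmorphM /=; ring.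
  rewrite sumrB exchange_big /= [X in _ - X]big1 => [|i _].
    rewrite subr0 (bigD1 k) //= eqxx mulr1 big1 ?addr0 // => p /negbTE ->.
    by rewrite mulr0.
  rewrite -mulr_sumr -rmorph_sum /=.
  have := cV (\row_p cos1 p (tnth (x i) j0)); rewrite map_f ?mem_enum // => /(_ isT).
  rewrite (eq_bigr (fun p : 'I_(n.*2) => c p * cos1 p (tnth (x i) j0))) => [->|p _].
    by rewrite mulr0.
  by rewrite mxE.
(* Frequency 0 has weight 1, so [G] dominates it thanks to the first weight being at most 1. *)
have G1 : 1 <= G.
  rewrite ler_pdivlMr // mul1r (le_trans g1) // -[X in X <= _](powRr0 (4 * n%:R)).
  apply: ler_powR; first by rewrite -natrM ler1n muln_gt0.
  by rewrite mulr_ge0 // (le_trans _ (ltW a2)).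
have G0 : 0 < G by exact: lt_le_trans G1.
have rG q : (q <= 4 * n)%N -> rfac a (g 0%N) q%:Z <= G.
  move=> qn; rewrite /rfac; case: ifP => // _.
  rewrite ler_wpM2r ?invr_ge0 ?(ltW (g0 _)) // ge0_ler_powR ?nnegrE ?ler0n //.
  - by rewrite mulr_ge0 // (le_trans _ (ltW a2)).
  - by rewrite -natrM ler_nat absz_nat.
have b1 (b : nat -> R) (ps : seq nat) : uniq ps -> (forall p, p \in ps -> (p < n.*2)%N) ->
    (forall p, 0 <= b p <= 1) -> \sum_(p <- ps) (cc p * b p) ^+ 2 <= 1.
  move=> ups pn b01; apply: le_trans c1.
  apply: (@le_trans _ _ (\sum_(p <- ps) cc p ^+ 2)).
    apply: ler_sum => p _; have /andP[bp0 bp1] := b01 p.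
    by rewrite exprMn ler_piMr ?sqr_ge0 // expr_le1.
  under [leRHS]eq_bigr do rewrite -ccE.
  rewrite -(big_mkord xpredT (fun p => cc p ^+ 2)).
  apply: ler_sum_subseq => // [|p pps|p]; first exact: iota_uniq.
    by rewrite mem_index_iota pn.
  exact: sqr_ge0.
have bp p : 0 <= cosp k p <= 1 by exact: cosp_itv.
have bm p : 0 <= cosm k p <= 1 by exact: cosp_itv.
have kn := ltn_ord k.
(* The distance from p to k repeats values; it is injective in p on either side of k, hence the
   split. *)
pose lo := [seq p <- iota 0 n.*2 | (p <= k)%N].
pose hi := [seq p <- iota 0 n.*2 | (k < p)%N].
have T1 : normc (\sum_(p <- iota 0 n.*2) (cc p * cosp k p)%:C * axis_error (p + k)) <= eps * Num.sqrt G.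
  apply: axis_piece_le => //.
  - by rewrite map_inj_uniq ?iota_uniq // => p q; exact: addIn.
  - by move=> p; rewrite mem_iota => /andP[_ pn]; apply: rG; lia.
  - by apply: b1; rewrite ?iota_uniq // => p; rewrite mem_iota.
have T2 : normc (\sum_(p <- lo) (cc p * cosm k p)%:C * axis_error (k - p)) <= eps * Num.sqrt G.
  apply: axis_piece_le => //.
  - rewrite map_inj_in_uniq ?filter_uniq ?iota_uniq // => p q.
    by rewrite !mem_filter => /andP[pk _] /andP[qk _]; lia.
  - by move=> p _; apply: rG; lia.
  - apply: b1; rewrite ?filter_uniq ?iota_uniq // => p.
    by rewrite mem_filter mem_iota => /andP[_ /andP[]].
have T3 : normc (\sum_(p <- hi) (cc p * cosm k p)%:C * axis_error (p - k)) <= eps * Num.sqrt G.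
  apply: axis_piece_le => //.
  - rewrite map_inj_in_uniq ?filter_uniq ?iota_uniq // => p q.
    by rewrite !mem_filter => /andP[pk _] /andP[qk _]; lia.
  - by move=> p; rewrite mem_filter mem_iota => /andP[_ /andP[_ pn]]; apply: rG; lia.
  - apply: b1; rewrite ?filter_uniq ?iota_uniq // => p.
    by rewrite mem_filter mem_iota => /andP[_ /andP[]].
apply: (le_trans ck); rewrite -[c k]ger0_norm; last by rewrite (le_trans _ ck).
rewrite -normc_real -tot.
have -> : \sum_(p < n.*2) (cc p)%:C * ((cosp k p)%:C * axis_error (p + k) +
     (cosm k p)%:C * axis_error ((p - k) + (k - p))) =
   \sum_(p <- iota 0 n.*2) (cc p * cosp k p)%:C * axis_error (p + k) +
   (\sum_(p <- lo) (cc p * cosm k p)%:C * axis_error (k - p) +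
    \sum_(p <- hi) (cc p * cosm k p)%:C * axis_error (p - k)).
  rewrite -(big_mkord xpredT (fun p => (cc p)%:C * ((cosp k p)%:C * axis_error (p + k) +
     (cosm k p)%:C * axis_error ((p - k) + (k - p))))).
  rewrite /index_iota subn0.
  under eq_bigr do rewrite mulrDr !mulrA -!rmorphM.
  rewrite big_split /=; congr (_ + _).
  rewrite (bigID (fun p => (p <= k)%N)) /= -[X in X + _]big_filter -[X in _ + X]big_filter; congr (_ + _).
    rewrite !big_seq; apply: eq_bigr => p; rewrite mem_filter => /andP[pk _].
    by rewrite (eqP pk) add0n.
  rewrite (eq_filter (a2 := fun p => (k < p)%N)) => [|p]; last by rewrite ltnNge.
  rewrite !big_seq; apply: eq_bigr => p; rewrite mem_filter => /andP[pk _].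
  by rewrite (eqP (ltnW pk)) addn0.
apply: le_trans (le_normcD _ _) _.
have := le_normcD (\sum_(p <- lo) (cc p * cosm k p)%:C * axis_error (k - p))
  (\sum_(p <- hi) (cc p * cosm k p)%:C * axis_error (p - k)).
by lra.
Qed.
End Rule.
End CosineLowerBound.

(** * Convergence rates *)

Section Rates.
Variables (R : realType) (a : R) (g : nat -> R).
Hypothesis a2 : 2^-1 < a.
Hypothesis g0 : forall j, 0 < g j.

Lemma cbc_korobov_bound (l : R) d n (z : d.-tuple 'I_n) : (2 * a)^-1 < l <= 1 ->
  prime n -> is_cbc a g z ->
  (lattice_korobov_error a g z <=
    (((n%:R - 1)^-1 * (\prod_(j < d) (1 + cbc_factor a g l j) - 1)) `^ (2 * l)^-1)%:E)%E.
Proof.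
move=> /andP[al l1] pn cz; have n0 := prime_gt0 pn.
have a0 : 0 < 2 * a by rewrite mulr_gt0 // (lt_trans _ a2) // invr_gt0.
have l0 : 0 < l by apply: lt_trans al; rewrite invr_gt0.
have al1 : 1 < 2 * a * l by rewrite -ltr_pdivrMl // mulr1.
pose y j := nth (Ordinal n0) z j.
have zE : z = prefix_tuple d y.
  by apply: eq_from_tnth => j; rewrite tnth_mktuple (tnth_nth (Ordinal n0)).
move: cz; rewrite zE => /(is_cbc_mean n0 a2 g0) cz.
have := @cbc_bound R n a g l pn a2 g0 l0 l1 al1 d y (fun s sd => (cz s sd).2).
rewrite lattice_korobov_errorE // lee_fin -/(cbc_mean a g d y).
have e0 : 0 <= cbc_mean a g d y - 1 by exact: kernel_mean_ge1.
set e := _ - 1 in e0 *; set B := _ / _ => eB.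
rewrite [_^-1 * _]mulrC -/B -powR12_sqrt // (_ : e `^ 2^-1 = (e `^ l) `^ (2 * l)^-1).
  apply: ge0_ler_powR => //; first by rewrite invr_ge0 mulr_ge0 // ltW.
    by rewrite nnegrE powR_ge0.
  by rewrite nnegrE (le_trans (powR_ge0 _ _) eB).
by rewrite -powRrM invfM mulrCA mulfV ?mulr1 // gt_eqF.
Qed.

Lemma tent_error_le_bound (l : R) d n (z : d.-tuple 'I_n) D : (2 * a)^-1 < l <= 1 ->
  prime n -> is_cbc a g z -> (tent_error a g z D <= tent_rms_error a g z)%E ->
  (tent_error a g z D <=
    ((2 * (\prod_(j < d) (1 + cbc_factor a g l j) - 1)) `^ (2 * l)^-1 *
      n%:R `^ (- (2 * l)^-1))%:E)%E.
Proof.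
move=> hl pn cz /le_trans; apply.
have n0 := prime_gt0 pn; have n1 := prime_gt1 pn.
rewrite tent_rms_errorE // -lattice_korobov_errorE //.
apply: le_trans (cbc_korobov_bound hl pn cz) _; rewrite lee_fin.
have a0 : 0 < 2 * a by rewrite mulr_gt0 // (lt_trans _ a2) // invr_gt0.
have l0 : 0 < l by case/andP: hl => al _; apply: lt_trans al; rewrite invr_gt0.
have P0 : 0 <= \prod_(j < d) (1 + cbc_factor a g l j) - 1.
  by rewrite subr_ge0 cbc_factor_prod_ge1 // -ltr_pdivrMl // mulr1; case/andP: hl.
set P := _ - 1 in P0 *.
have nR : 2 <= n%:R :> R by rewrite ler_nat.
have nB (r : R) : n%:R `^ (- r) = n%:R^-1 `^ r by rewrite -powR_inv1 // -powRrM mulN1r.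
rewrite nB -powRM ?invr_ge0 ?mulr_ge0 //.
rewrite ge0_ler_powR ?nnegrE ?invr_ge0 ?mulr_ge0 ?invr_ge0 ?(ltW l0) //; first by lra.
(* 1/(n-1) <= 2/n for n >= 2, the origin of the factor 2 in the constant. *)
rewrite mulrAC ler_wpM2r // -[2 / n%:R]invrK invfM invrK lef_pV2 ?posrE; lra.
Qed.

(** From 1 + x <= exp x; the dimension then enters only through a partial sum of the weights to the
    power [l]. *)
Lemma prod_cbc_factor_le (l : R) d : 1 < 2 * a * l ->
  \prod_(j < d) (1 + cbc_factor a g l j) <=
  expR (2 `^ (1 - l) * zeta (2 * a * l) * \sum_(0 <= j < d) g j `^ l).
Proof.
move=> al; rewrite big_mkord mulr_sumr expR_sum; apply: ler_prod => j _.
by rewrite expR_ge1Dx addr_ge0 ?cbc_factor_ge0.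
Qed.

End Rates.

Lemma no_better_rate (R : realType) (a : R) (g : nat -> R) d (b C : R)
    (x : forall n, 'I_n -> d.-tuple R) (w : forall n, 'I_n -> R[i]) :
  2^-1 < a -> weights g -> (0 < d)%N -> a < b -> (forall n i, cube R d (x n i)) ->
  ~ \forall n \near \oo,
      (wor_error (cosine_space d a g) (cubature (x n) (w n)) <= (C * n%:R `^ (- b))%:E)%E.
Proof.
move=> a2 [g1 _ g0] d0 ab xc [N _ hN].
(* Chosen so that the lower bound reads 1/2 <= K/2 times n^(-(b-a)), which fails once n exceeds
   K^(1/(b-a)). The summand 1 keeps [eps] positive. *)
pose K := 6 * (`|C| + 1) * (4 `^ a * Num.sqrt (g 0%N)^-1).
have K0 : 0 < K by rewrite !mulr_gt0 ?ltr_wpDl ?powR_gt0 // sqrtr_gt0 invr_gt0.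
have ba : 0 < b - a by rewrite subr_gt0.
pose n := (N + Num.bound (K `^ (b - a)^-1))%N.
have nK : K `^ (b - a)^-1 < n%:R.
  by rewrite (lt_le_trans (archi_boundP (powR_ge0 _ _))) // ler_nat leq_addl.
have nR : 0 < n%:R :> R by apply: le_lt_trans nK; exact: powR_ge0.
have n0 : (0 < n)%N by rewrite ltr0n in nR.
pose eps := (`|C| + 1) * n%:R `^ (- b).
have eps0 : 0 < eps by rewrite mulr_gt0 ?ltr_wpDl ?powR_gt0.
have err : (wor_error (cosine_space d a g) (cubature (x n) (w n)) <= eps%:E)%E.
  apply: le_trans (hN n _) _; first by rewrite /= leq_addr.
  by rewrite lee_fin ler_wpM2r ?powR_ge0 // (le_trans (ler_norm _)) // lerDl.
have := wor_error_lower d0 a2 g0 g1 n0 (xc n) eps0 err.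
have -> : 3 * (eps * Num.sqrt ((4 * n%:R) `^ (2 * a) / g 0%N)) = 2^-1 * (K * n%:R `^ (- (b - a))).
  rewrite sqrtrM ?powR_ge0 // -[Num.sqrt (_ `^ _)]powR12_sqrt ?powR_ge0 // -powRrM.
  rewrite [2 * a]mulrC mulfK // powRM // opprB powRD ?(gt_eqF nR) ?implybT // /K /eps.
  by field.
rewrite ler_pMr ?invr_gt0 // powRN ler_pdivlMr ?powR_gt0 // mul1r.
apply/negP; rewrite -ltNge [X in X < _](_ : K = (K `^ (b - a)^-1) `^ (b - a)); last first.
  by rewrite -powRrM mulVf ?gt_eqF // powRr1 // ltW.
by rewrite gt0_ltr_powR ?nnegrE ?powR_ge0 ?(ltW nR).
Qed.

Theorem corollary2 (R : realType) :
  (* a fast component-by-component algorithm, with cost O(d n log n) *)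
  (exists C : R, forall d n : nat, (0 < d)%N -> prime n ->
     exists p : program R (d.-tuple 'I_n),
       (cost p)%:R <= C * d%:R * n%:R * ln n%:R /\
       forall (alpha : R) (gamma : nat -> R), 2^-1 < alpha -> weights gamma ->
         is_cbc alpha gamma (run p (cbc_input d n alpha gamma)))
  /\
  forall (alpha : R) (gamma : nat -> R), 2^-1 < alpha -> weights gamma ->
  [/\ (* existence of a shift, and the error bounds *)
      forall (d n : nat) (z : d.-tuple 'I_n),
        (0 < d)%N -> prime n -> is_cbc alpha gamma z ->
        exists Delta : d.-tuple R,
          [/\ cube R d Delta,
              (tent_error alpha gamma z Delta <= tent_rms_error alpha gamma z)%E,
              tent_rms_error alpha gamma z = lattice_korobov_error alpha gamma z &
              forall lambda : R, (2 * alpha)^-1 < lambda <= 1 ->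
                (lattice_korobov_error alpha gamma z <=
                 (((n%:R - 1)^-1 *
                   (\prod_(j < d) (1 + 2 `^ (1 - lambda) *
                        zeta (2 * alpha * lambda) * gamma j `^ lambda) - 1))
                  `^ (2 * lambda)^-1)%:E)%E],
      (* rate O(n^(-1/(2 lambda))) for fixed d *)
      forall lambda : R, (2 * alpha)^-1 < lambda <= 1 ->
      forall d : nat, (0 < d)%N ->
      exists C : R, forall (n : nat) (z : d.-tuple 'I_n) (Delta : d.-tuple R),
        prime n -> is_cbc alpha gamma z -> cube R d Delta ->
        (tent_error alpha gamma z Delta <= tent_rms_error alpha gamma z)%E ->
        (tent_error alpha gamma z Delta <=
           (C * n%:R `^ (- (2 * lambda)^-1))%:E)%E,
      (* implied constant independent of d for summable gamma^lambda *)
      forall lambda : R, (2 * alpha)^-1 < lambda <= 1 ->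
      (\sum_(0 <= j <oo) (gamma j `^ lambda)%:E < +oo)%E ->
      exists C : R, forall (d n : nat) (z : d.-tuple 'I_n) (Delta : d.-tuple R),
        (0 < d)%N -> prime n -> is_cbc alpha gamma z -> cube R d Delta ->
        (tent_error alpha gamma z Delta <= tent_rms_error alpha gamma z)%E ->
        (tent_error alpha gamma z Delta <=
           (C * n%:R `^ (- (2 * lambda)^-1))%:E)%E,
      (* rate O(n^(-alpha + delta)) for fixed d *)
      forall d : nat, (0 < d)%N ->
      forall delta : R, 0 < delta ->
      exists C : R, forall (n : nat) (z : d.-tuple 'I_n) (Delta : d.-tuple R),
        prime n -> is_cbc alpha gamma z -> cube R d Delta ->
        (tent_error alpha gamma z Delta <= tent_rms_error alpha gamma z)%E ->
        (tent_error alpha gamma z Delta <=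
           (C * n%:R `^ (- alpha + delta))%:E)%E &
      (* no sequence of n-point linear cubature rules has rate O(n^(-beta)) *)
      forall d : nat, (0 < d)%N ->
      forall beta : R, alpha < beta ->
      ~ exists (x : forall n, 'I_n -> d.-tuple R) (w : forall n, 'I_n -> R[i])
               (C : R),
          (forall n i, cube R d (x n i)) /\
          \forall n \near \oo,
            (wor_error (cosine_space d alpha gamma) (cubature (x n) (w n)) <=
               (C * n%:R `^ (- beta))%:E)%E].
Proof.
split.
  exists (700 / ln 2) => d n d0 pn.
  have [m nm mc] := cbc_program_cost R d0 pn.
  have [p [cp hp]] := cbc_program R pn d nm.
  by exists p; split; [apply: le_trans mc; rewrite ler_nat|exact: hp].
move=> a g a2 wg; have g0 : forall j, 0 < g j by case: wg.
have a0 : 0 < 2 * a by rewrite mulr_gt0 // (lt_trans _ a2) // invr_gt0.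
have lal l : (2 * a)^-1 < l <= 1 -> 1 < 2 * a * l.
  by case/andP=> al _; rewrite -ltr_pdivrMl // mulr1.
have fixed_d l d : (2 * a)^-1 < l <= 1 ->
    exists C : R, forall n (z : d.-tuple 'I_n) D, prime n -> is_cbc a g z ->
      (tent_error a g z D <= tent_rms_error a g z)%E ->
      (tent_error a g z D <= (C * n%:R `^ (- (2 * l)^-1))%:E)%E.
  by move=> hl; eexists => n z D pn cz; exact: tent_error_le_bound.
split.
- move=> d n z _ pn cz; have n0 := prime_gt0 pn.
  have [D cD le] := exists_good_shift z n0 a2 g0; exists D; split => //.
    by rewrite tent_rms_errorE // lattice_korobov_errorE.
  by move=> l hl; exact: cbc_korobov_bound.
- move=> l hl d _; have [C hC] := fixed_d l d hl.
  by exists C => n z D pn cz _; exact: hC.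
- move=> l hl Sfin; have l0 : 0 < l by case/andP: hl => al _; apply: lt_trans al; rewrite invr_gt0.
  pose S := fine (\sum_(0 <= j <oo) (g j `^ l)%:E)%E.
  have SE d : \sum_(0 <= j < d) g j `^ l <= S.
    rewrite -lee_fin fineK ?ge0_fin_numE ?nneseries_ge0 // => [|j _ _]; last by rewrite lee_fin powR_ge0.
    by rewrite -sumEFin; apply: nneseries_lim_ge => j _ _; rewrite lee_fin powR_ge0.
  exists ((2 * expR (2 `^ (1 - l) * zeta (2 * a * l) * S)) `^ (2 * l)^-1).
  move=> d n z D _ pn cz _ le.
  apply: le_trans (tent_error_le_bound a2 g0 hl pn cz le) _.
  rewrite lee_fin ler_wpM2r ?powR_ge0 // ge0_ler_powR ?nnegrE ?invr_ge0 ?mulr_ge0 ?(ltW l0) ?expR_ge0 //.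
    by rewrite subr_ge0 cbc_factor_prod_ge1 // lal.
  rewrite ler_pM2l // lerBlDr (le_trans (prod_cbc_factor_le _ _ (lal _ hl))) //.
  by rewrite ler_wpDr // ler_expR ler_wpM2l // mulr_ge0 ?powR_ge0 ?zeta_ge0 ?lal.
- move=> d _ delta delta0.
  (* The exponent 1/(2l) is a - delta when that is admissible; if a - delta <= 1/2, the value l = 1
     already gives a sufficient rate. *)
  pose l := if a - delta <= 2^-1 then 1 else (2 * (a - delta))^-1.
  have [hl ld] : (2 * a)^-1 < l <= 1 /\ - (2 * l)^-1 <= - a + delta.
    rewrite /l; case: (leP (a - delta) 2^-1) => ad.
      split; last by rewrite mulr1; lra.
      by rewrite lexx andbT invf_lt1 //; lra.
    have ad0 : 0 < 2 * (a - delta) by lra.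
    split.
      by rewrite ltf_pV2 ?posrE // invf_le1 //; apply/andP; split; lra.
    by rewrite invf_div [2 * _]mulrC mulfK // opprB addrC.
  (* The sign of [C] is unknown, and comparing the two powers of [n] takes a nonnegative factor. *)
  have [C hC] := fixed_d l d hl; exists `|C| => n z D pn cz _ le.
  apply: le_trans (hC n z D pn cz le) _; rewrite lee_fin.
  apply: le_trans (ler_wpM2r (powR_ge0 _ _) (ler_norm C)) _.
  by rewrite ler_wpM2l // ler_powR // ler1n prime_gt0.
- move=> d d0 b ab [x [w [C [xc hC]]]].
  exact: (@no_better_rate R a g d b C x w a2 wg d0 ab xc hC).
Qed.
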